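(* Let $F$ be a sufficiently smooth function. Then ${\bf E}\bigl[F\bigl(\int_{\mathcal D}\varphi(x)\,M_\mu(dx)\bigr)\bigr]$ has the formal intermittency expansion (as a formal power series in $\mu$) $$ {\bf E}\Bigl[F\Bigl(\int_{\mathcal D}\varphi(x)\,M_\mu(dx)\Bigr)\Bigr]=F(\bar\varphi)+\sum_{n=1}^\infty\frac{\mu^n}{n!}\Bigl[\sum_{k=2}^{2n}F^{(k)}(\bar\varphi)\,H_{n,k}(\varphi)\Bigr]. $$ The expansion coefficients $H_{n,k}(\varphi)=\int_{\mathcal D^k}h_{n,k}(x)\,dx$ are given by the binomial transform of the derivatives of the positive integer moments at zero intermittency, $$ H_{n,k}(\varphi)=\frac{(-1)^k}{k!}\sum_{l=2}^k(-1)^l\binom{k}{l}\,\bar\varphi^{\,k-l}\,\frac{\partial^nS_l[\varphi]}{\partial\mu^n}\Big|_{\mu=0}. $$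
   Context: Setting. $X(y)$ is a centered (regularized) Gaussian process on $\mathbb{R}^d$ with covariance $g(x,y)={\bf Cov}(X(x),X(y))$, where $g$ may depend on a regularization parameter $\varepsilon>0$ that is suppressed from the notation. For $\mu>0$ (the intermittency), $$\omega_\mu(y)=\sqrt{\mu}\,X(y)-\frac{\mu}{2}{\bf Var}\,X(y),$$ and the random measure is $M_\mu(dy)=e^{\omega_\mu(y)}\,dy$; integration with respect to $M_\mu$ is understood in the sense of the $\varepsilon\to0$ limit. $\mathcal D\subset\mathbb{R}^d$ is a fixed compact region, $\varphi>0$ a fixed function on $\mathcal D$, and $\bar\varphi=\int_{\mathcal D}\varphi(x)\,dx$. $F^{(k)}$ is the $k$th derivative of $F$. The positive integer moments of the total mass are given formally by $$S_l[\varphi](\mu)=\int_{\mathcal D^l}\prod_{i=1}^l\varphi(x_i)\,\exp\Bigl(\mu\sum_{1\le i<j\le l}g(x_i,x_j)\Bigr)dx_1\cdots dx_l .$$ The functions $h_{n,k}(x_1,\dots,x_k)$, $n\ge1$, $2\le k\le 2n$, are defined by $h_{1,2}(x_1,x_2)=\frac12g(x_1,x_2)\varphi(x_1)\varphi(x_2)$ and $$h_{n+1,k}(x_1\cdots x_k)=\tfrac12h_{n,k-2}(x_1\cdots x_{k-2})g(x_{k-1},x_k)\varphi(x_{k-1})\varphi(x_k)+h_{n,k-1}(x_1\cdots x_{k-1})\Bigl(\sum_{i=1}^{k-1}g(x_i,x_k)\Bigr)\varphi(x_k)+h_{n,k}(x_1\cdots x_k)\sum_{1\le i<j\le k}g(x_i,x_j),$$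 with $h_{n,k}=0$ for $k$ outside $2,\dots,2n$. The expansion is asserted formally, in the sense of equality of formal power series in $\mu$; convergence is not part of the claim.
   Formalization: Proved as an asymptotic series at μ→0+, with F smooth on (0,∞), F of the total mass bounded in L^q for some q>1 as μ→0, and g_ε→g a.e. dominated by G with exp(cG)φφ integrable; without growth control the expectation can be infinite (F=exp, g=1). *)

(* Defs.v *)
From HB Require Import structures.
From mathcomp Require Import all_boot all_order all_algebra.
From mathcomp Require Import all_classical all_reals all_analysis.

Set Implicit Arguments.
Unset Strict Implicit.
Unset Printing Implicit Defensive.

Import Order.TTheory GRing.Theory Num.Theory.
Import numFieldNormedType.Exports.

Local Open Scope classical_set_scope.
Local Open Scope ring_scope.

Section power_measure_step.
Context {d : measure_display} {T : measurableType d} {R : realType}.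
Variable m : {sigma_finite_measure set T -> \bar R}.
Variable n : nat.
Variable mn : {sigma_finite_measure set n.-tuple T -> \bar R}.

Definition tuple_cons (p : T * n.-tuple T) : n.+1.-tuple T :=
  [the n.+1.-tuple T of p.1 :: p.2].

Lemma measurable_tuple_cons : measurable_fun setT tuple_cons.
Proof. exact: measurable_cons. Qed.

Definition tuple_uncons (x : n.+1.-tuple T) : T * n.-tuple T :=
  (thead x, [tuple of behead x]).

Lemma measurable_tuple_uncons : measurable_fun setT tuple_uncons.
Proof.
apply/measurable_fun_pairP; split.
  exact: measurable_tnth.
exact: measurable_behead.
Qed.

Lemma tuple_consK : cancel tuple_cons tuple_uncons.
Proof. by case=> a t; congr pair; apply: val_inj. Qed.

Definition power_step : set (n.+1.-tuple T) -> \bar R :=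
  pushforward (m \x mn)%E tuple_cons.

Let power_step0 : power_step set0 = 0%E.
Proof. by rewrite /power_step /pushforward preimage_set0 measure0. Qed.

Let power_step_ge0 A : (0 <= power_step A)%E.
Proof. by rewrite /power_step /pushforward; apply: measure_ge0. Qed.

Let power_step_sigma_additive : semi_sigma_additive power_step.
Proof.
move=> F mF tF mUF; rewrite /power_step /pushforward preimage_bigcup.
apply: measure_semi_sigma_additive.
- by move=> i; rewrite -[X in measurable X]setTI; exact: measurable_tuple_cons.
- apply/trivIsetP => /= i j _ _ ij; rewrite -preimage_setI.
  by move/trivIsetP : tF => /(_ _ _ _ _ ij) ->//; rewrite preimage_set0.
- rewrite -preimage_bigcup -[X in measurable X]setTI.
  exact: measurable_tuple_cons.
Qed.

HB.instance Definition _ := isMeasure.Build _ _ _ power_step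
  power_step0 power_step_ge0 power_step_sigma_additive.

Let power_step_sigma_finite : sigma_finite setT power_step.
Proof.
have /sigma_finiteP[F [TF ndF Foo]] := sigma_finiteT m.
have /sigma_finiteP[G [TG ndG Goo]] := sigma_finiteT mn.
exists (fun i => tuple_uncons @^-1` (F i `*` G i)).
  rewrite -preimage_bigcup [X in _ @^-1` X](_ : _ = setT) ?preimage_setT//.
  apply/seteqP; split=> // -[x y] _.
  have [i _ Fx] : (\bigcup_i F i) x by rewrite -TF.
  have [j _ Gy] : (\bigcup_j G j) y by rewrite -TG.
  exists (maxn i j) => //; split => /=.
    by move: x Fx; exact/subsetPset/ndF/leq_maxl.
  by move: y Gy; exact/subsetPset/ndG/leq_maxr.
move=> i; have [mF Fi] := Foo i; have [mG Gi] := Goo i.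
have mFG : measurable (F i `*` G i) by exact: measurableX.
split.
  by rewrite -[X in measurable X]setTI; exact: measurable_tuple_uncons.
rewrite /power_step /pushforward -comp_preimage.
rewrite (_ : tuple_uncons \o tuple_cons = id); last exact/funext/tuple_consK.
by rewrite preimage_id product_measure1E// lte_mul_pinfty// ge0_fin_numE.
Qed.

HB.instance Definition _ := Measure_isSigmaFinite.Build _ _ _ power_step
  power_step_sigma_finite.

End power_measure_step.

(* The n-fold product measure m^n on T^n. *)
Fixpoint power_measure {d : measure_display} {T : measurableType d}
    {R : realType} (m : {sigma_finite_measure set T -> \bar R}) (n : nat) :
    {sigma_finite_measure set n.-tuple T -> \bar R} :=
  match n with
  | 0 => \d_([tuple] : 0.-tuple T)
  | n'.+1 => power_step m (power_measure m n')
  end.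

(* R^d with its product (i.e. Borel) sigma-algebra; measurableTypeR R is R with
   the sigma-algebra on which lebesgue_measure is declared. *)
Notation Rvec R d := (d.-tuple (measurableTypeR R)).

Definition lebesgue_Rd (R : realType) (d : nat) :
    {sigma_finite_measure set (Rvec R d) -> \bar R} :=
  power_measure (@lebesgue_measure R) d.

(* Tuples carry no topology in the library; that of R^d comes from 'rV_d. *)
Definition compact_region (R : realType) (d : nat) (D : set (Rvec R d)) :=
  compact [set \row_(i < d) (tnth x i : R) | x in D].

Definition set_power {T : Type} (D : set T) (n : nat) : set (n.-tuple T) :=
  [set x | forall i, D (tnth x i)].
Arguments set_power {T} D n.

Section gaussian_process.
Context {d : measure_display} {Omega : measurableType d} {R : realType}.
Variable P : probability Omega R.

(* Law N(0, s^2). The case s = 0 is separate because the library's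
   normal_prob 0 0 is not a Dirac mass. *)
Definition centered_gaussian (Y : Omega -> R) : Prop :=
  measurable_fun setT Y /\
  exists s : R, forall A : set R, measurable A ->
    P (Y @^-1` A) = (if s == 0 then \d_(0 : R) A else normal_prob 0 s A).

Definition centered_gaussian_process (I : Type) (X : I -> Omega -> R)
    (g : I -> I -> R) : Prop :=
  (forall (n : nat) (a : 'I_n -> R) (y : 'I_n -> I),
     centered_gaussian (fun w => \sum_(i < n) a i * X (y i) w)) /\
  (forall x y : I, covariance P (X x) (X y) = (g x y)%:E).

Definition cvg_in_law (Y_ : R -> Omega -> R) (Y : Omega -> R) : Prop :=
  forall f : R -> R, continuous f -> (exists M, forall x, `|f x| <= M) ->
    (fun eps => 'E_P[f \o Y_ eps]%E) @ (0 : R)^'+ --> 'E_P[f \o Y]%E.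

End gaussian_process.

Section chaos.
Context {dO : measure_display} {Omega : measurableType dO} {R : realType}.
Context {d : measure_display} {T : measurableType d}.
Variables (P : probability Omega R) (m : {sigma_finite_measure set T -> \bar R}).
Variables (D : set T) (phi : T -> R).

Definition omega (X : T -> Omega -> R) (mu : R) (y : T) (w : Omega) : R :=
  Num.sqrt mu * X y w - mu / 2 * fine ('V_P[X y])%E.

(* The integral over D of phi(x) M_mu(dx), M_mu(dx) = exp(omega_mu(x)) dx, for
   a regularized process X. *)
Definition phi_mass (X : T -> Omega -> R) (mu : R) (w : Omega) : R :=
  \int[m]_(y in D) (phi y * expR (omega X mu y w)).

Definition phi_bar : R := \int[m]_(x in D) phi x.

Variable g : T -> T -> R.

Definition pair_sum (k : nat) (x : nat -> T) : R :=
  \sum_(j < k) \sum_(i < j) g (x i) (x j).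

(* A point (x_1, ..., x_k) is given by a sequence x : nat -> T of which only
   x 0, ..., x k.-1 are used. *)
Definition moment_integrand (l : nat) (mu : R) (x : nat -> T) : R :=
  (\prod_(i < l) phi (x i)) * expR (mu * pair_sum l x).

Fixpoint h_coef (n k : nat) (x : nat -> T) : R :=
  match n with
  | 0 => 0
  | n'.+1 =>
    if n' is 0 then
      (if k == 2%N then 2^-1 * g (x 0%N) (x 1%N) * phi (x 0%N) * phi (x 1%N)
       else 0)
    else if (2 <= k <= n.*2)%N then
      2^-1 * h_coef n' k.-2 x * g (x k.-2) (x k.-1) * phi (x k.-2) * phi (x k.-1)
      + h_coef n' k.-1 x * (\sum_(i < k.-1) g (x i) (x k.-1)) * phi (x k.-1)
      + h_coef n' k x * pair_sum k x
    else 0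
  end.

(* The point x0 only serves as padding beyond the last entry of a tuple. *)
Variable x0 : T.

Definition S_moment (l : nat) (mu : R) : R :=
  \int[power_measure m l]_(x in set_power D l)
    moment_integrand l mu (nth x0 x).

Definition H_coef (n k : nat) : R :=
  \int[power_measure m k]_(x in set_power D k) h_coef n k (nth x0 x).

End chaos.

(* [v] has the formal power series sum_n a_n mu^n at mu = 0: the series is the
   (unique, possibly divergent) asymptotic series of v as mu -> 0+. *)
Definition formal_expansion {R : realType} (v : R -> R) (a : nat -> R) : Prop :=
  forall N : nat,
    (fun mu => (v mu - \sum_(n < N.+1) a n * mu ^+ n) / mu ^+ N)
      @ (0 : R)^'+ --> (0 : R).

(* g_ eps tends to g almost everywhere on D^2 as eps -> 0+ and |g_ eps| <= G
   there, where exp (c G) is integrable for some c > 0 against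
   phi(x) phi(y) dx dy; e.g. G(x,y) = C (1 + log_+ (1/|x-y|)) with phi bounded. *)
Definition regularizes {d : measure_display} {T : measurableType d}
    {R : realType} (m : {sigma_finite_measure set T -> \bar R})
    (D : set T) (phi : T -> R) (g_ : R -> T -> T -> R) (g : T -> T -> R) : Prop :=
  [/\ measurable_fun setT (fun p : T * T => g p.1 p.2),
      {ae (m \x m)%E, forall p, D p.1 -> D p.2 ->
         (fun eps => g_ eps p.1 p.2) @ (0 : R)^'+ --> g p.1 p.2} &
      exists c : R, exists G : T * T -> R,
        [/\ 0 < c, measurable_fun setT G,
            \forall eps \near (0 : R)^'+, {ae (m \x m)%E, forall p,
              D p.1 -> D p.2 -> `|g_ eps p.1 p.2| <= G p} &
            (\int[m \x m]_(p in D `*` D)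
               (phi p.1 * phi p.2 * expR (c * G p))%:E < +oo)%E]].

(* Main.v *)
Require Import Defs.
From HB Require Import structures.
From mathcomp Require Import all_boot all_order all_algebra.
From mathcomp Require Import all_classical all_reals all_analysis.
From mathcomp Require Import measurable_realfun lebesgue_integral_under ring lra.

(* Put nu = phi 1_D dx, b = nu(T) and let p_l = sum_(i<j) g(x_i,x_j) on T^l. By
   the Gaussian exponential moments, Fubini and dominated convergence, the l-th
   moment of the mass Z is S_l(mu), the integral of exp(mu p_l) against nu^l,
   which is smooth at mu = 0 with derivatives M_(l,n) = int p_l^n dnu^l.

   Expanding p_l^n factor by factor, each factor meets two new points, one new
   point or none; collecting terms by the set of points met so far gives
   p_l^n = sum_k sum_s h_(n,k)(x_s), where h is taken with phi = 1 and s ranges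
   over the injections of a k-set into an l-set. Hence
   M_(l,n) = sum_k l(l-1)...(l-k+1) b^(l-k) H_(n,k), and binomial inversion turns
   this into the formula for H_(n,k); it also says that the n-th derivative of the
   centered moment E(Z-b)^k at mu = 0 is k! H_(n,k), which vanishes for n < k/2.

   The expansion of E F(Z) is then Taylor's formula for F at b: for k > 2N the
   k-th centered moment is O(mu^(N+1)), and far from b the function F is
   controlled by its q-th moment together with a high centered moment. *)

Set Implicit Arguments.
Unset Strict Implicit.
Unset Printing Implicit Defensive.

Import Order.TTheory GRing.Theory Num.Theory.
Import numFieldNormedType.Exports.

Local Open Scope classical_set_scope.
Local Open Scope ring_scope.

(** No single [mu > 0] serves all orders: the exponential of the pair sum of [l] points is
    controlled only for [mu] below a rate of order [c / l^2]. Each order [N] of the expansion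
    therefore uses finitely many moments and a neighbourhood of [0] of its own.

    The mass is a limit in law only. Its moments are recovered by truncation, the moment of the next
    order supplying uniform integrability, and they are moments of its positive part, because the
    limit variable may take negative values as a function.

    [F] is smooth on the open half-line only, and far from [b] nothing but a bounded [q]-th moment
    is known. There [|F|] is split into a part of size [mu^-K], which a centered moment of large
    order compensates, and a part paid for by the [q]-th moment.

    The kernel [g] is an almost everywhere limit, so it is symmetric and dominated only almost
    everywhere. It is replaced by a version with these properties at every point; this is harmless
    because pair sums and [h] never evaluate the kernel at a pair of equal indices. *)

Section measurable_real.
Context d (T : measurableType d) (R : realType) (D : set T).

Lemma measurable_funEFin (g : T -> R) : measurable_fun D g ->
  measurable_fun D (fun x => (g x)%:E).
Proof. by move=> mg; apply: measurableT_comp. Qed.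

Lemma integrable_measurable_real (mu : set T -> \bar R) (g : T -> R) :
  mu.-integrable D (EFin \o g) -> measurable_fun D g.
Proof. by move=> /measurable_int /measurable_EFinP. Qed.

End measurable_real.

(** * Densities and powers of measures *)

Section density_measure.
Import HBNNSimple.
Context d (T : measurableType d) (R : realType).
Variables (m : {measure set T -> \bar R}) (f : T -> R).
Local Open Scope ereal_scope.

(** The two proofs are arguments so that the finite measure structure can be inferred from the term
    itself. *)
Definition density_measure (_ : forall x, (0 <= f x)%R)
    (_ : m.-integrable setT (EFin \o f)) (A : set T) : \bar R :=
  \int[m]_(x in A) (f x)%:E.

Hypotheses (f_ge0 : forall x, (0 <= f x)%R)
  (intf : m.-integrable setT (EFin \o f)).

Let nu := density_measure f_ge0 intf.

Let nu0 : nu set0 = 0.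
Proof. exact: integral_set0. Qed.

Let nu_ge0 A : 0 <= nu A.
Proof. by apply: integral_ge0 => x _; rewrite lee_fin. Qed.

Let nu_sigma_additive : semi_sigma_additive nu.
Proof.
move=> A mA tA mUA; rewrite /nu /density_measure integral_bigcup//; last first.
  exact: (integrableS measurableT).
by apply: is_cvg_ereal_nneg_natsum_cond => n _ _; exact: nu_ge0.
Qed.

HB.instance Definition _ := isMeasure.Build _ _ _
  (density_measure f_ge0 intf) nu0 nu_ge0 nu_sigma_additive.

Let nu_fin : fin_num_fun nu.
Proof.
move=> A mA; apply: integrable_fin_num => //.
exact: (integrableS measurableT).
Qed.

HB.instance Definition _ := Measure_isFinite.Build _ _ _
  (density_measure f_ge0 intf) nu_fin.

Let mf : measurable_fun setT (EFin \o f).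
Proof. exact: measurable_int intf. Qed.

(** By monotone convergence along simple functions increasing to [g], then linearity, only
    indicators remain, and for them this is the definition of the density measure. *)
Lemma ge0_integral_density (g : T -> \bar R) : measurable_fun setT g ->
  (forall x, 0 <= g x) ->
  \int[density_measure f_ge0 intf]_x g x = \int[m]_x (g x * (f x)%:E).
Proof.
move=> mg g0; pose h := nnsfun_approx measurableT mg.
have gE x : g x = lim ((EFin \o h n) x @[n --> \oo]).
  by apply/esym/cvg_lim => //; exact: cvg_nnsfun_approx.
have ndh x : {homo (fun n => h n x) : a b / (a <= b)%N >-> (a <= b)%R}.
  by move=> a b ab; exact/lefP/nd_nnsfun_approx.
have h_ge0 n x : (0 <= h n x)%R by exact: fun_ge0.
transitivity (lim (\int[nu]_x (EFin \o h n) x @[n --> \oo])).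
  under eq_integral do rewrite gE.
  apply: monotone_convergence => //.
  - by move=> n; exact/measurable_EFinP.
  - by move=> n x _; rewrite lee_fin.
  - by move=> x _ a b ab; rewrite lee_fin ndh.
have -> : \int[m]_x (g x * (f x)%:E) =
    lim (\int[m]_x ((EFin \o h n) x * (f x)%:E) @[n --> \oo]).
  have gfE x : g x * (f x)%:E = lim (((EFin \o h n) x * (f x)%:E) @[n --> \oo]).
    apply/esym/cvg_lim => //; apply: cvgeZr => //.
    exact: cvg_nnsfun_approx.
  under eq_integral do rewrite gfE.
  apply: monotone_convergence => //.
  - by move=> n; apply/emeasurable_funM => //; exact/measurable_EFinP.
  - by move=> n x _; rewrite mule_ge0 ?lee_fin.
  - by move=> x _ a b ab; rewrite lee_wpmul2r ?lee_fin ?ndh.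
apply/congr_lim/funext => n.
have mi r : measurable (h n @^-1` [set r]) by [].
transitivity (\int[nu]_x (\sum_(y \in range (h n))
    (y * \1_(h n @^-1` [set y]) x)%:E)).
  by apply: eq_integral => t _; rewrite /= fimfunE -fsumEFin.
have indich r : measurable_fun setT (fun x => (r * \1_(h n @^-1` [set r]) x)%:E).
  by apply/measurable_EFinP; exact: measurable_funM.
rewrite ge0_integral_fsum//; last by move=> r x _; exact: nnfun_muleindic_ge0.
transitivity (\int[m]_x (\sum_(y \in range (h n))
    (y * \1_(h n @^-1` [set y]) x)%:E * (f x)%:E)); last first.
  apply: eq_integral => x _ /=.
  rewrite -ge0_mule_fsuml => [|y]; last exact: nnfun_muleindic_ge0.
  by rewrite fsumEFin // -(fimfunE _ x).
rewrite ge0_integral_fsum//; last 2 first.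
  - by move=> r; exact: emeasurable_funM.
  - by move=> r x _; rewrite mule_ge0 ?lee_fin// -lee_fin nnfun_muleindic_ge0.
apply: eq_fsbigr => r; rewrite inE => -[x _ <-].
under [RHS]eq_integral do rewrite EFinM -muleA.
rewrite [RHS]ge0_integralZl//; last 3 first.
  - apply: emeasurable_funM => //.
    by apply/measurable_EFinP.
  - by move=> y _; rewrite mule_ge0 ?lee_fin.
  - by rewrite lee_fin.
under [LHS]eq_integral do rewrite EFinM.
rewrite [LHS]ge0_integralZl//; last 2 first.
  - by apply/measurable_EFinP.
  - by rewrite lee_fin.
rewrite integral_indic// setIT; congr (_ * _).
transitivity (\int[m]_(y in h n @^-1` [set h n x]) (f y)%:E) => //.
rewrite integral_mkcond; apply: eq_integral => y _.
by rewrite epatch_indic muleC.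
Qed.

End density_measure.

Section power_measure_theory.
Context d (T : measurableType d) (R : realType).
Variables (m : {sigma_finite_measure set T -> \bar R}).
Local Open Scope ereal_scope.

Lemma ge0_integral_power_measureS n (f : n.+1.-tuple T -> \bar R) :
  measurable_fun setT f -> (forall x, 0 <= f x) ->
  \int[power_measure m n.+1]_x f x =
  \int[m]_x \int[power_measure m n]_t f (tuple_cons (x, t)).
Proof.
move=> mf f0 /=; rewrite /power_step.
transitivity (\int[m \x power_measure m n]_p f (tuple_cons p)).
  rewrite (ge0_integral_pushforward (phi := @tuple_cons _ _ _))//.
  exact: measurable_tuple_cons.
rewrite fubini_tonelli1//=.
by apply: measurableT_comp => //; exact: measurable_tuple_cons.
Qed.

Definition box n (A : 'I_n -> set T) : set (n.-tuple T) :=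
  [set x | forall i, A i (tnth x i)].

Lemma measurable_box n (A : 'I_n -> set T) :
  (forall i, measurable (A i)) -> measurable (box A).
Proof.
move=> mA.
rewrite (_ : box A = \bigcap_(i in [set: 'I_n]) ((@tnth _ T ^~ i) @^-1` A i)).
  apply: fin_bigcap_measurable => // i _.
  by rewrite -[X in measurable X]setTI; exact: measurable_tnth.
by apply/seteqP; split => [x H i _|x H i]; [exact: H|exact: (H i Logic.I)].
Qed.

Lemma ge0_integral_power_prod n (f : T -> R) : measurable_fun setT f ->
  (forall x, 0 <= f x)%R ->
  \int[power_measure m n]_x (\prod_(i < n) f (tnth x i))%:E =
  (\int[m]_x (f x)%:E) ^+ n.
Proof.
move=> mf f0; elim: n => [|n IHn].
  rewrite /= integral_dirac//=; last first.
    by apply/measurable_EFinP; apply: measurable_prod => i; case: i.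
  by rewrite diracE in_setT mul1e big_ord0.
rewrite ge0_integral_power_measureS; last 2 first.
- apply/measurable_EFinP; apply: measurable_prod => i _.
  by apply: measurableT_comp => //; exact: measurable_tnth.
- by move=> x; rewrite lee_fin prodr_ge0.
rewrite expeS -IHn muleC -ge0_integralZl//; last 3 first.
- exact/measurable_EFinP.
- by move=> x _; rewrite lee_fin.
- by apply: integral_ge0 => x _; rewrite lee_fin prodr_ge0.
apply: eq_integral => x _; rewrite muleC -ge0_integralZl//; last 3 first.
- apply/measurable_EFinP; apply: measurable_prod => i _.
  by apply: measurableT_comp => //; exact: measurable_tnth.
- by move=> t _; rewrite lee_fin prodr_ge0.
- by rewrite lee_fin.
apply: eq_integral => t _; rewrite -EFinM big_ord_recl; congr (_ * _)%:E.
by apply: eq_bigr => i _; congr f; rewrite tnthS; congr tnth; exact: val_inj.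
Qed.

End power_measure_theory.

Section power_measure_finite.
Context d (T : measurableType d) (R : realType).
Variables (nu : {finite_measure set T -> \bar R}).
Local Open Scope ereal_scope.

Lemma power_measure_box n (A : 'I_n -> set T) : (forall i, measurable (A i)) ->
  power_measure nu n (box A) = (\prod_(i < n) fine (nu (A i)))%:E.
Proof.
elim: n A => [|n IHn] A mA.
  rewrite big_ord0 /= diracE (_ : box A = setT) ?in_setT//.
  by apply/seteqP; split => // x _ [].
rewrite /= /power_step /pushforward.
rewrite (_ : _ @^-1` _ = A ord0 `*` box (fun i => A (lift ord0 i))).
  rewrite product_measure1E//; last exact: measurable_box.
  rewrite IHn// big_ord_recl EFinM fineK// fin_num_measure//.
apply/seteqP; split => [[x t] /= H|[x t] [/= Ax H] i].
  split; first exact: (H ord0).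
  by move=> i; have := H (lift ord0 i); rewrite tnthS; congr (A _ (tnth _ _)); exact: val_inj.
case: (unliftP ord0 i) => [j ->|->//]; rewrite tnthS.
by have := H j; congr (A _ (tnth _ _)); exact: val_inj.
Qed.

Lemma power_measureT n : power_measure nu n setT = (fine (nu setT) ^+ n)%:E.
Proof.
rewrite (_ : setT = box (fun=> setT)) ?power_measure_box//; last first.
  by apply/seteqP; split.
by rewrite prodr_const card_ord.
Qed.

Lemma power_measure_lty n A : measurable A -> power_measure nu n A < +oo.
Proof.
move=> mA; apply: (@le_lt_trans _ _ (power_measure nu n setT)).
  by apply: le_measure => //; rewrite inE.
by rewrite power_measureT ltry.
Qed.

Definition reindex_tuple k l (s : 'I_k -> 'I_l) (x : l.-tuple T) : k.-tuple T :=
  [tuple tnth x (s i) | i < k].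

Lemma measurable_reindex_tuple k l (s : 'I_k -> 'I_l) :
  measurable_fun setT (reindex_tuple s).
Proof.
apply/measurable_fun_tnthP => i.
rewrite (_ : _ \o _ = (@tnth _ T ^~ (s i))); first exact: measurable_tnth.
by apply/funext => x /=; rewrite tnth_mktuple.
Qed.

(** Boxes are stable under intersection and contain the cylinders generating the sigma-algebra of
    tuples; finiteness of [m1] lets the constant sequence [setT] serve as exhaustion. *)
Lemma tuple_measure_unique n (m1 m2 : {measure set n.-tuple T -> \bar R}) :
  (forall A, (forall i, measurable (A i)) -> m1 (box A) = m2 (box A)) ->
  m1 setT < +oo -> forall A, measurable A -> m1 A = m2 A.
Proof.
move=> m12 m1oo A mA.
pose G : set (set (n.-tuple T)) :=
  [set B | exists2 A : 'I_n -> set T, (forall i, measurable (A i)) & B = box A].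
apply: (g_sigma_algebra_measure_unique G _ (fun=> setT)) => //.
- by move=> _ [B mB ->]; exact: measurable_box.
- by move=> _; exists (fun=> setT) => //; apply/seteqP; split.
- by rewrite bigcup_const//; exists 0%N.
- move=> _ _ [B mB ->] [C mC ->]; exists (fun i => B i `&` C i).
    by move=> i; exact: measurableI.
  by apply/seteqP; split => [x [Bx Cx] i|x H]; [split; [exact: Bx|exact: Cx]|
    split => i; have [] := H i].
- by move=> _ [B mB ->]; exact: m12.
- move: A mA; apply: smallest_sub; first exact: smallest_sigma_algebra.
  rewrite -bigcup_seq/= => A [i _ [B mB <-]]; apply: sub_sigma_algebra.
  (* A cylinder over the coordinate [i] is a box whose other sides are full. *)
  exists (fun j => if j == i then B else setT) => [j|].
    by case: ifP.
  rewrite setTI; apply/seteqP; split => [x Bx j|x H].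
    by case: eqP => // ->.
  by have := H i; rewrite eqxx.
Qed.

HB.instance Definition _ k l (s : 'I_k -> 'I_l) :=
  isMeasurableFun.Build _ _ _ _ (reindex_tuple s) (measurable_reindex_tuple s).

(** Each of the [l - k] coordinates that [s] does not select integrates to the total mass; this is
    the source of the factors [b^(l-k)]. *)
Lemma power_measure_reindex k l (s : 'I_k -> 'I_l) : injective s ->
  forall A, measurable A ->
  power_measure nu l (reindex_tuple s @^-1` A) =
  (fine (nu setT) ^+ (l - k))%:E * power_measure nu k A.
Proof.
move=> s_inj A mA.
have c0 : (0 <= fine (nu setT) ^+ (l - k))%R by rewrite exprn_ge0// fine_ge0.
have := @tuple_measure_unique k (pushforward (power_measure nu l) (reindex_tuple s))
  (mscale (NngNum c0) (power_measure nu k)).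
apply => //; last first.
  exact: (@power_measure_lty l setT).
move=> {mA}A mA.
change (power_measure nu l (reindex_tuple s @^-1` box A) =
  (fine (nu setT) ^+ (l - k))%:E * power_measure nu k (box A)).
rewrite (power_measure_box (A := A))//.
(* The preimage of a box is again a box, with full sides at the coordinates outside the image of
   [s]. *)
pose B j := if [pick i | s i == j] is Some i then A i else setT.
have BE i : B (s i) = A i.
  rewrite /B; case: pickP => [j /eqP /s_inj -> //|/(_ i)].
  by rewrite eqxx.
have -> : reindex_tuple s @^-1` box A = box B.
  apply/seteqP; split => [x H j|x H i].
    rewrite /B; case: pickP => // i /eqP <-.
    by have := H i; rewrite tnth_mktuple.
  by have := H (s i); rewrite BE tnth_mktuple.
rewrite power_measure_box; last by move=> j; rewrite /B; case: pickP.
rewrite -EFinM; congr EFin.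
rewrite (bigID (fun j => j \in [set s i | i : 'I_k]%SET)) /= mulrC; congr (_ * _)%R.
  rewrite (eq_bigr (fun=> fine (nu setT))); last first.
    move=> j; rewrite /B; case: pickP => // i /eqP <- /negP[].
    exact: imset_f.
  rewrite prodr_const; congr (_ ^+ _)%R.
  rewrite -[l in RHS]card_ord -[k in RHS]card_ord -(card_imset _ s_inj).
  transitivity #|~: [set s x | x : 'I_k]%SET|.
    by apply: eq_card => j; rewrite !inE.
  by rewrite cardsCs finset.setCK.
by rewrite big_imset/=; [apply: eq_bigr => i _; rewrite BE|move=> i j _ _ /s_inj].
Qed.

Lemma ge0_integral_reindex k l (s : 'I_k -> 'I_l) (f : k.-tuple T -> \bar R) :
  injective s -> measurable_fun setT f -> (forall x, 0 <= f x) ->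
  \int[power_measure nu l]_x f (reindex_tuple s x) =
  (fine (nu setT) ^+ (l - k))%:E * \int[power_measure nu k]_x f x.
Proof.
move=> s_inj mf f0.
have c0 : (0 <= fine (nu setT) ^+ (l - k))%R by rewrite exprn_ge0// fine_ge0.
rewrite -[X in X%:E * _]/((NngNum c0)%:num) -ge0_integral_mscale//.
transitivity (\int[pushforward (power_measure nu l) (reindex_tuple s)]_x f x).
  by rewrite ge0_integral_pushforward//; exact: measurable_reindex_tuple.
by apply: eq_measure_integral => A mA _; exact: power_measure_reindex.
Qed.

Lemma integral_reindex k l (s : 'I_k -> 'I_l) (f : k.-tuple T -> R) :
  injective s -> (power_measure nu k).-integrable setT (EFin \o f) ->
  (power_measure nu l).-integrable setT (fun x => (f (reindex_tuple s x))%:E) /\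
  (\int[power_measure nu l]_x f (reindex_tuple s x) =
   fine (nu setT) ^+ (l - k) * \int[power_measure nu k]_x f x)%R.
Proof.
move=> s_inj intf.
have mf : measurable_fun setT f by exact: integrable_measurable_real intf.
have mr := @measurable_reindex_tuple k l s.
have intfr : (power_measure nu l).-integrable setT
    (fun x => (f (reindex_tuple s x))%:E).
  apply/integrableP; split.
    by apply: measurable_funEFin; apply: measurableT_comp.
  rewrite (ge0_integral_reindex (f := fun x => `|(f x)%:E|))//; last first.
    by apply: measurableT_comp => //; exact: measurable_funEFin.
  have /integrableP[_ foo] := intf.
  rewrite -ge0_fin_numE; last by rewrite mule_ge0 ?integral_ge0// lee_fin exprn_ge0// fine_ge0.
  by rewrite fin_numM// ge0_fin_numE// integral_ge0.
split=> //; rewrite /Rintegral.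
have -> c r : (c * fine r = fine c%:E * fine r)%R by [].
rewrite -fineM//; last first.
  exact: integrable_fin_num.
congr fine.
rewrite integralE [X in _ = _ * X]integralE.
transitivity (\int[power_measure nu l]_x (EFin \o f)^\+ (reindex_tuple s x) -
  \int[power_measure nu l]_x (EFin \o f)^\- (reindex_tuple s x)).
  by congr (_ - _); apply: eq_integral => x _; rewrite ?funeposE ?funenegE.
rewrite (ge0_integral_reindex (f := (EFin \o f)^\+))//; last first.
  by apply: measurable_funepos; exact: measurable_funEFin.
rewrite (ge0_integral_reindex (f := (EFin \o f)^\-))//; last first.
  by apply: measurable_funeneg; exact: measurable_funEFin.
rewrite [RHS]muleBr//.
by apply: fin_num_adde_defl;
  rewrite fin_numN; apply: integrable_fin_num => //; exact: integrable_funeneg.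
Qed.

End power_measure_finite.

Section power_density.
Context d (T : measurableType d) (R : realType).
Variables (m : {sigma_finite_measure set T -> \bar R}) (f : T -> R).
Hypotheses (f_ge0 : forall x, (0 <= f x)%R)
  (intf : m.-integrable setT (EFin \o f)).
Local Open Scope ereal_scope.
Let nu : {finite_measure set T -> \bar R} := density_measure f_ge0 intf.

Let mf : measurable_fun setT f.
Proof. exact: integrable_measurable_real intf. Qed.

Let mprod n : measurable_fun setT
  (fun x : n.-tuple T => (\prod_(i < n) f (tnth x i))%:E).
Proof.
apply: measurable_funEFin; apply: measurable_prod => i _.
by apply: measurableT_comp => //; exact: measurable_tnth.
Qed.

Lemma ge0_integral_power_density n (g : n.-tuple T -> \bar R) :
  measurable_fun setT g -> (forall x, 0 <= g x) ->
  \int[power_measure nu n]_x g x =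
  \int[power_measure m n]_x (g x * (\prod_(i < n) f (tnth x i))%:E).
Proof.
elim: n g => [|n IHn] g mg g0.
  rewrite /= !integral_dirac//.
    by rewrite big_ord0 mule1.
  by apply: emeasurable_funM => //; exact: mprod.
rewrite !ge0_integral_power_measureS//; last 2 first.
- by apply: emeasurable_funM => //; exact: mprod.
- by move=> x; rewrite mule_ge0// lee_fin prodr_ge0.
have mgc : measurable_fun setT (fun p => g (tuple_cons p)).
  by apply: measurableT_comp => //; exact: measurable_tuple_cons.
rewrite ge0_integral_density//; last 2 first.
- exact: (measurable_fun_fubini_tonelli_F _ mgc (fun p => g0 _)).
- by move=> x; exact: integral_ge0.
apply: eq_integral => x _.
have mgx : measurable_fun setT (fun t => g (tuple_cons (x, t))).
  by apply: (measurableT_comp mgc); exact: pair1_measurable.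
rewrite IHn// muleC -ge0_integralZl ?lee_fin//; last 2 first.
- by apply: emeasurable_funM => //; exact: mprod.
- by move=> t _; rewrite mule_ge0// lee_fin prodr_ge0.
apply: eq_integral => t _; rewrite muleCA -EFinM; congr (_ * _%:E).
rewrite big_ord_recl; congr (_ * _)%R.
by apply: eq_bigr => i _; congr f; rewrite tnthS; congr tnth; exact: val_inj.
Qed.

End power_density.

Section power_density_on.
Context d (T : measurableType d) (R : realType).
Variables (m : {sigma_finite_measure set T -> \bar R}) (D : set T) (phi : T -> R).
Hypotheses (mD : measurable D) (phi0 : forall x, D x -> 0 <= phi x)
  (intphi : m.-integrable D (EFin \o phi)).
Local Open Scope ereal_scope.

Lemma patch_ge0 x : (0 <= (phi \_ D) x)%R.
Proof. by rewrite patchE; case: ifP => // /[!inE]; exact: phi0. Qed.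

Lemma integrable_patch : m.-integrable setT (EFin \o (phi \_ D)).
Proof. by rewrite -restrict_EFin -integrable_mkcond. Qed.

(** The measure [nu] of the overview. Extending [phi] by [0] outside [D] turns integrals over
    [set_power D n] into integrals over all tuples. *)
Definition weighted_measure : {finite_measure set T -> \bar R} :=
  density_measure patch_ge0 integrable_patch.

Local Notation nu := weighted_measure.

Lemma prod_patch n (x : n.-tuple T) :
  (\prod_(i < n) (phi \_ D) (tnth x i) =
   if x \in set_power D n then \prod_(i < n) phi (tnth x i) else 0)%R.
Proof.
case: ifPn => [/[!inE] Dx|/negP].
  by apply: eq_bigr => i _; rewrite patchE ifT// inE; exact: Dx.
rewrite inE => /existsNP[i Dxi]; apply/eqP; rewrite prodf_seq_eq0.
apply/hasP; exists i; first by rewrite mem_index_enum.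
by rewrite /= patchE ifF//; apply/negP => /[!inE].
Qed.

Lemma ge0_integral_weighted n (g : n.-tuple T -> R) :
  measurable_fun setT g -> (forall x, (0 <= g x)%R) ->
  \int[power_measure m n]_(x in set_power D n)
    ((\prod_(i < n) phi (tnth x i)) * g x)%:E =
  \int[power_measure nu n]_x (g x)%:E.
Proof.
move=> mg g0; rewrite ge0_integral_power_density//; last exact: measurable_funEFin.
rewrite integral_mkcond; apply: eq_integral => x _.
by rewrite patchE -EFinM prod_patch; case: ifP => //; rewrite ?mulr0// mulrC.
Qed.

(** The weight is nonnegative on [set_power D n], so it commutes with taking positive and negative
    parts, and each part falls under the nonnegative case. *)
Lemma integral_weighted n (g : n.-tuple T -> R) :
  measurable_fun setT g ->
  \int[power_measure m n]_(x in set_power D n)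
    ((\prod_(i < n) phi (tnth x i)) * g x)%:E =
  \int[power_measure nu n]_x (g x)%:E.
Proof.
move=> mg; rewrite integralE [RHS]integralE; congr (_ - _).
  rewrite [RHS](eq_integral (fun x => (Num.max (g x) 0)%:E)); last first.
    by move=> x _; rewrite funeposE EFin_max.
  rewrite -ge0_integral_weighted; last 2 first.
  - exact: measurable_maxr.
  - by move=> x; rewrite le_max lexx orbT.
  apply: eq_integral => x /[!inE] Dx; rewrite funeposE -EFin_max.
  by rewrite maxr_pMr ?mulr0// prodr_ge0// => i _; exact/phi0/Dx.
rewrite [RHS](eq_integral (fun x => (Num.max (- g x) 0)%:E)); last first.
  by move=> x _; rewrite funenegE EFin_max.
rewrite -ge0_integral_weighted; last 2 first.
- by apply: measurable_maxr => //; exact: measurable_funN.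
- by move=> x; rewrite le_max lexx orbT.
apply: eq_integral => x /[!inE] Dx; rewrite funenegE -EFinN -EFin_max.
by rewrite maxr_pMr ?mulr0 ?mulrN// prodr_ge0// => i _; exact/phi0/Dx.
Qed.

Lemma integrable_weighted n (g : n.-tuple T -> R) :
  (power_measure nu n).-integrable setT (EFin \o g) ->
  (power_measure m n).-integrable (set_power D n)
    (fun x => ((\prod_(i < n) phi (tnth x i)) * g x)%:E).
Proof.
move=> /integrableP[mg0 goo]; have mg : measurable_fun setT g by exact/measurable_EFinP.
apply/integrableP; split.
  apply: (eq_measurable_fun
    (fun x => (g x * (\prod_(i < n) (phi \_ D) (tnth x i)))%:E)).
    by move=> x xD; rewrite prod_patch xD mulrC.
  apply: measurable_funTS; apply: measurable_funEFin.
  apply: measurable_funM => //; apply: measurable_prod => i _.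
  apply: measurableT_comp => //; last exact: measurable_tnth.
  exact: integrable_measurable_real integrable_patch.
rewrite (eq_integral (fun x => ((\prod_(i < n) phi (tnth x i)) * `|g x|)%:E)).
  by rewrite ge0_integral_weighted//; exact: measurableT_comp.
move=> x /[!inE] Dx; rewrite abse_EFin normrM ger0_norm// prodr_ge0// => i _.
exact/phi0/Dx.
Qed.

Lemma weighted_measureT : nu setT = (\int[m]_(x in D) phi x)%:E.
Proof.
rewrite /= /density_measure; have := integrable_patch.
rewrite fineK; last exact: integrable_fin_num.
by rewrite [RHS]integral_mkcond restrict_EFin.
Qed.

Lemma integral_weighted1 (g : T -> R) : measurable_fun setT g -> (forall x, 0 <= g x)%R ->
  \int[nu]_x (g x)%:E = \int[m]_(x in D) (phi x * g x)%:E.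
Proof.
move=> mg g0; rewrite ge0_integral_density//; last exact: measurable_funEFin.
rewrite [RHS]integral_mkcond; apply: eq_integral => x _.
by rewrite !patchE; case: ifP => _; rewrite ?mule0// -EFinM mulrC.
Qed.

End power_density_on.

(** * The functions h and the powers of the pair sum *)

Section h_coef_theory.
Context d (T : measurableType d) (R : realType) (g : T -> T -> R).
Implicit Types (x y : nat -> T) (n k : nat).

Local Notation h1 := (h_coef (fun=> 1) g).

Lemma h_coefSS phi n k x : h_coef phi g n.+2 k x =
  if (2 <= k <= n.+2.*2)%N then
    2^-1 * h_coef phi g n.+1 k.-2 x * g (x k.-2) (x k.-1)
      * phi (x k.-2) * phi (x k.-1)
    + h_coef phi g n.+1 k.-1 x * (\sum_(i < k.-1) g (x i) (x k.-1)) * phi (x k.-1)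
    + h_coef phi g n.+1 k x * pair_sum g k x
  else 0.
Proof. by []. Qed.

(** Every branch of the recursion multiplies by [phi] at exactly the points that it adds. Integrals
    of [h_coef phi] over powers of [D] thereby become integrals of [h1] against powers of [nu]. *)
Lemma h_coefE phi n k x :
  h_coef phi g n k x = (\prod_(i < k) phi (x i)) * h1 n k x.
Proof.
elim: n k => [|[|n] IHn] k; first by rewrite mulr0.
  rewrite [LHS]/= [h1 _ _ _]/=; case: eqP => [->|_]; last by rewrite mulr0.
  by rewrite !big_ord_recr big_ord0 /=; ring.
rewrite !h_coefSS; case: ifP => [|_]; last by rewrite mulr0.
case: k => [//|[//|k]] _; rewrite !IHn [k.+2.-2]/= [k.+2.-1]/=.
by rewrite !big_ord_recr /=; ring.
Qed.

Lemma h_coef_supp phi n k x : ~~ (2 <= k <= n.*2)%N -> h_coef phi g n k x = 0.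
Proof.
case: n => [//|[|n]] /negbTE h; last by rewrite /= h.
by rewrite /=; case: eqP h => // ->.
Qed.

Lemma pair_sum_ext k x y : (forall i, (i < k)%N -> x i = y i) ->
  pair_sum g k x = pair_sum g k y.
Proof.
move=> xy; apply: eq_bigr => j _; apply: eq_bigr => i _.
by rewrite !xy// (ltn_trans _ (ltn_ord j)).
Qed.

(* h with the convention h_(0,k) = 1 if k = 0 and 0 otherwise, for which the
   recursion also holds at n = 0. *)
Definition h_coef0 n k x : R := if n is 0 then (k == 0%N)%:R else h1 n k x.

Lemma h_coef0_supp n k x : (n.*2 < k)%N -> h_coef0 n k x = 0.
Proof.
case: n => [|n] nk; first by case: k nk.
by apply: h_coef_supp; rewrite negb_and -!ltnNge nk orbT.
Qed.

Lemma h_coef0S n k x : h_coef0 n.+1 k x =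
  (if (2 <= k)%N then 2^-1 * h_coef0 n k.-2 x * g (x k.-2) (x k.-1) else 0)
  + (if (1 <= k)%N then
       h_coef0 n k.-1 x * (\sum_(i < k.-1) g (x i) (x k.-1)) else 0)
  + h_coef0 n k x * pair_sum g k x.
Proof.
case: n => [|n].
  case: k => [|[|[|k]]]; rewrite /h_coef0 /= ?big_ord0 /pair_sum ?big_ord0; ring.
rewrite /h_coef0; have [k2|k2] := boolP (2 <= k <= n.+2.*2)%N.
  by rewrite h_coefSS k2; move: k2; case: k => [//|[//|k]] _; rewrite !mulr1.
rewrite h_coef_supp//; move: k2; rewrite negb_and -!ltnNge.
case: k => [|[|k]].
- by move=> _; rewrite (@h_coef_supp _ n.+1 0)//= mul0r !addr0.
- by move=> _; rewrite (@h_coef_supp _ n.+1 0)// (@h_coef_supp _ n.+1 1)//= !mul0r !addr0.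
rewrite !doubleS !ltnS ltn0 orFb => nk.
rewrite (@h_coef_supp _ n.+1 k); last by rewrite negb_and -!ltnNge doubleS nk orbT.
rewrite (@h_coef_supp _ n.+1 k.+1); last first.
  by rewrite negb_and -!ltnNge doubleS (leqW nk) orbT.
rewrite (@h_coef_supp _ n.+1 k.+2); last first.
  by rewrite negb_and -!ltnNge doubleS (leqW (leqW nk)) orbT.
by rewrite !(mulr0, mul0r, addr0).
Qed.

Lemma h_coef0_ext n k x y : (forall i, (i < k)%N -> x i = y i) ->
  h_coef0 n k x = h_coef0 n k y.
Proof.
elim: n k => [//|n IHn] k xy; rewrite !h_coef0S (pair_sum_ext xy) IHn//.
congr (_ + _ + _).
- by case: k xy => [//|[//|k]] xy; rewrite [k.+2.-2]/= [k.+2.-1]/= !xy.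
- case: k xy => [//|k] xy; rewrite [k.+1.-1]/= (IHn k).
    by congr (_ * _); apply: eq_bigr => i _; rewrite !xy// ltnS ltnW.
  by move=> i ik; rewrite xy// ltnW.
- by rewrite (IHn k).
- by move=> i ik; apply: xy; case: k ik => [//|[//|k]] /= ik; rewrite ltnW// ltnW.
Qed.

End h_coef_theory.
Arguments h_coef0 : simpl never.

(** * Sums over injections and the splitting of pair sums *)

Section injective_sums.
Variable R : realType.
Implicit Types (l k : nat) (f : seq nat -> R) (s : seq nat).

(* Sum of f over the injections of {0..k-1} into {0..l-1}, as sequences. *)
Fixpoint inj_sum l k f : R :=
  if k is k'.+1 then
    inj_sum l k' (fun s => \sum_(a <- iota 0 l | a \notin s) f (rcons s a))
  else f [::].

Definition inj_seq l k s := [&& uniq s, size s == k & all (gtn l) s].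

Lemma inj_seq_rcons l k s a : inj_seq l k s -> a \in iota 0 l -> a \notin s ->
  inj_seq l k.+1 (rcons s a).
Proof.
move=> /and3P[us /eqP ss al] ai ans; apply/and3P; split.
- by rewrite rcons_uniq ans.
- by rewrite size_rcons ss.
- by rewrite all_rcons al andbT; rewrite mem_iota in ai.
Qed.

Lemma eq_inj_sum l k f f' : (forall s, inj_seq l k s -> f s = f' s) ->
  inj_sum l k f = inj_sum l k f'.
Proof.
elim: k f f' => [|k IHk] f f' ff'; first exact: ff'.
apply: IHk => s sk; rewrite big_seq_cond [RHS]big_seq_cond.
by apply: eq_bigr => a /andP[al ans]; apply: ff'; exact: inj_seq_rcons.
Qed.

Lemma inj_sumD l k f f' :
  inj_sum l k (fun s => f s + f' s) = inj_sum l k f + inj_sum l k f'.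
Proof.
elim: k f f' => [//|k IHk] f f' /=; rewrite -IHk.
by apply: eq_inj_sum => s _; rewrite big_split.
Qed.

Lemma inj_sumZ l k c f : inj_sum l k (fun s => f s * c) = inj_sum l k f * c.
Proof.
elim: k f => [//|k IHk] f /=; rewrite -IHk.
by apply: eq_inj_sum => s _; rewrite mulr_suml.
Qed.

(** Splits the indices into the points already met and the others; sums over pairs are cut along
    this partition. *)
Lemma perm_iota_inj_seq l k s : inj_seq l k s ->
  perm_eq (iota 0 l) (s ++ [seq a <- iota 0 l | a \notin s]).
Proof.
move=> /and3P[us _ al].
rewrite -(perm_filterC (mem s) (iota 0 l)) perm_cat2r.
apply: uniq_perm => //; first by rewrite filter_uniq// iota_uniq.
move=> a; rewrite mem_filter mem_iota /=.
by case: (boolP (a \in s)) => // /(allP al).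
Qed.

(** After [k] distinct indices there remain [l - k] choices for the next one, whence the falling
    factorial. *)
Lemma inj_sum_cst l k c : inj_sum l k (fun=> c) = (l ^_ k)%:R * c.
Proof.
elim: k c => [|k IHk] c /=; first by rewrite ffactn0 mul1r.
rewrite ffactnSr natrM -mulrA -IHk; apply: eq_inj_sum => s sk.
rewrite -big_filter big_const_seq count_predT iter_addr_0 mulr_natl.
congr (_ *+ _); have /perm_size := perm_iota_inj_seq sk.
move/esym; rewrite size_iota size_cat.
by have /and3P[_ /eqP -> _] := sk; move=> {2}<-; rewrite addKn.
Qed.

End injective_sums.

Section pair_sums.
Variables (R : realType) (G : nat -> nat -> R).
Implicit Types (t s : seq nat).

Definition seq_pair_sum t :=
  \sum_(j < size t) \sum_(i < j) G (nth 0%N t i) (nth 0%N t j).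

Lemma seq_pair_sum_rcons t c :
  seq_pair_sum (rcons t c) = seq_pair_sum t + \sum_(a <- t) G a c.
Proof.
rewrite /seq_pair_sum size_rcons big_ord_recr /=; congr (_ + _).
  apply: eq_bigr => j _; apply: eq_bigr => i _.
  by rewrite !nth_rcons ltn_ord (ltn_trans _ (ltn_ord j)).
rewrite (big_nth 0%N) big_mkord; apply: eq_bigr => i _.
by rewrite !nth_rcons ltn_ord ltnn eqxx.
Qed.

Variable l : nat.
Hypothesis symG : forall a b, (a < l)%N -> (b < l)%N -> G a b = G b a.

(** By symmetry each unordered pair is counted twice on the right. This form no longer depends on
    the order of [t], so the indices may be permuted freely. *)
Lemma seq_pair_sumE t : uniq t -> all (gtn l) t ->
  seq_pair_sum t = 2^-1 * \sum_(a <- t) \sum_(b <- t | b != a) G a b.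
Proof.
elim/last_ind: t => [|t c IHt]; first by rewrite /seq_pair_sum !big_nil/= big_ord0 mulr0.
rewrite rcons_uniq all_rcons => /andP[cnt ut] /andP[cl al].
rewrite seq_pair_sum_rcons IHt// -cats1 big_cat big_seq1 /=.
rewrite big_cat /= big_cons big_nil eqxx addr0.
have -> : \sum_(b <- t | b != c) G c b = \sum_(a <- t) G a c.
  rewrite big_seq_cond [RHS]big_seq; apply: eq_big => [b|b /andP[bt _]].
    by apply/andb_idr => bt; apply: contraNneq cnt => <-.
  by apply: symG => //; exact: (allP al).
have -> : \sum_(a <- t) \sum_(b <- t ++ [:: c] | b != a) G a b =
    \sum_(a <- t) \sum_(b <- t | b != a) G a b + \sum_(a <- t) G a c.
  rewrite -big_split; apply: eq_big_seq => a at_ /=.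
  rewrite big_cat /=; congr (_ + _); rewrite big_cons big_nil ifT ?addr0//.
  by apply: contraNneq cnt => ->.
by field.
Qed.

(** The three terms collect the pairs with two, one and no points outside [s]. The two mixed blocks
    agree by symmetry and absorb the factor [1/2]; the block of two new points keeps it, which
    explains the [1/2] in the recursion for [h]. *)
Lemma seq_pair_sum_split k s : inj_seq l k s ->
  seq_pair_sum (iota 0 l) =
  \sum_(a <- iota 0 l | a \notin s)
     \sum_(b <- iota 0 l | b \notin rcons s a) 2^-1 * G a b
  + \sum_(a <- iota 0 l | a \notin s) \sum_(b <- s) G b a
  + seq_pair_sum s.
Proof.
move=> sk; have /and3P[us /eqP ss al] := sk.
rewrite seq_pair_sumE ?iota_uniq//; last by apply/allP => a; rewrite mem_iota.
rewrite [seq_pair_sum s]seq_pair_sumE//.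
have pe := perm_iota_inj_seq sk.
set u := [seq a <- iota 0 l | a \notin s] in pe.
have ul a : a \in u -> (a < l)%N by rewrite mem_filter mem_iota => /and3P[].
have ns a : a \in u -> a \notin s by rewrite mem_filter => /andP[].
rewrite (perm_big _ pe) big_cat /=.
under eq_bigr do rewrite (perm_big _ pe) big_cat.
under [X in _ + X]eq_bigr do rewrite (perm_big _ pe) big_cat.
rewrite !big_split /=.
rewrite -(big_filter (iota 0 l)) -/u -[X in _ = _ + X + _]big_filter -/u.
have -> : \sum_(a <- u) \sum_(b <- iota 0 l | b \notin rcons s a) 2^-1 * G a b
    = 2^-1 * \sum_(a <- u) \sum_(b <- u | b != a) G a b.
  rewrite mulr_sumr; apply: eq_bigr => a _; rewrite -mulr_sumr; congr (_ * _).
  rewrite -[RHS]big_filter -[LHS]big_filter /u -filter_predI; congr bigop.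
  by apply: eq_filter => b /=; rewrite mem_rcons inE negb_or.
have -> : \sum_(a <- s) \sum_(b <- u | b != a) G a b =
    \sum_(a <- u) \sum_(b <- s) G b a.
  rewrite (exchange_big_dep predT)//=; apply: eq_big_seq => b bu.
  rewrite big_seq_cond [RHS]big_seq_cond; apply: eq_bigl => a.
  rewrite andbT; apply/andb_idr => as_; apply: contraNneq (ns _ bu) => ->//.
have -> : \sum_(a <- u) \sum_(b <- s | b != a) G a b =
    \sum_(a <- u) \sum_(b <- s) G b a.
  apply: eq_big_seq => a au; rewrite big_seq_cond [RHS]big_seq.
  apply: eq_big => [b|b /andP[bs _]].
    by apply/andb_idr => bs; apply: contraNneq (ns _ au) => <-.
  by apply: symG; [exact: ul|exact: (allP al _ bs)].
by field.
Qed.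

End pair_sums.

Section pair_sum_expansion.
Context d (T : measurableType d) (R : realType) (g : T -> T -> R).
Variables (l : nat) (x : nat -> T).
Hypothesis symg : forall a b, (a < l)%N -> (b < l)%N ->
  g (x a) (x b) = g (x b) (x a).

Let G a b := g (x a) (x b).
Let sel (s : seq nat) i := x (nth 0%N s i).

Let pair_sum_iota : pair_sum g l x = seq_pair_sum G (iota 0 l).
Proof.
rewrite /seq_pair_sum size_iota; apply: eq_bigr => j _; apply: eq_bigr => i _.
by rewrite /G !nth_iota// (ltn_trans _ (ltn_ord j)).
Qed.

Let pair_sum_sel k s : size s = k -> pair_sum g k (sel s) = seq_pair_sum G s.
Proof. by move=> <-. Qed.

Lemma pair_sum_expn n : pair_sum g l x ^+ n =
  \sum_(k < n.*2.+1) inj_sum l k (fun s => h_coef0 g n k (sel s)).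
Proof.
elim: n => [|n IHn].
  by rewrite expr0 big_ord_recr big_ord0 /= add0r.
rewrite exprSr IHn mulr_suml.
(* Contributions of the pairs that add two, one or no points to [s]. New points are appended at the
   end, so they occupy the last arguments, as in the recursion for [h]. *)
pose A2 k s := 2^-1 * h_coef0 g n k (sel s) * g (sel s k) (sel s k.+1).
pose A1 k s := h_coef0 g n k (sel s) * \sum_(i < k) g (sel s i) (sel s k).
pose A0 k s := h_coef0 g n k (sel s) * pair_sum g k (sel s).
have step k : inj_sum l k (fun s => h_coef0 g n k (sel s)) * pair_sum g l x =
    inj_sum l k.+2 (A2 k) + inj_sum l k.+1 (A1 k) + inj_sum l k (A0 k).
  rewrite -inj_sumZ /= -!inj_sumD; apply: eq_inj_sum => s sk.
  have /and3P[us /eqP ss al] := sk.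
  rewrite pair_sum_iota (seq_pair_sum_split symg sk) !mulrDr; congr (_ + _ + _).
  - rewrite mulr_sumr; apply: eq_bigr => a _; rewrite mulr_sumr.
    apply: eq_bigr => b _; rewrite /A2 (@h_coef0_ext _ _ _ _ _ _ _ (sel s)).
      rewrite /sel !nth_rcons !size_rcons ss ltnSn ltnn eqxx ltnn eqxx /G; ring.
    by move=> i ik; rewrite /sel !nth_rcons size_rcons ss ik ltnW// ltnS ltnW.
  - rewrite mulr_sumr; apply: eq_bigr => a _.
    rewrite /A1 (@h_coef0_ext _ _ _ _ _ _ _ (sel s)); last first.
      by move=> i ik; rewrite /sel nth_rcons ss ik.
    congr (_ * _); rewrite (big_nth 0%N) big_mkord ss.
    by apply: eq_bigr => i _; rewrite /sel !nth_rcons ss ltn_ord ltnn eqxx.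
  - by rewrite /A0 pair_sum_sel.
under eq_bigr do rewrite step.
rewrite !big_split /= doubleS.
(* The same contributions indexed by the number of points after the step instead of before it; a
   missing predecessor counts as [0], as in the guards of [h_coef0S]. *)
pose B2 k s := if (2 <= k)%N then A2 k.-2 s else 0.
pose B1 k s := if (1 <= k)%N then A1 k.-1 s else 0.
have -> : \sum_(i < n.*2.+1) inj_sum l i.+2 (A2 i) =
    \sum_(k < n.*2.+3) inj_sum l k (B2 k).
  rewrite [RHS]big_ord_recl [X in _ = _ + X]big_ord_recl.
  have -> : inj_sum l (lift ord0 (@ord0 n.*2.+1)) (B2 (lift ord0 (@ord0 n.*2.+1))) = 0.
    by rewrite (@eq_inj_sum _ l 1 _ (fun=> 0)) ?inj_sum_cst ?mulr0.
  by rewrite [X in _ = X + _](_ : _ = 0)// !add0r.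
have -> : \sum_(i < n.*2.+1) inj_sum l i.+1 (A1 i) =
    \sum_(k < n.*2.+3) inj_sum l k (B1 k).
  rewrite [RHS]big_ord_recl [X in _ = _ + X]big_ord_recr.
  rewrite [X in _ = X + _](_ : _ = 0)// add0r.
  (* The top index [2n + 2] would stem from [h_(n,2n+1)], which is beyond the support. *)
  rewrite [X in _ = _ + X](_ : _ = 0) ?addr0//.
  rewrite (@eq_inj_sum _ l n.*2.+2 _ (fun=> 0)) ?inj_sum_cst ?mulr0// => s _.
  by rewrite /B1 /A1 h_coef0_supp ?mul0r.
have -> : \sum_(i < n.*2.+1) inj_sum l i (A0 i) =
    \sum_(k < n.*2.+3) inj_sum l k (A0 k).
  have z k : (n.*2 < k)%N -> inj_sum l k (A0 k) = 0.
    move=> nk; rewrite (@eq_inj_sum _ l k _ (fun=> 0)) ?inj_sum_cst ?mulr0// => s _.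
    by rewrite /A0 h_coef0_supp ?mul0r.
  rewrite [RHS]big_ord_recr [X in _ = X + _]big_ord_recr.
  rewrite [X in _ = _ + X](z n.*2.+2)// addr0.
  by rewrite [X in _ = X]/= [X in _ = _ + X](z n.*2.+1)// addr0.
rewrite -!big_split /=; apply: eq_bigr => k _.
rewrite -!inj_sumD; apply: eq_inj_sum => s _.
rewrite h_coef0S /B2 /B1 /A2 /A1 /A0; congr (_ + _ + _).
by case: (val k) => [|[|]].
Qed.

End pair_sum_expansion.

(** Both sides count the [(k+j)]-subsets of [K] points together with an ordered list of [k] of their
    elements. *)
Lemma bin_ffact_bin K k j : (k + j <= K)%N ->
  ('C(K, k + j) * (k + j) ^_ k = K ^_ k * 'C(K - k, j))%N.
Proof.
move=> kjK.
have kK : (k <= K)%N := leq_trans (leq_addr j k) kjK.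
have jK : (j <= K - k)%N by rewrite leq_subRL.
apply/eqP; rewrite -(eqn_pmul2r (fact_gt0 j)) -(eqn_pmul2r (fact_gt0 (K - k - j))).
have e1 : ((k + j) ^_ k * j`! = (k + j)`!)%N.
  by rewrite -[X in (_ * X`!)%N](addKn k) ffact_fact// leq_addr.
apply/eqP; transitivity ('C(K, k + j) * ((k + j)`! * (K - (k + j))`!))%N.
  by rewrite -e1 subnDA !mulnA.
transitivity (K ^_ k * ('C(K - k, j) * (j`! * (K - k - j)`!)))%N.
  by rewrite !bin_fact// ffact_fact.
by rewrite !mulnA.
Qed.

(** For fixed [k] the sum over [l = k + j] collapses by [bin_ffact_bin] to [K ^_ k] times [H k]
    times [(-b + b)^(K-k)], so only [k = K] survives, provided that it is among the [N] terms. *)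
Lemma binomial_inversion (R : realType) (b : R) (N : nat) (H : nat -> R) K :
  \sum_(l < K.+1) 'C(K, l)%:R * (- b) ^+ (K - l) *
    (\sum_(k < N) (l ^_ k)%:R * b ^+ (l - k) * H k) =
  if (K < N)%N then K`!%:R * H K else 0.
Proof.
under eq_bigr do rewrite mulr_sumr.
rewrite exchange_big /=.
have key k : \sum_(l < K.+1) 'C(K, l)%:R * (- b) ^+ (K - l) *
    ((l ^_ k)%:R * b ^+ (l - k) * H k) = if k == K then K`!%:R * H K else 0.
  have [kK|Kk] := leqP k K; last first.
    rewrite big1 ?gtn_eqF// => l _.
    by rewrite (ffact_small (leq_ltn_trans _ Kk)) ?mul0r ?mulr0// -ltnS.
  rewrite -(big_mkord predT (fun l => 'C(K, l)%:R * (- b) ^+ (K - l) *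
    ((l ^_ k)%:R * b ^+ (l - k) * H k))).
  rewrite (@big_cat_nat _ _ _ k)//=; last by rewrite ltnW.
  rewrite big_nat_cond big1 ?add0r; last first.
    by move=> l /andP[/andP[_ lk] _]; rewrite ffact_small// mul0r mul0r mulr0.
  rewrite -{1}[k]add0n big_addn big_mkord.
  transitivity ((K ^_ k)%:R * H k * (- b + b) ^+ (K - k)).
    rewrite exprDn mulr_sumr subSn//; apply: eq_bigr => j _.
    have jK : (j <= K - k)%N by rewrite -ltnS.
    have e : ('C(K, j + k)%:R * ((j + k) ^_ k)%:R = (K ^_ k)%:R * 'C(K - k, j)%:R :> R).
      by rewrite -!natrM addnC bin_ffact_bin// -leq_subRL.
    rewrite addnK addnC subnDA -mulr_natr.
    transitivity ('C(K, j + k)%:R * ((j + k) ^_ k)%:R * (- b) ^+ (K - k - j) * b ^+ j * H k).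
      by rewrite addnC; ring.
    by rewrite e; ring.
  rewrite addNr; have [<-|nkK] := eqVneq k K.
    by rewrite subnn expr0 mulr1 ffactnn.
  by rewrite expr0n subn_eq0 leqNgt ltn_neqAle nkK kK mulr0.
rewrite (eq_bigr (fun k : 'I_N => if (k : nat) == K then K`!%:R * H K else 0)) => [|k _]; last exact: key.
rewrite -big_mkcond /=; have [KN|NK] := ltnP K N.
  by rewrite (big_pred1 (Ordinal KN)).
by rewrite big_pred0// => k; apply/negbTE; rewrite neq_ltn (leq_trans (ltn_ord k) NK).
Qed.

(** * Taylor bounds *)

Section taylor.
Variable R : realType.
Implicit Types (F : R -> R) (a x y C : R).

Definition taylor_sum F a N x :=
  \sum_(j < N) derive1n j F a / j`!%:R * (x - a) ^+ j.

Lemma is_derive_taylor_sum F a N x :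
  is_derive x 1 (taylor_sum F a N.+1) (taylor_sum (derive1 F) a N x).
Proof.
have -> : taylor_sum F a N.+1 = \sum_(j < N.+1)
    (cst (derive1n j F a / j`!%:R) * (id - cst a) ^+ j).
  by apply/funext => y; rewrite /taylor_sum fct_sumE; apply: eq_bigr => j _; rewrite !fctE.
apply: is_derive_eq.
rewrite big_ord_recl /= mul0r scale0r !scaler0 !add0r /taylor_sum.
apply: eq_bigr => j _; rewrite scaler0 addr0 subr0 add0n /bump leq0n add1n.
rewrite -derive1nS derive1Sn factS natrM /GRing.scale/= !fctE.
have p0 : (j.+1%:R : R) != 0 by rewrite pnatr_eq0.
have q0 : (j`!%:R : R) != 0 by rewrite pnatr_eq0 -lt0n fact_gt0.
move: (j.+1%:R : R) (j`!%:R : R) p0 q0 => p q0 p0' q0'.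
by field; rewrite p0' q0'.
Qed.

(** Induction on [N] with the mean value theorem: the remainder vanishes at [a], and its derivative
    is the remainder of [F'] of one order less. The constant is not divided by a factorial; only the
    order in [|x - a|] matters. *)
Lemma taylor_bound F a x C N : 0 <= C ->
  (forall n y, (n < N)%N -> `|y - a| <= `|x - a| -> derivable (derive1n n F) y 1) ->
  (forall y, `|y - a| <= `|x - a| -> `|derive1n N F y| <= C) ->
  `|F x - taylor_sum F a N x| <= C * `|x - a| ^+ N.
Proof.
move=> C0; elim: N F x => [|N IHN] F x dF bF.
  by rewrite /taylor_sum big_ord0 subr0 expr0 mulr1; exact: bF.
pose Rm y := F y - taylor_sum F a N.+1 y.
pose dRm y := derive1 F y - taylor_sum (derive1 F) a N y.
have Rma : Rm a = 0.
  rewrite /Rm /taylor_sum big_ord_recl subrr expr0 mulr1 divr1 big1 ?addr0 ?subrr//.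
  by move=> j _; rewrite expr0n mulr0.
have dR y : `|y - a| <= `|x - a| -> is_derive y 1 Rm (dRm y).
  move=> yx.
  have d1 : is_derive y 1 F (derive1 F y).
    by rewrite derive1E; apply: derivableP; exact: (dF 0%N).
  have d2 := is_derive_taylor_sum F a N y.
  exact: is_deriveB.
have bdR y : `|y - a| <= `|x - a| -> `|dRm y| <= C * `|x - a| ^+ N.
  move=> yx; apply: (@le_trans _ _ (C * `|y - a| ^+ N)); last first.
    by rewrite ler_wpM2l// lerXn2r ?nnegrE.
  apply: IHN => [n z nN zy|z zy].
    by rewrite -derive1Sn; apply: dF => //; exact: le_trans yx.
  by rewrite -derive1Sn; apply: bF; exact: le_trans yx.
rewrite -/(Rm x) exprSr mulrA.
have [xa|/ltW xa] := leP a x.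
  have xa' y : y \in `[a, x] -> `|y - a| <= `|x - a|.
    by rewrite in_itv/= => /andP[ay yx]; rewrite !ger0_norm ?subr_ge0// lerD2r.
  have [||c cax e] := MVT_segment xa (f := Rm) (df := dRm).
  - by move=> y yax; apply: dR; apply: xa'; exact: subset_itv_oo_cc yax.
  - by apply: derivable_within_continuous => y /xa' /dR [].
  - rewrite -[Rm x]subr0 -Rma e normrM ler_wpM2r// bdR//; exact: xa'.
have xa' y : y \in `[x, a] -> `|y - a| <= `|x - a|.
  rewrite in_itv/= => /andP[xy ya]; rewrite distrC [leRHS]distrC.
  by rewrite !ger0_norm ?subr_ge0// lerD2l lerN2.
have [||c cax e] := MVT_segment xa (f := Rm) (df := dRm).
- by move=> y yax; apply: dR; apply: xa'; exact: subset_itv_oo_cc yax.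
- by apply: derivable_within_continuous => y /xa' /dR [].
- rewrite -normrN -[- Rm x]add0r -Rma e normrM [`|a - x|]distrC ler_wpM2r// bdR//; exact: xa'.
Qed.

Lemma derive1n_expR n : derive1n n (@expR R) = expR.
Proof.
elim: n => [//|n IHn]; rewrite derive1nS IHn; apply/funext => x.
by rewrite derive1E derive_val.
Qed.

Lemma expR_taylor_bound N (u : R) :
  `|expR u - \sum_(n < N) u ^+ n / n`!%:R| <= expR `|u| * `|u| ^+ N.
Proof.
have := @taylor_bound (@expR R) 0 u (expR `|u|) N (expR_ge0 _).
rewrite !subr0 /taylor_sum.
under eq_bigr => j _ do rewrite derive1n_expR expR0 div1r subr0 mulrC.
apply.
- by move=> n y _ _; rewrite derive1n_expR; exact: derivable_expR.
- move=> y; rewrite subr0 derive1n_expR => yu.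
  by rewrite ger0_norm ?expR_ge0// ler_expR (le_trans (ler_norm _)).
Qed.

Lemma taylor_local F a N r : 0 < r ->
  (forall n y, `|y - a| <= r -> derivable (derive1n n F) y 1) ->
  exists2 C, 0 <= C & forall x, `|x - a| <= r ->
    `|F x - taylor_sum F a N x| <= C * `|x - a| ^+ N.
Proof.
move=> r0 dF.
have cN : {within `[a - r, a + r], continuous (derive1n N F)}.
  apply: derivable_within_continuous => y; rewrite in_itv/= -ler_distl => yr.
  exact: dF.
have [M [Mreal bM]] : bounded_set (derive1n N F @` `[a - r, a + r]).
  apply: compact_bounded; apply: continuous_compact => //.
  exact: segment_compact.
pose C := Num.max 0 (M + 1).
exists C; first by rewrite le_max lexx.
move=> x xr; apply: taylor_bound => [|n y _ yx|y yx].
- by rewrite le_max lexx.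
- by apply: dF; exact: le_trans xr.
- apply: (@le_trans _ _ (M + 1)); last by rewrite le_max lexx orbT.
  apply: bM; first by rewrite ltrDl.
  by exists y => //=; rewrite in_itv/= -ler_distl (le_trans yx).
Qed.

End taylor.

(** * Integrability of real-valued functions *)

Section real_integrals.
Context d (T : measurableType d) (R : realType) (mu : {measure set T -> \bar R}).
Implicit Types f h : T -> R.

Lemma integrableD_real f h : mu.-integrable setT (EFin \o f) ->
  mu.-integrable setT (EFin \o h) ->
  mu.-integrable setT (EFin \o (fun x => f x + h x)).
Proof.
move=> intf inth; rewrite (_ : _ \o _ = (EFin \o f) \+ (EFin \o h))%E.
  exact: integrableD.
by apply/funext => x /=; rewrite EFinD.
Qed.

Lemma integrableZ_real c f : mu.-integrable setT (EFin \o f) ->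
  mu.-integrable setT (EFin \o (fun x => c * f x)).
Proof.
by move=> intf; apply: (integrableZl measurableT c intf).
Qed.

Lemma integrable_sum_real (I : Type) (s : seq I) (P : pred I) (F : I -> T -> R) :
  (forall i, P i -> mu.-integrable setT (EFin \o F i)) ->
  mu.-integrable setT (EFin \o (fun x => \sum_(i <- s | P i) F i x)).
Proof.
move=> intF; rewrite (_ : _ \o _ = fun x => (\sum_(i <- s | P i) (F i x)%:E)%E).
  exact: integrable_sum.
by apply/funext => x /=; rewrite sumEFin.
Qed.

Lemma Rintegral_sum (I : Type) (s : seq I) (P : pred I) (F : I -> T -> R) :
  (forall i, P i -> mu.-integrable setT (EFin \o F i)) ->
  \int[mu]_x (\sum_(i <- s | P i) F i x) = \sum_(i <- s | P i) \int[mu]_x F i x.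
Proof.
move=> intF; elim: s => [|i s IHs].
  rewrite big_nil; under eq_Rintegral do rewrite big_nil.
  by rewrite /Rintegral integral0.
rewrite big_cons; under eq_Rintegral do rewrite big_cons.
case: ifP => // Pi; rewrite RintegralD//; first by rewrite IHs.
  exact: intF.
exact: integrable_sum_real.
Qed.

Lemma le_integrable_real f h : measurable_fun setT f ->
  (forall x, `|f x| <= h x) -> mu.-integrable setT (EFin \o h) ->
  mu.-integrable setT (EFin \o f).
Proof.
move=> mf fh inth; apply: (le_integrable _ _ _ inth) => //.
  exact: measurable_funEFin.
by move=> x _ /=; rewrite lee_fin (le_trans (fh x))// ler_norm.
Qed.

End real_integrals.

Section inj_sum_integral.
Context d (T : measurableType d) (R : realType) (mu : {measure set T -> \bar R}).
Variables (l : nat).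

Lemma integral_inj_sum k (F : seq nat -> T -> R) :
  (forall s, inj_seq l k s -> mu.-integrable setT (EFin \o F s)) ->
  mu.-integrable setT (EFin \o (fun x => inj_sum l k (F ^~ x))) /\
  \int[mu]_x (inj_sum l k (F ^~ x)) = inj_sum l k (fun s => \int[mu]_x F s x).
Proof.
elim: k F => [|k IHk] F intF; first by split => //; exact: intF.
pose F' s x := \sum_(a <- iota 0 l | (a \in iota 0 l) && (a \notin s)) F (rcons s a) x.
have FE : (fun x => inj_sum l k.+1 (F ^~ x)) = (fun x => inj_sum l k (F' ^~ x)).
  apply/funext => x /=; apply: eq_inj_sum => s _.
  by rewrite /F' [LHS]big_seq_cond.
have [|i1 i2] := IHk F'.
  move=> s sk; apply: integrable_sum_real => a /andP[al ans].
  by apply: intF; exact: inj_seq_rcons.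
rewrite FE; split => //; rewrite i2 /=; apply: eq_inj_sum => s sk.
rewrite Rintegral_sum; first by rewrite [RHS]big_seq_cond.
by move=> a /andP[al ans]; apply: intF; exact: inj_seq_rcons.
Qed.

End inj_sum_integral.

(** * Moments of the pair sum *)

Section pairs_of_power.
Context d (T : measurableType d) (R : realType) (nu : {finite_measure set T -> \bar R}).
Local Open Scope ereal_scope.

Lemma ge0_integral_pair l (i j : 'I_l) (f : T * T -> \bar R) : i != j ->
  measurable_fun setT f -> (forall p, 0 <= f p) ->
  \int[power_measure nu l]_x f (tnth x i, tnth x j) =
  (fine (nu setT) ^+ (l - 2))%:E * \int[nu \x nu]_p f p.
Proof.
move=> ij mf f0.
pose s (a : 'I_2) := if a == ord0 then i else j.
have s_inj : injective s.
  move=> a b; rewrite /s; case: eqP => [->|a0]; case: eqP => [->|b0]//.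
  - by move/eqP; rewrite (negbTE ij).
  - by move/esym/eqP; rewrite (negbTE ij).
  - have val1 (c : 'I_2) : c <> ord0 -> val c = 1%N.
      by case: c => -[|[|//]] ic // H; case: H; exact: val_inj.
    by move=> _; apply/val_inj; rewrite !val1.
pose f2 (t : 2.-tuple T) := f (tnth t ord0, tnth t ord_max).
have mf2 : measurable_fun setT f2.
  apply: measurableT_comp => //; apply: measurable_fun_pair; exact: measurable_tnth.
transitivity (\int[power_measure nu l]_x f2 (reindex_tuple s x)).
  by apply: eq_integral => x _; rewrite /f2 !tnth_mktuple.
rewrite ge0_integral_reindex//; last by move=> t; exact: f0.
congr (_ * _); rewrite ge0_integral_power_measureS//; last by move=> t; exact: f0.
rewrite fubini_tonelli1//; apply: eq_integral => x _; rewrite /fubini_F.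
have mf2x : measurable_fun setT (fun t : 1.-tuple T => f2 (tuple_cons (x, t))).
  apply: (measurableT_comp mf2).
  apply: (measurableT_comp (@measurable_tuple_cons _ _ 1)).
  exact: pair1_measurable.
rewrite ge0_integral_power_measureS//; last by move=> t; exact: f0.
apply: eq_integral => y _.
rewrite /= integral_dirac//; last first.
  apply: (measurableT_comp mf2x).
  apply: (measurableT_comp (@measurable_tuple_cons _ _ 0)).
  exact: pair1_measurable.
by rewrite diracE in_setT mul1e.
Qed.

(** A null set of pairs pulls back to a null set along two distinct coordinates. For [i = j] nothing
    can be said, since the diagonal may itself be null. *)
Lemma ae_power_pair l (Q : T * T -> Prop) : {ae (nu \x nu), forall p, Q p} ->
  {ae power_measure nu l, forall x, forall i j : 'I_l, i != j -> Q (tnth x i, tnth x j)}.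
Proof.
move=> [N [mN N0 QN]].
have aeij (i j : 'I_l) : i != j ->
    {ae power_measure nu l, forall x, Q (tnth x i, tnth x j)}.
  move=> ij; have mp : measurable_fun setT (fun x : l.-tuple T => (tnth x i, tnth x j)).
    by apply: measurable_fun_pair; exact: measurable_tnth.
  exists ((fun x : l.-tuple T => (tnth x i, tnth x j)) @^-1` N); split.
  - by rewrite -[X in measurable X]setTI; exact: mp.
  - rewrite -[X in power_measure _ _ X]setIT -integral_indic//; last first.
      by rewrite -[X in measurable X]setTI; exact: mp.
    have := @ge0_integral_pair l i j (EFin \o \1_N) ij.
    rewrite (eq_integral (fun x => (\1_N (tnth x i, tnth x j))%:E))// => ->.
    + rewrite (_ : integral _ _ _ = 0) ?mule0//.
      by rewrite integral_indic// setIT; exact: N0.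
    + exact: measurable_funEFin.
    + by move=> p; rewrite lee_fin.
  - by move=> x /= nQ; exact: QN.
(* [ae_foralln] intersects over natural numbers, so the bounds on the indices become hypotheses
   inside the property. *)
have aeij' (i j : nat) : {ae power_measure nu l, forall x, forall (hi : (i < l)%N) (hj : (j < l)%N),
   i != j -> Q (tnth x (Ordinal hi), tnth x (Ordinal hj))}.
  have [hi|hi] := pselect (i < l)%N; last by apply: aeW => x hi'.
  have [hj|hj] := pselect (j < l)%N; last by apply: aeW => x hi' hj'.
  have [->|ij] := eqVneq i j; first by apply: aeW.
  apply: filterS (aeij (Ordinal hi) (Ordinal hj) ij) => x Qx hi' hj' _.
  by rewrite (bool_irrelevance hi' hi) (bool_irrelevance hj' hj).
have := ae_foralln (fun i => ae_foralln (aeij' i)).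
apply: filterS => x H [i hi] [j hj] ij; exact: H.
Qed.

End pairs_of_power.

(** * Exponential bounds *)

Section exponential_moments.
Variable R : realType.

(** Some term is at least the average, so a single exponential dominates; the [1] covers the empty
    sum. Applied twice, this bounds the exponential of a pair sum by functions of one pair each. *)
Lemma expR_sum_le n (a : 'I_n -> R) :
  expR (\sum_i a i) <= 1 + \sum_i expR (n%:R * a i).
Proof.
case: n a => [|n] a.
  by rewrite !big_ord0 expR0 addr0.
have [i ai] : exists i, \sum_i a i <= n.+1%:R * a i.
  apply/not_existsP => H.
  have : \sum_i n.+1%:R * a i < \sum_(i < n.+1) \sum_i a i.
    apply: ltr_sum => [|i _].
      by apply/hasP; exists ord0 => //; rewrite mem_index_enum.
    by rewrite ltNge; apply/negP/H.
  by rewrite sumr_const card_ord -mulr_sumr mulr_natl ltxx.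
apply: (@le_trans _ _ (expR (n.+1%:R * a i))); first by rewrite ler_expR.
by rewrite (bigD1 i)//= addrCA lerDl addr_ge0// sumr_ge0.
Qed.

(** One term of the exponential series: a power is paid for by an arbitrarily small exponential
    rate. *)
Lemma exprn_le_expR (u r : R) n : 0 <= u -> 0 < r ->
  u ^+ n <= (n`!%:R / r ^+ n) * expR (r * u).
Proof.
move=> u0 r0; case: n => [|n].
  by rewrite !expr0 divr1 mul1r -expR0 ler_expR mulr_ge0// ltW.
have := @expR_ge1Dxn R (r * u) n (mulr_ge0 (ltW r0) u0).
move=> /(le_trans _) h; rewrite -mulrA [r ^- _ * _]mulrC mulrA ler_pdivlMr ?exprn_gt0//.
rewrite -exprMn [u * r]mulrC [leRHS]mulrC -ler_pdivrMr ?mulr_gt0 ?ltr0n ?fact_gt0//.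
by apply: h; rewrite lerDr.
Qed.

End exponential_moments.

Section pair_sum_measurable.
Context d (T : measurableType d) (R : realType) (x0 : T).

Lemma measurable_nth l i : measurable_fun setT (fun x : l.-tuple T => nth x0 x i).
Proof.
have [il|li] := ltnP i l.
  rewrite (_ : (fun _ => _) = (@tnth _ T ^~ (Ordinal il))).
    exact: measurable_tnth.
  by apply/funext => x; rewrite (tnth_nth x0).
rewrite (_ : (fun _ => _) = cst x0); first exact: measurable_cst.
by apply/funext => x /=; rewrite nth_default// size_tuple.
Qed.

Lemma measurable_nth2 (g : T -> T -> R) l i j :
  measurable_fun setT (fun p : T * T => g p.1 p.2) ->
  measurable_fun setT (fun x : l.-tuple T => g (nth x0 x i) (nth x0 x j)).
Proof.
move=> mg; apply: (measurableT_comp (g := fun x : l.-tuple T => (nth x0 x i, nth x0 x j)) mg).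
by apply: measurable_fun_pair; exact: measurable_nth.
Qed.

Lemma measurable_pair_sum (g : T -> T -> R) l k :
  measurable_fun setT (fun p : T * T => g p.1 p.2) ->
  measurable_fun setT (fun x : l.-tuple T => pair_sum g k (nth x0 x)).
Proof.
move=> mg; apply: measurable_sum => j; apply: measurable_sum => i.
exact: measurable_nth2.
Qed.

Lemma measurable_h_coef0 (g : T -> T -> R) n l k :
  measurable_fun setT (fun p : T * T => g p.1 p.2) ->
  measurable_fun setT (fun x : l.-tuple T => h_coef0 g n k (nth x0 x)).
Proof.
move=> mg; elim: n k => [|n IHn] k; first exact: measurable_cst.
under eq_fun do rewrite h_coef0S.
apply: measurable_funD; first apply: measurable_funD.
- case: (1 < k)%N; last exact: measurable_cst.
  by apply: measurable_funM; [exact: measurable_funM|exact: measurable_nth2].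
- case: (0 < k)%N; last exact: measurable_cst.
  apply: measurable_funM => //; apply: measurable_sum => i.
  exact: measurable_nth2.
- by apply: measurable_funM => //; exact: measurable_pair_sum.
Qed.

End pair_sum_measurable.

Section moments.
Context d (T : measurableType d) (R : realType) (nu : {finite_measure set T -> \bar R}).
Variables (x0 : T) (g : T -> T -> R) (G : T * T -> R) (c : R).
Hypotheses (c0 : 0 < c)
  (mg : measurable_fun setT (fun p : T * T => g p.1 p.2))
  (mG : measurable_fun setT G)
  (symg : forall a b, g a b = g b a)
  (gG : forall a b, `|g a b| <= G (a, b))
  (expG : (\int[nu \x nu]_p (expR (c * G p))%:E < +oo)%E).

Local Notation pow := (power_measure nu).
Let Gc a b := G (a, b).
Let b := fine (nu setT).

(** The two uses of [expR_sum_le] multiply the rate by [l] and by some [j < l], so each [G] ends up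
    with a coefficient at most [c]. Taking [l.+1] keeps the rate meaningful at [l = 0]. *)
Definition exp_rate l : R := c / (l.+1 ^ 2)%:R.

Lemma exp_rate_gt0 l : 0 < exp_rate l.
Proof. by rewrite divr_gt0// ltr0n expn_gt0. Qed.

Let mGc : measurable_fun setT (fun p : T * T => Gc p.1 p.2).
Proof. by rewrite (_ : (fun _ => _) = G)//; apply/funext => -[]. Qed.

Let G0 p : 0 <= G p.
Proof. by case: p => x y; rewrite (le_trans _ (gG x y)). Qed.

Lemma integrable_cst_power l (r : R) : (pow l).-integrable setT (EFin \o cst r).
Proof.
apply/integrableP; split; first by apply: measurable_funEFin.
rewrite (eq_integral (cst `|r|%:E))// integral_cst//= lte_mul_pinfty//.
exact: (@power_measure_lty _ _ _ nu l setT).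
Qed.

Lemma pair_sum_bound_ge0 k x : 0 <= pair_sum Gc k x.
Proof. by apply: sumr_ge0 => j _; apply: sumr_ge0 => i _; exact: G0. Qed.

Lemma le_pair_sum k x : `|pair_sum g k x| <= pair_sum Gc k x.
Proof.
apply: le_trans (ler_norm_sum _ _ _) _; apply: ler_sum => j _.
by apply: le_trans (ler_norm_sum _ _ _) _; apply: ler_sum => i _; exact: gG.
Qed.

Lemma integrable_exp_bound l : (pow l).-integrable setT
  (EFin \o (fun x => expR (exp_rate l * pair_sum Gc l (nth x0 x)))).
Proof.
pose h (x : l.-tuple T) := 1 + \sum_(j < l) (1 + \sum_(i < j)
  expR (c * G (nth x0 x i, nth x0 x j))).
apply: (@le_integrable_real _ _ _ _ _ h).
- apply: measurableT_comp => //; apply: measurable_funM => //.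
  exact: measurable_pair_sum.
- move=> x; rewrite ger0_norm ?expR_ge0// /pair_sum mulr_sumr.
  apply: le_trans (expR_sum_le _) _; rewrite lerD2l; apply: ler_sum => j _.
  rewrite !mulr_sumr; apply: le_trans (expR_sum_le _) _; rewrite lerD2l.
  apply: ler_sum => i _; rewrite ler_expR !mulrA ler_wpM2r ?G0//.
  rewrite ler_pdivrMr ?ltr0n ?expn_gt0// [leLHS]mulrC ler_pM2l//.
  rewrite -natrM ler_nat expnS expn1.
  by rewrite leq_mul// ltnW// ltnS// ltnW.
- apply: integrableD_real; first exact: integrable_cst_power.
  apply: integrable_sum_real => j _; apply: integrableD_real.
    exact: integrable_cst_power.
  apply: integrable_sum_real => i _.
  have il : (i < l)%N by rewrite (ltn_trans (ltn_ord i)).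
  have ij : Ordinal il != j by rewrite -val_eqE/= ltn_eqF.
  have e : (\int[pow l]_x (expR (c * G (nth x0 x i, nth x0 x j)))%:E =
      (b ^+ (l - 2))%:E * \int[nu \x nu]_p (expR (c * G p))%:E)%E.
    rewrite -(ge0_integral_pair _ ij (f := fun p => (expR (c * G p))%:E)); last 2 first.
    - by apply: measurable_funEFin; apply: measurableT_comp => //; exact: measurable_funM.
    - by move=> p; rewrite lee_fin expR_ge0.
    by apply: eq_integral => x _; rewrite !(tnth_nth x0).
  apply/integrableP; split.
    apply: measurable_funEFin; apply: measurableT_comp => //; apply: measurable_funM => //.
    exact: (measurable_nth2 _ (g := Gc)).
  rewrite (eq_integral (fun x : l.-tuple T => (expR (c * G (nth x0 x i, nth x0 x j)))%:E)).
    rewrite e lte_mul_pinfty// lee_fin exprn_ge0// /b fine_ge0//.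
  by move=> x _ /=; rewrite ger0_norm ?expR_ge0.
Qed.

Lemma integrable_le_exp l (w : l.-tuple T -> R) C : measurable_fun setT w ->
  (forall x, `|w x| <= C * expR (exp_rate l * pair_sum Gc l (nth x0 x))) ->
  (pow l).-integrable setT (EFin \o w).
Proof.
move=> mw wC; apply: (le_integrable_real mw wC).
by apply: integrableZ_real; exact: integrable_exp_bound.
Qed.

Lemma integrable_le_bound_expn l (w : l.-tuple T -> R) C n : measurable_fun setT w ->
  0 <= C -> (forall x, `|w x| <= C * pair_sum Gc l (nth x0 x) ^+ n) ->
  (pow l).-integrable setT (EFin \o w).
Proof.
move=> mw C0 wC.
apply: (@integrable_le_exp _ _ (C * (n`!%:R / exp_rate l ^+ n))) => // x.
rewrite -mulrA; apply: le_trans (wC x) _; rewrite ler_wpM2l//.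
exact: exprn_le_expR (pair_sum_bound_ge0 _ _) (exp_rate_gt0 l).
Qed.

(** Each of the three terms of the recursion costs at most one more factor [pair_sum Gc k x]. Since
    [G] is nonnegative, this pair sum increases with [k], so it also bounds the terms with fewer
    points. *)
Lemma le_h_coef0 n k x : `|h_coef0 g n k x| <= 3 ^+ n * pair_sum Gc k x ^+ n.
Proof.
elim: n k => [|n IHn] k.
  by rewrite !expr0 mulr1 /h_coef0; case: eqP => _; rewrite ?normr1 ?normr0.
have G_ge0 := pair_sum_bound_ge0.
have pS j : pair_sum Gc j.+1 x = pair_sum Gc j x + \sum_(i < j) Gc (x i) (x j).
  by rewrite /pair_sum big_ord_recr.
have s0 j : 0 <= \sum_(i < j) Gc (x i) (x j) by apply: sumr_ge0 => i _; exact: G0.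
have pmon j : pair_sum Gc j x <= pair_sum Gc j.+1 x by rewrite pS lerDl.
have IH j : (j <= k)%N -> `|h_coef0 g n j x| <= 3 ^+ n * pair_sum Gc k x ^+ n.
  move=> jk; apply: le_trans (IHn j) _; rewrite ler_wpM2l ?exprn_ge0//.
  apply: lerXn2r; rewrite ?nnegrE//.
  exact: (homo_leq (@le_refl _ _) (@le_trans _ _) pmon).
have last j : (j.+1 <= k)%N -> `|\sum_(i < j) g (x i) (x j)| <= pair_sum Gc k x.
  move=> jk; apply: (@le_trans _ _ (\sum_(i < j) Gc (x i) (x j))).
    by apply: le_trans (ler_norm_sum _ _ _) _; apply: ler_sum => i _; exact: gG.
  apply: (@le_trans _ _ (pair_sum Gc j.+1 x)); first by rewrite pS lerDr.
  exact: (homo_leq (@le_refl _ _) (@le_trans _ _) pmon).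
have g2 : (1 < k)%N -> `|g (x k.-2) (x k.-1)| <= pair_sum Gc k x.
  case: (k) => [//|[//|j]] _ /=; apply: le_trans (gG _ _) _.
  rewrite pS big_ord_recr /= addrA lerDr addr_ge0// sumr_ge0// => i _.
  exact: G0.
set A := 3 ^+ n * _ in IH; set p := pair_sum Gc k x in last g2 *.
have p0 : 0 <= p by exact: G_ge0.
have A0 : 0 <= A by rewrite mulr_ge0// exprn_ge0.
rewrite h_coef0S.
have -> : 3 ^+ n.+1 * p ^+ n.+1 = A * p + A * p + A * p.
  by rewrite /A !exprS; ring.
apply: le_trans (ler_normD _ _) _; apply: lerD; last first.
  rewrite normrM; exact: ler_pM (IH _ (leqnn k)) (le_pair_sum k x).
apply: le_trans (ler_normD _ _) _; apply: lerD.
  case: ifP => [k2|_]; last by rewrite normr0 mulr_ge0.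
  rewrite !normrM ler_pM//.
    rewrite -[leRHS]mul1r ler_pM//; first by rewrite ger0_norm//; lra.
    by apply: IH; rewrite (leq_trans (leq_pred _))// leq_pred.
  exact: g2.
case: ifP => [k1|_]; last by rewrite normr0 mulr_ge0.
rewrite normrM ler_pM//; first by apply: IH; exact: leq_pred.
by apply: last; rewrite prednK.
Qed.

Lemma integrable_h_coef0 n k : (pow k).-integrable setT
  (EFin \o (fun x => h_coef0 g n k (nth x0 x))).
Proof.
apply: (@integrable_le_bound_expn _ _ (3 ^+ n) n).
- exact: measurable_h_coef0.
- exact: exprn_ge0.
- by move=> x; exact: le_h_coef0.
Qed.

Lemma integrable_pair_sum_expn n l : (pow l).-integrable setT
  (EFin \o (fun x => pair_sum g l (nth x0 x) ^+ n)).
Proof.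
apply: (@integrable_le_bound_expn _ _ 1 n) => //.
- by apply: measurable_funX; exact: measurable_pair_sum.
- move=> x; rewrite mul1r normrX lerXn2r ?nnegrE//; last exact: le_pair_sum.
  exact: pair_sum_bound_ge0.
Qed.

(** The [M_(l,n)] of the overview; [h_integral] is its [H_(n,k)], extended to [n = 0] by the
    convention of [h_coef0]. *)
Definition pair_moment l n := \int[pow l]_x (pair_sum g l (nth x0 x) ^+ n).
Definition h_integral n k := \int[pow k]_x h_coef0 g n k (nth x0 x).

Lemma integral_h_coef0_sel n k l s : inj_seq l k s ->
  (pow l).-integrable setT
    (EFin \o (fun x : l.-tuple T => h_coef0 g n k (fun i => nth x0 x (nth 0%N s i)))) /\
  \int[pow l]_x h_coef0 g n k (fun i => nth x0 x (nth 0%N s i)) =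
  b ^+ (l - k) * h_integral n k.
Proof.
move=> /and3P[us /eqP ss al].
have sl (i : 'I_k) : (nth 0%N s i < l)%N.
  by apply: (allP al); apply: mem_nth; rewrite ss.
pose sg (i : 'I_k) : 'I_l := Ordinal (sl i).
have sg_inj : injective sg.
  move=> i j /(congr1 val)/= /eqP; rewrite nth_uniq ?ss// => /eqP ij.
  exact: val_inj.
have := integral_reindex sg_inj (integrable_h_coef0 n k).
have e (x : l.-tuple T) : h_coef0 g n k (nth x0 (reindex_tuple sg x)) =
    h_coef0 g n k (fun i => nth x0 x (nth 0%N s i)).
  apply: h_coef0_ext => i ik.
  rewrite -[i]/(val (Ordinal ik)) -tnth_nth tnth_mktuple.
  by rewrite (tnth_nth x0).
move=> [i1 i2]; split.
  by rewrite (_ : _ \o _ = fun x => (h_coef0 g n k (nth x0 (reindex_tuple sg x)))%:E)//;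
    apply/funext => x /=; rewrite e.
by rewrite -i2; apply: eq_Rintegral => x _; rewrite e.
Qed.

Lemma pair_momentE l n : pair_moment l n =
  \sum_(k < n.*2.+1) (l ^_ k)%:R * b ^+ (l - k) * h_integral n k.
Proof.
rewrite /pair_moment.
under eq_Rintegral => x _ do rewrite (pair_sum_expn (l := l) (fun i j _ _ => symg _ _)).
have H k := @integral_inj_sum _ _ _ (pow l) l k
  (fun s x => h_coef0 g n k (fun i => nth x0 x (nth 0%N s i)))
  (fun s sk => (integral_h_coef0_sel n sk).1).
rewrite Rintegral_sum; last by move=> k _; exact: (H k).1.
apply: eq_bigr => k _; rewrite (H k).2 -mulrA -inj_sum_cst.
by apply: eq_inj_sum => s sk; rewrite (integral_h_coef0_sel n sk).2.
Qed.

Lemma h_integral_inversion n k :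
  \sum_(l < k.+1) 'C(k, l)%:R * (- b) ^+ (k - l) * pair_moment l n =
  if (k < n.*2.+1)%N then k`!%:R * h_integral n k else 0.
Proof.
rewrite -(binomial_inversion b n.*2.+1 (h_integral n) k).
by apply: eq_bigr => l _; rewrite pair_momentE.
Qed.

(** Half of the rate absorbs the power and the other half dominates the exponential, hence the bound
    [exp_rate l / 2] on [mu]. *)
Lemma le_pair_sum_expR n l (mu : R) (x : nat -> T) : `|mu| <= exp_rate l / 2 ->
  `|pair_sum g l x| ^+ n * expR (`|mu| * `|pair_sum g l x|) <=
  n`!%:R / (exp_rate l / 2) ^+ n * expR (exp_rate l * pair_sum Gc l x).
Proof.
move=> mur; have r0 : 0 < exp_rate l / 2 by rewrite divr_gt0// exp_rate_gt0.
have G_ge0 := pair_sum_bound_ge0 l x.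
have -> : expR (exp_rate l * pair_sum Gc l x) =
    expR (exp_rate l / 2 * pair_sum Gc l x) * expR (exp_rate l / 2 * pair_sum Gc l x).
  by rewrite -expRD; congr expR; field.
rewrite mulrA ler_pM ?expR_ge0 ?exprn_ge0//.
  apply: le_trans (exprn_le_expR n G_ge0 r0).
  by rewrite lerXn2r ?nnegrE// le_pair_sum.
by rewrite ler_expR ler_pM// le_pair_sum.
Qed.

Let measurable_pexp n l mu : measurable_fun setT (fun x : l.-tuple T =>
  pair_sum g l (nth x0 x) ^+ n * expR (mu * pair_sum g l (nth x0 x))).
Proof.
have mp : measurable_fun setT (fun x : l.-tuple T => pair_sum g l (nth x0 x)).
  exact: measurable_pair_sum.
apply: measurable_funM; first exact: measurable_funX.
by apply: measurableT_comp => //; exact: measurable_funM.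
Qed.

Lemma integrable_pair_sum_expR n l (mu : R) : `|mu| <= exp_rate l / 2 ->
  (pow l).-integrable setT (EFin \o (fun x =>
    pair_sum g l (nth x0 x) ^+ n * expR (mu * pair_sum g l (nth x0 x)))).
Proof.
move=> mur; apply: integrable_le_exp => // x.
rewrite normrM normrX; apply: le_trans (le_pair_sum_expR n _ mur).
by rewrite ler_wpM2l ?exprn_ge0// ger0_norm ?expR_ge0// ler_expR -normrM ler_norm.
Qed.

(** For [n = 0] this is the moment [S_l]; for larger [n] it is the derivative of order [n] taken
    under the integral sign. *)
Definition exp_moment l n (mu : R) : R :=
  \int[pow l]_x (pair_sum g l (nth x0 x) ^+ n * expR (mu * pair_sum g l (nth x0 x))).

Lemma exp_moment0 l n : exp_moment l n 0 = pair_moment l n.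
Proof. by apply: eq_Rintegral => x _; rewrite mul0r expR0 mulr1. Qed.

(** The pointwise Taylor remainder of the exponential is at most [|mu|^N] times an integrable
    function that does not depend on [mu]. *)
Lemma exp_moment_taylor l N : exists2 C, 0 <= C & forall mu : R,
  `|mu| <= exp_rate l / 2 ->
  `|exp_moment l 0 mu - \sum_(n < N) pair_moment l n / n`!%:R * mu ^+ n| <=
    C * `|mu| ^+ N.
Proof.
pose K := N`!%:R / (exp_rate l / 2) ^+ N.
have r0 : 0 < exp_rate l / 2 by rewrite divr_gt0// exp_rate_gt0.
have K0 : 0 <= K by rewrite divr_ge0// exprn_ge0// ltW.
pose I := \int[pow l]_x expR (exp_rate l * pair_sum Gc l (nth x0 x)).
have I0 : 0 <= I by apply: Rintegral_ge0 => x _; exact: expR_ge0.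
exists (K * I); first exact: mulr_ge0.
move=> mu mur.
pose w (x : l.-tuple T) := expR (mu * pair_sum g l (nth x0 x)) -
  \sum_(n < N) (mu * pair_sum g l (nth x0 x)) ^+ n / n`!%:R.
have intn n : (pow l).-integrable setT (EFin \o (fun x : l.-tuple T =>
    (mu * pair_sum g l (nth x0 x)) ^+ n / n`!%:R)).
  have := integrableZ_real (mu ^+ n / n`!%:R) (integrable_pair_sum_expn n l).
  by apply: eq_integrable => // x _ /=; rewrite exprMn mulrAC.
have inte : (pow l).-integrable setT (EFin \o (fun x : l.-tuple T =>
    expR (mu * pair_sum g l (nth x0 x)))).
  have := integrable_pair_sum_expR 0 mur.
  by apply: eq_integrable => // x _ /=; rewrite mul1r.
have ints : (pow l).-integrable setT (EFin \o (fun x : l.-tuple T =>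
    \sum_(n < N) (mu * pair_sum g l (nth x0 x)) ^+ n / n`!%:R)).
  by apply: integrable_sum_real => n _; exact: intn.
have -> : exp_moment l 0 mu - \sum_(n < N) pair_moment l n / n`!%:R * mu ^+ n =
    \int[pow l]_x w x.
  rewrite /w RintegralB//; congr (_ - _).
    by apply: eq_Rintegral => x _; rewrite expr0 mul1r.
  rewrite Rintegral_sum//; apply: eq_bigr => n _.
  rewrite mulrAC -mulrA mulrC -RintegralZl//; last exact: integrable_pair_sum_expn.
  by apply: eq_Rintegral => x _; rewrite exprMn mulrAC.
have intw : (pow l).-integrable setT (EFin \o w).
  rewrite (_ : EFin \o w = ((EFin \o (fun x : l.-tuple T =>
      expR (mu * pair_sum g l (nth x0 x)))) \-
    (EFin \o (fun x : l.-tuple T =>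
      (\sum_(n < N) (mu * pair_sum g l (nth x0 x)) ^+ n / n`!%:R)%R)))%E).
    exact: integrableB.
  by apply/funext => x; rewrite /w /= EFinB.
apply: le_trans (le_normr_Rintegral measurableT intw) _.
have -> : K * I * `|mu| ^+ N = \int[pow l]_x ((K * `|mu| ^+ N) *
    expR (exp_rate l * pair_sum Gc l (nth x0 x))).
  rewrite RintegralZl//; last exact: integrable_exp_bound.
  by rewrite mulrAC.
apply: le_Rintegral => //.
- by apply: integrable_norm.
- by apply: integrableZ_real; exact: integrable_exp_bound.
move=> x _; apply: le_trans (expR_taylor_bound _ _) _.
rewrite normrM exprMn; have := le_pair_sum_expR N (nth x0 x) mur.
move: (expR _) (expR _) (`|pair_sum g _ _| ^+ N) (`|mu| ^+ N) (exprn_ge0 N (normr_ge0 mu)).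
move=> E e p m m0 h; rewrite -/K in h.
rewrite [leLHS](_ : _ = m * (p * e)); last by ring.
by rewrite [leRHS](_ : _ = m * (K * E)) ?ler_wpM2l//; ring.
Qed.

Lemma is_derive_exp_moment l n (mu : R) : `|mu| < exp_rate l / 2 ->
  is_derive mu 1 (exp_moment l n) (exp_moment l n.+1 mu).
Proof.
move=> mur; pose r := exp_rate l / 2.
pose f (t : R) (x : l.-tuple T) :=
  pair_sum g l (nth x0 x) ^+ n * expR (t * pair_sum g l (nth x0 x)).
have rI t : `]- r, r[%classic t -> `|t| <= r.
  by rewrite /= in_itv/= => /andP[h1 h2]; rewrite ler_norml !ltW.
have muI : `]- r, r[%classic mu by rewrite /= in_itv/= -ltr_norml.
have intf t : `]- r, r[%classic t -> (pow l).-integrable setT (EFin \o f t).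
  by move=> /rI tr; exact: integrable_pair_sum_expR.
have df (t : R) (x : l.-tuple T) : is_derive t 1 (f ^~ x) (f t x * pair_sum g l (nth x0 x)).
  rewrite /f; set p := pair_sum g l _.
  have -> : (fun t => p ^+ n * expR (t * p)) = cst (p ^+ n) * (@expR R \o (id * cst p)).
    by apply/funext => s; rewrite !fctE.
  apply: is_derive_eq; rewrite !fctE /GRing.scale/=.
  by rewrite !mulr0 mulr1 add0r addr0 mulrA.
have pf (t : R) (x : l.-tuple T) : partial1of2 f t x = f t x * pair_sum g l (nth x0 x).
  by rewrite partial1of2E derive_val.
(* The constant of [le_pair_sum_expR] for the power [n.+1] that differentiation brings down; the
   resulting bound is uniform in [t]. *)
pose C := n.+1`!%:R / r ^+ n.+1.
have r0 : 0 < r by rewrite divr_gt0// exp_rate_gt0.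
pose H (x : l.-tuple T) := C * expR (exp_rate l * pair_sum Gc l (nth x0 x)).
have H0 x : 0 <= H x by rewrite mulr_ge0 ?expR_ge0// divr_ge0// exprn_ge0// ltW.
have intH : (pow l).-integrable setT (EFin \o H).
  by apply: integrableZ_real; exact: integrable_exp_bound.
have bH (t : R) (x : l.-tuple T) : `]- r, r[%classic t -> setT x -> `|partial1of2 f t x| <= H x.
  move=> /rI tr _; rewrite pf /f mulrAC -exprSr normrM normrX.
  apply: le_trans (le_pair_sum_expR n.+1 _ tr).
  by rewrite ler_wpM2l ?exprn_ge0// ger0_norm ?expR_ge0// ler_expR -normrM ler_norm.
have derf (t : R) (x : l.-tuple T) : `]- r, r[%classic t -> setT x -> derivable (f ^~ x) t 1.
  by move=> _ _; exact: (@ex_derive _ _ _ _ _ _ _ (df t x)).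
apply: DeriveDef.
  exact: (derivable_under_integral measurableT muI intf derf H0 intH bH).
rewrite -derive1E.
rewrite (differentiation_under_integral measurableT muI intf derf H0 intH bH).
by apply: eq_Rintegral => x _; rewrite pf /f exprSr mulrAC.
Qed.

(** Differentiating once more requires the formula on a neighbourhood, so the induction carries the
    whole open interval. *)
Lemma near_derive1n_exp_moment l n : forall mu : R, `|mu| < exp_rate l / 2 ->
  derive1n n (exp_moment l 0) mu = exp_moment l n mu /\
  derivable (derive1n n (exp_moment l 0)) mu 1.
Proof.
have near_mu (f h : R -> R) (mu : R) : `|mu| < exp_rate l / 2 ->
    (forall t : R, `|t| < exp_rate l / 2 -> f t = h t) -> \near mu, f mu = h mu.
  rewrite ltr_norml => mur fh; have mui : mu \in `](- (exp_rate l / 2)), (exp_rate l / 2)[.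
    by rewrite in_itv.
  apply: filterS (near_in_itvoo mui) => t; rewrite in_itv/= -ltr_norml.
  exact: fh.
elim: n => [|n IHn] mu mur.
  by rewrite derive1n0; split => //; case: (is_derive_exp_moment 0 mur).
have e (t : R) : `|t| < exp_rate l / 2 -> derive1n n.+1 (exp_moment l 0) t = exp_moment l n.+1 t.
  move=> tr; rewrite derive1nS derive1E.
  have tn : \near t, derive1n n (exp_moment l 0) t = exp_moment l n t.
    by apply: near_mu => // s sr; exact: (IHn s sr).1.
  rewrite (near_eq_derive _ tn).
  exact: (@derive_val _ _ _ _ _ _ _ (is_derive_exp_moment n tr)).
split; first exact: e.
apply: (@near_eq_derivable _ _ _ (exp_moment l n.+1)).
  by apply: near_mu => // s sr; rewrite e.
by case: (is_derive_exp_moment n.+1 mur).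
Qed.

End moments.

(** * Exponential moments of Gaussian processes *)

Section gaussian_moments.
Context d (Omega : measurableType d) (R : realType) (P : probability Omega R).
Local Notation leb := (@lebesgue_measure R).

Lemma ge0_integral_normal_prob (s : R) (f : measurableTypeR R -> \bar R) :
  measurable_fun setT f -> (forall x, 0 <= f x)%E ->
  (\int[normal_prob 0 s]_x f x = \int[leb]_x (f x * (normal_pdf 0 s x)%:E))%E.
Proof.
move=> mf f0.
exact: (@ge0_integral_density _ (measurableTypeR R) R leb (normal_pdf 0 s)
  (normal_pdf_ge0 0 s) (integrable_normal_pdf 0 s)).
Qed.

(** Completing the square: tilting by [exp(t x)] moves the mean to [t s^2]. *)
Lemma normal_pdf_shift (s t x : R) : s != 0 ->
  expR (t * x) * normal_pdf 0 s x =
  expR (t ^+ 2 * s ^+ 2 / 2) * normal_pdf (t * s ^+ 2) s x.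
Proof.
move=> s0; rewrite !normal_pdfE// mulrCA [RHS]mulrCA; congr (_ * _).
rewrite /normal_fun -!expRD; congr expR; rewrite subr0.
by field; rewrite s0 /=.
Qed.

Lemma normal_prob_mgf (s t : R) : s != 0 ->
  (\int[normal_prob 0 s]_x (expR (t * x))%:E = (expR (t ^+ 2 * s ^+ 2 / 2))%:E)%E.
Proof.
move=> s0; rewrite ge0_integral_normal_prob; last 2 first.
- by apply: measurable_funEFin; apply: measurableT_comp => //; exact: measurable_funM.
- by move=> x; rewrite lee_fin expR_ge0.
under eq_integral do rewrite -EFinM normal_pdf_shift// EFinM.
have m1 : measurable_fun setT
    (fun x : measurableTypeR R => (normal_pdf (t * s ^+ 2) s x)%:E).
  by apply/measurable_EFinP; exact: measurable_normal_pdf.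
rewrite (ge0_integralZl _ measurableT m1)//; last first.
  by move=> x _; rewrite lee_fin normal_pdf_ge0.
by rewrite integral_normal_pdf mule1.
Qed.

Lemma centered_gaussian_mgf (Y : Omega -> R) : centered_gaussian P Y ->
  exists s : R, forall t : R,
    (\int[P]_w (expR (t * Y w))%:E = (expR (t ^+ 2 * s ^+ 2 / 2))%:E)%E.
Proof.
move=> [mY [s lawY]]; exists s => t.
have me : measurable_fun setT (fun x : measurableTypeR R => (expR (t * x))%:E).
  by apply: measurable_funEFin; apply: measurableT_comp => //; exact: measurable_funM.
pose Y' : Omega -> measurableTypeR R := Y.
have mY' : measurable_fun setT Y' by exact: mY.
transitivity (\int[pushforward P Y']_x (expR (t * x))%:E)%E.
  by rewrite ge0_integral_pushforward// => x _; rewrite lee_fin expR_ge0.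
have [s0|s0] := eqVneq s 0.
  transitivity (\int[\d_((0 : R)%R : measurableTypeR R)]_x (expR (t * x))%:E)%E.
    apply: eq_measure_integral => A mA _.
    by apply: etrans (lawY A mA) _; rewrite s0 eqxx.
  by rewrite integral_dirac// diracE in_setT mul1e s0 mulr0 expr0n !mulr0 mul0r.
rewrite -normal_prob_mgf//.
apply: eq_measure_integral => A mA _.
by apply: etrans (lawY A mA) _; rewrite (negbTE s0).
Qed.

(* Y ~ N(0, v) enters only through its moment generating function, which is
   differentiated under the integral at 0. *)
Section from_mgf.
Variables (Y : Omega -> R) (v : R).
Hypotheses (mY : measurable_fun setT Y) (mgf : forall t : R,
  (\int[P]_w (expR (t * Y w))%:E = (expR (t ^+ 2 * v / 2))%:E)%E).

Let integrable_exp t : P.-integrable setT (EFin \o (fun w => expR (t * Y w))).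
Proof.
apply/integrableP; split.
  apply: measurable_funEFin; apply: measurableT_comp => //; exact: measurable_funM.
rewrite (eq_integral (fun w => (expR (t * Y w))%:E)); last first.
  by move=> w _ /=; rewrite ger0_norm ?expR_ge0.
by rewrite mgf ltry.
Qed.

(** At least [exp(2 |Y|)]: one factor [exp |Y|] absorbs the powers of [Y], the other [exp(t Y)] for
    [|t| <= 1]. *)
Let H w := expR (2 * Y w) + expR ((- 2) * Y w).

Let integrable_H : P.-integrable setT (EFin \o H).
Proof. exact: integrableD_real. Qed.

Let le_H w n t : `|t| <= 1 -> `|Y w ^+ n * expR (t * Y w)| <= n`!%:R * H w.
Proof.
move=> t1; rewrite normrM normrX (ger0_norm (expR_ge0 _)).
have h1 := exprn_le_expR n (normr_ge0 (Y w)) ltr01.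
rewrite expr1n divr1 mul1r in h1.
have h2 : expR (t * Y w) <= expR `|Y w|.
  by rewrite ler_expR (le_trans (ler_norm _))// normrM ler_piMl.
have h3 : expR `|Y w| * expR `|Y w| <= H w.
  rewrite -expRD /H; have [y0|y0] := ger0P (Y w).
    by rewrite mulr_natl mulr2n lerDl expR_ge0.
  by rewrite mulNr mulr_natl mulr2n opprD lerDr expR_ge0.
apply: le_trans (ler_pM _ (expR_ge0 _) h1 h2) _; first exact: exprn_ge0.
by rewrite -mulrA ler_wpM2l.
Qed.

Let integrable_Yn n t : `|t| <= 1 ->
  P.-integrable setT (EFin \o (fun w => Y w ^+ n * expR (t * Y w))).
Proof.
move=> t1; apply: (@le_integrable_real _ _ _ _ _ (fun w => n`!%:R * H w)).
- apply: measurable_funM; first exact: measurable_funX.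
  by apply: measurableT_comp => //; exact: measurable_funM.
- by move=> w; exact: le_H.
- exact: integrableZ_real.
Qed.

Let E n t := \int[P]_w (Y w ^+ n * expR (t * Y w)).

Let dE n (t : R) : `|t| < 1 -> is_derive t 1 (E n) (E n.+1 t).
Proof.
move=> t1; pose f (t : R) (w : Omega) := Y w ^+ n * expR (t * Y w).
have rI (u : R) : `]- 1, 1[%classic u -> `|u| <= 1.
  by rewrite /= in_itv/= => /andP[h1 h2]; rewrite ler_norml !ltW.
have tI : `]- 1, 1[%classic t by rewrite /= in_itv/= -ltr_norml.
have intf (u : R) : `]- 1, 1[%classic u -> P.-integrable setT (EFin \o f u).
  by move=> /rI tr; exact: integrable_Yn.
have df (u : R) w : is_derive u 1 (f ^~ w) (f u w * Y w).
  rewrite /f; set p := Y w.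
  have -> : (fun t => p ^+ n * expR (t * p)) = cst (p ^+ n) * (@expR R \o (id * cst p)).
    by apply/funext => s; rewrite !fctE.
  apply: is_derive_eq; rewrite !fctE /GRing.scale/=.
  by rewrite !mulr0 mulr1 add0r addr0 mulrA.
have pf (u : R) w : partial1of2 f u w = f u w * Y w.
  by rewrite partial1of2E derive_val.
have H0 w : 0 <= n.+1`!%:R * H w by rewrite mulr_ge0// addr_ge0// expR_ge0.
have intH : P.-integrable setT (EFin \o (fun w => n.+1`!%:R * H w)).
  exact: integrableZ_real.
have bH (u : R) w : `]- 1, 1[%classic u -> setT w -> `|partial1of2 f u w| <= n.+1`!%:R * H w.
  by move=> /rI tr _; rewrite pf /f mulrAC -exprSr; exact: le_H.
have derf (u : R) w : `]- 1, 1[%classic u -> setT w -> derivable (f ^~ w) u 1.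
  by move=> _ _; exact: (@ex_derive _ _ _ _ _ _ _ (df u w)).
apply: DeriveDef.
  exact: (derivable_under_integral measurableT tI intf derf H0 intH bH).
rewrite -derive1E.
rewrite (differentiation_under_integral measurableT tI intf derf H0 intH bH).
by apply: eq_Rintegral => w _; rewrite pf /f exprSr mulrAC.
Qed.

Let E0 t : E 0 t = expR (t ^+ 2 * v / 2).
Proof.
rewrite /E /Rintegral.
under eq_integral do rewrite mul1r.
by rewrite mgf.
Qed.

Let near0 (f h : R -> R) : (forall t : R, `|t| < 1 -> f t = h t) ->
  forall t : R, `|t| < 1 -> \near t, f t = h t.
Proof.
move=> fh t; rewrite ltr_norml => t1.
have ti : t \in `](- 1), 1[ by rewrite in_itv.
apply: filterS (near_in_itvoo ti) => u; rewrite in_itv/= -ltr_norml.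
exact: fh.
Qed.

Let dexp (t : R) : is_derive t 1 (fun t : R => expR (t ^+ 2 * v / 2))
  (expR (t ^+ 2 * v / 2) * (t * v)).
Proof.
have -> : (fun t : R => expR (t ^+ 2 * v / 2)) = @expR R \o (id ^+ 2 * cst (v / 2)).
  by apply/funext => s; rewrite !fctE mulrA.
apply: is_derive_eq; rewrite !fctE /GRing.scale/= expr1 mulr0 mulr1 add0r.
have -> : t ^+ 2 * (v / 2) = t ^+ 2 * v / 2 by rewrite mulrA.
by congr (_ * _); field.
Qed.

Let E1 (t : R) : `|t| < 1 -> E 1 t = expR (t ^+ 2 * v / 2) * (t * v).
Proof.
move=> t1; rewrite -(@derive_val _ _ _ _ _ _ _ (dE 0 t1)).
have -> : E 0 = (fun t : R => expR (t ^+ 2 * v / 2)) by apply/funext => u; exact: E0.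
exact: (@derive_val _ _ _ _ _ _ _ (dexp t)).
Qed.

Lemma mgf_mean : P.-integrable setT (EFin \o Y) /\ \int[P]_w Y w = 0.
Proof.
have n1 : `|0 : R| <= 1 by rewrite normr0.
split.
  have := integrable_Yn 1 n1; apply: eq_integrable => // w _ /=.
  by rewrite mul0r expR0 mulr1 expr1.
transitivity (E 1 0).
  by apply: eq_Rintegral => w _; rewrite mul0r expR0 mulr1 expr1.
by rewrite E1 ?normr0// mul0r mulr0.
Qed.

Lemma mgf_second_moment :
  P.-integrable setT (EFin \o (fun w => Y w ^+ 2)) /\ \int[P]_w (Y w ^+ 2) = v.
Proof.
have n1 : `|0 : R| <= 1 by rewrite normr0.
have n1' : `|0 : R| < 1 by rewrite normr0.
split.
  have := integrable_Yn 2 n1; apply: eq_integrable => // w _ /=.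
  by rewrite mul0r expR0 mulr1.
transitivity (E 2 0).
  by apply: eq_Rintegral => w _; rewrite mul0r expR0 mulr1.
rewrite -(@derive_val _ _ _ _ _ _ _ (dE 1 n1')).
rewrite (near_eq_derive _ (near0 E1 n1')).
have d3 : is_derive (0 : R) 1 (fun t : R => t * v) v.
  have -> : (fun t : R => t * v) = id * cst v by apply/funext => s; rewrite !fctE.
  by apply: is_derive_eq; rewrite !fctE /GRing.scale/= mulr0 add0r mulr1.
rewrite (@derive_val _ _ _ _ _ _ _ (is_deriveM (dexp 0) d3)) /GRing.scale/=.
by rewrite expr0n !mul0r expR0 mul1r addr0.
Qed.

End from_mgf.

End gaussian_moments.

Lemma sum_sum_pair (R : realType) (a : nat -> nat -> R) n :
  (forall i j, a i j = a j i) ->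
  \sum_(i < n) \sum_(j < n) a i j =
  \sum_(i < n) a i i + 2 * \sum_(j < n) \sum_(i < j) a i j.
Proof.
move=> asym; elim: n => [|n IHn]; first by rewrite !big_ord0 mulr0 addr0.
rewrite big_ord_recr /=.
under eq_bigr do rewrite big_ord_recr /=.
rewrite big_split /= IHn !big_ord_recr /=.
have -> : \sum_(j < n) a n j = \sum_(i < n) a i n by apply: eq_bigr => i _.
ring.
Qed.

Section gaussian_process_moments.
Context dO (Omega : measurableType dO) (R : realType) (P : probability Omega R).
Context d (T : measurableType d).
Variables (X : T -> Omega -> R) (g : T -> T -> R).
Hypothesis gaussX : centered_gaussian_process P X g.

Lemma centered_gaussian_moments (Y : Omega -> R) : centered_gaussian P Y ->
  [/\ P.-integrable setT (EFin \o Y), \int[P]_w Y w = 0,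
      P.-integrable setT (EFin \o (fun w => Y w ^+ 2)) &
      (\int[P]_w (expR (Y w))%:E = (expR ((\int[P]_w (Y w ^+ 2)) / 2))%:E)%E].
Proof.
move=> gY; have [s mgf] := centered_gaussian_mgf gY; have [mY _] := gY.
have [i1 e1] := mgf_mean mY mgf; have [i2 e2] := mgf_second_moment mY mgf.
split => //; rewrite e2.
by have := mgf 1; rewrite expr1n mul1r => <-; apply: eq_integral => w _; rewrite mul1r.
Qed.

Lemma gaussian_process1 y : centered_gaussian P (X y).
Proof.
have := gaussX.1 1%N (fun=> 1) (fun=> y).
rewrite (_ : (fun w => _) = X y)//.
by apply/funext => w; rewrite big_ord_recr big_ord0 /= add0r mul1r.
Qed.

Lemma integrable_process_mul x y :
  P.-integrable setT (EFin \o (fun w => X x w * X y w)).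
Proof.
have [mx _] := gaussian_process1 x; have [my _] := gaussian_process1 y.
have [_ _ ix _] := centered_gaussian_moments (gaussian_process1 x).
have [_ _ iy _] := centered_gaussian_moments (gaussian_process1 y).
apply: (@le_integrable_real _ _ _ _ _ (fun w => X x w ^+ 2 + X y w ^+ 2)).
- exact: measurable_funM.
- move=> w; rewrite ler_norml; apply/andP; split.
    rewrite -subr_ge0 opprK; have := sqr_ge0 (X x w + X y w).
    by have := sqr_ge0 (X x w); have := sqr_ge0 (X y w); nra.
  rewrite -subr_ge0; have := sqr_ge0 (X x w - X y w).
  by have := sqr_ge0 (X x w); have := sqr_ge0 (X y w); nra.
- exact: integrableD_real.
Qed.

Lemma process_covariance x y : \int[P]_w (X x w * X y w) = g x y.
Proof.
have mean0 z : fine ('E_P[X z])%E = 0.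
  have [_ <- _ _] := centered_gaussian_moments (gaussian_process1 z).
  by rewrite expectation.unlock.
have := gaussX.2 x y; rewrite covariance.unlock !mean0 expectation.unlock.
rewrite (eq_integral (fun w => (X x w * X y w)%:E)) => [|w _]; last first.
  by change (((X x w - 0) * (X y w - 0))%:E = (X x w * X y w)%:E); rewrite !subr0.
by rewrite /Rintegral => ->.
Qed.

Lemma process_covarianceC x y : g x y = g y x.
Proof.
by rewrite -!process_covariance; apply: eq_Rintegral => w _; rewrite mulrC.
Qed.

Lemma process_variance y : fine ('V_P[X y])%E = g y y.
Proof. by rewrite /variance gaussX.2. Qed.

Lemma gaussian_process_mgf n (a : 'I_n -> R) (y : 'I_n -> T) :
  (\int[P]_w (expR (\sum_(i < n) a i * X (y i) w))%:E =
  (expR ((\sum_(i < n) \sum_(j < n) a i * a j * g (y i) (y j)) / 2))%:E)%E.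
Proof.
have [_ _ _ ->] := centered_gaussian_moments (gaussX.1 n a y).
congr (expR (_ / 2))%:E.
have intij i j : P.-integrable setT
    (EFin \o (fun w => a i * a j * (X (y i) w * X (y j) w))).
  by apply: integrableZ_real; exact: integrable_process_mul.
transitivity (\int[P]_w
    (\sum_(i < n) \sum_(j < n) a i * a j * (X (y i) w * X (y j) w))).
  apply: eq_Rintegral => w _; rewrite expr2 mulr_suml; apply: eq_bigr => i _.
  by rewrite mulr_sumr; apply: eq_bigr => j _; ring.
rewrite Rintegral_sum => [|i _]; last by apply: integrable_sum_real => j _.
apply: eq_bigr => i _; rewrite Rintegral_sum//; apply: eq_bigr => j _.
rewrite RintegralZl//; last exact: integrable_process_mul.
by rewrite process_covariance.
Qed.

(** The variance subtracted in [omega] cancels exactly the diagonal of the covariance form, and the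
    symmetric rest is twice the sum over [i < j]. *)
Lemma integral_prod_omega (mu : R) l (y : nat -> T) : 0 <= mu ->
  (\int[P]_w (\prod_(i < l) expR (omega P X mu (y i) w))%:E =
  (expR (mu * pair_sum g l y))%:E)%E.
Proof.
move=> mu0.
have e w : \prod_(i < l) expR (omega P X mu (y i) w) =
    expR (- (mu / 2 * \sum_(i < l) g (y i) (y i))) *
    expR (\sum_(i < l) Num.sqrt mu * X (y i) w).
  rewrite -expRD -expR_sum; congr expR.
  rewrite /omega mulr_sumr addrC -sumrB; apply: eq_bigr => i _.
  by rewrite process_variance.
under eq_integral do rewrite e EFinM.
have msum : measurable_fun setT
    (fun w => (expR (\sum_(i < l) Num.sqrt mu * X (y i) w))%:E).
  apply: measurable_funEFin; apply: measurableT_comp => //.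
  apply: measurable_sum => i; apply: measurable_funM => //.
  by have [] := gaussian_process1 (y i).
rewrite (ge0_integralZl _ measurableT msum)//.
rewrite gaussian_process_mgf -EFinM -expRD; congr (expR _)%:E.
have -> : \sum_(i < l) \sum_(j < l) Num.sqrt mu * Num.sqrt mu * g (y i) (y j) =
    mu * \sum_(i < l) \sum_(j < l) g (y i) (y j).
  rewrite mulr_sumr; apply: eq_bigr => i _; rewrite mulr_sumr.
  by apply: eq_bigr => j _; rewrite -expr2 sqr_sqrtr.
rewrite (@sum_sum_pair _ (fun i j => g (y i) (y j))); last first.
  by move=> i j; exact: process_covarianceC.
by rewrite /pair_sum; field.
Qed.

Variable nu : {finite_measure set T -> \bar R}.
Hypothesis mX : measurable_fun setT (fun p : T * Omega => X p.1 p.2).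

(** Measurability is inherited from the joint measurability of [X], the variance being a partial
    integral of [X^2]. *)
Lemma measurable_process_variance : measurable_fun setT (fun y => g y y).
Proof.
have m2 : measurable_fun setT (fun p : T * Omega => ((X p.1 p.2) ^+ 2)%:E).
  by apply: measurable_funEFin; exact: measurable_funX.
have m3 := measurable_fun_fubini_tonelli_F (m2 := P) _ m2
  (fun p => (sqr_ge0 (X p.1 p.2) : (0 <= (X p.1 p.2 ^+ 2)%:E)%E)).
have := measurableT_comp (fine_measurable (@measurableT _ (\bar R))) m3.
rewrite (_ : _ \o _ = fun y => g y y)//.
by apply/funext => y; rewrite -process_covariance.
Qed.

Lemma measurable_omega mu :
  measurable_fun setT (fun p : T * Omega => omega P X mu p.1 p.2).
Proof.
rewrite /omega; under eq_fun do rewrite process_variance.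
apply: measurable_funB; first exact: measurable_funM.
apply: measurable_funM => //.
exact: (measurableT_comp measurable_process_variance).
Qed.

(** Extended real-valued, so that Tonelli's theorem applies before finiteness is known; [phi_mass]
    is its [fine] part. *)
Definition chaos_mass mu (w : Omega) : \bar R :=
  (\int[nu]_y (expR (omega P X mu y w))%:E)%E.

Let measurable_exp_omega mu :
  measurable_fun setT (fun p : T * Omega => (expR (omega P X mu p.1 p.2))%:E).
Proof.
apply: measurable_funEFin; apply: measurableT_comp => //.
exact: measurable_omega.
Qed.

Lemma chaos_mass_ge0 mu w : (0 <= chaos_mass mu w)%E.
Proof. by apply: integral_ge0 => y _; rewrite lee_fin expR_ge0. Qed.

Lemma measurable_chaos_mass mu : measurable_fun setT (chaos_mass mu).
Proof.
apply: (measurable_fun_fubini_tonelli_G (m1 := nu) _ (measurable_exp_omega mu)).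
by move=> p; rewrite lee_fin expR_ge0.
Qed.

Let measurable_prod_omega mu l : measurable_fun setT
  (fun p : Omega * l.-tuple T =>
    (\prod_(i < l) expR (omega P X mu (tnth p.2 i) p.1))%:E).
Proof.
apply: measurable_funEFin; apply: measurable_prod => i _.
apply: measurableT_comp => //.
apply: (measurableT_comp (f := fun p : T * Omega => omega P X mu p.1 p.2)
  (g := fun p : Omega * l.-tuple T => (tnth p.2 i, p.1))).
  exact: measurable_omega.
apply: measurable_fun_pair => //.
exact: (measurableT_comp (@measurable_tnth _ T l i) measurable_snd).
Qed.

(** The function is the partial expectation of a jointly measurable product, from which it inherits
    its measurability. *)
Lemma measurable_expR_pair_sum mu l (x0 : T) : 0 <= mu -> measurable_fun setT
  (fun x : l.-tuple T => expR (mu * pair_sum g l (nth x0 x))).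
Proof.
move=> mu0.
have m1 := measurable_fun_fubini_tonelli_G (m1 := P) _ (@measurable_prod_omega mu l)
  (fun p => (prodr_ge0 _ (fun i _ => expR_ge0 _) : (0 <= (\prod_(i < l)
     expR (omega P X mu (tnth p.2 i) p.1))%:E)%E)).
have := measurableT_comp (fine_measurable (@measurableT _ (\bar R))) m1.
rewrite (_ : _ \o _ = fun x : l.-tuple T => expR (mu * pair_sum g l (nth x0 x)))//.
apply/funext => x /=; rewrite -[RHS]/(fine (expR _)%:E) -(integral_prod_omega _ _ mu0).
congr fine; apply: eq_integral => w _; congr (_%:E).
by apply: eq_bigr => i _; rewrite (tnth_nth x0).
Qed.

Lemma chaos_mass_moment mu l (x0 : T) : 0 <= mu ->
  (\int[P]_w (chaos_mass mu w) ^+ l =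
  \int[power_measure nu l]_x (expR (mu * pair_sum g l (nth x0 x)))%:E)%E.
Proof.
move=> mu0.
have mo w : measurable_fun setT (fun y => omega P X mu y w).
  exact: (measurableT_comp (measurable_omega mu) (pair2_measurable w)).
transitivity (\int[P]_w \int[power_measure nu l]_x
    (\prod_(i < l) expR (omega P X mu (tnth x i) w))%:E)%E.
  apply: eq_integral => w _; rewrite -ge0_integral_power_prod//.
  exact: measurableT_comp.
rewrite (fubini_tonelli _ (@measurable_prod_omega mu l)); last first.
  by move=> p; rewrite lee_fin prodr_ge0// => i _; exact: expR_ge0.
apply: eq_integral => x _; rewrite -(integral_prod_omega _ _ mu0).
apply: eq_integral => w _; congr (_%:E).
by apply: eq_bigr => i _; rewrite (tnth_nth x0).
Qed.

End gaussian_process_moments.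

(** * Moments of limits in law *)

Section law_limit.
Context d (Omega : measurableType d) (R : realType) (P : probability Omega R).

(** Truncation of the positive part at level [M]; for [M >= 0] its powers are continuous and
    bounded, hence admissible tests for convergence in law. *)
Definition clamp (M x : R) := Num.min (Num.max x 0) M.

Lemma continuous_clamp M : continuous (clamp M).
Proof.
have cmax (f : R -> R) (c : R) : continuous f -> continuous (fun x => Num.max (f x) c).
  move=> cf x; under eq_fun do rewrite maxr_absE.
  apply: cvgM; last exact: cvg_cst.
  apply: cvgD; first by apply: cvgD; [exact: cf|exact: cvg_cst].
  by apply: cvg_norm; apply: cvgB; [exact: cf|exact: cvg_cst].
have cmin (f : R -> R) (c : R) : continuous f -> continuous (fun x => Num.min (f x) c).
  move=> cf x; under eq_fun do rewrite minr_absE.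
  apply: cvgM; last exact: cvg_cst.
  apply: cvgB; first by apply: cvgD; [exact: cf|exact: cvg_cst].
  by apply: cvg_norm; apply: cvgB; [exact: cf|exact: cvg_cst].
apply: cmin; apply: (cmax id) => x; exact: cvg_id.
Qed.

Lemma clamp_ge0 M x : 0 <= M -> 0 <= clamp M x.
Proof. by move=> M0; rewrite /clamp le_min M0 le_max lexx orbT. Qed.

Lemma clamp_le M x : clamp M x <= M.
Proof. by rewrite /clamp ge_min lexx orbT. Qed.

Lemma clamp_le_pos M x : clamp M x <= Num.max x 0.
Proof. by rewrite /clamp ge_min lexx. Qed.

Lemma le_clamp M N x : M <= N -> clamp M x <= clamp N x.
Proof. by move=> MN; rewrite /clamp le_min !ge_min lexx MN orbT. Qed.

Lemma continuous_clampX M l : continuous (fun x => clamp M x ^+ l).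
Proof.
move=> x; apply: (@continuous_comp _ _ _ (clamp M) (fun y => y ^+ l)).
  exact: continuous_clamp.
exact: exprn_continuous.
Qed.

Lemma bounded_clampX M l : 0 <= M -> exists K, forall x, `|clamp M x ^+ l| <= K.
Proof.
move=> M0; exists (M ^+ l) => x.
rewrite ger0_norm ?exprn_ge0 ?clamp_ge0// lerXn2r ?nnegrE ?clamp_ge0//.
exact: clamp_le.
Qed.

(** Beyond the level [M] the factor [z / M] exceeds [1], so one more power pays for the tail. *)
Lemma expr_clamp_bound M z l : 0 < M -> 0 <= z ->
  z ^+ l <= clamp M z ^+ l + z ^+ l.+1 / M.
Proof.
move=> M0 z0; have [zM|Mz] := leP z M.
  rewrite /clamp (max_idPl z0) (min_idPl zM) lerDl.
  by rewrite divr_ge0// ?exprn_ge0// ltW.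
apply: (@le_trans _ _ (z ^+ l.+1 / M)).
  rewrite exprSr -mulrA ler_peMr ?exprn_ge0// ler_pdivlMr// mul1r; exact: ltW.
by rewrite lerDr exprn_ge0// clamp_ge0// ltW.
Qed.

Variables (Z_ : nat -> Omega -> R) (Z : {RV P >-> R}).
Hypotheses (mZ_ : forall n, measurable_fun setT (Z_ n))
  (Z_ge0 : forall n w, 0 <= Z_ n w)
  (cvgZ : forall f : R -> R, continuous f -> (exists K, forall x, `|f x| <= K) ->
     (fun n => 'E_P[f \o Z_ n]%E) @ \oo --> 'E_P[f \o Z]%E).

(* Boundedness of the moments of order l + 1 makes the Z_ n ^+ l uniformly
   integrable. As a function, Z need not be nonnegative: hence the positive part. *)
Lemma law_limit_moment l (s_ : nat -> \bar R) (s C : R) :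
  (forall n, (\int[P]_w (Z_ n w ^+ l)%:E = s_ n)%E) ->
  (\forall n \near \oo, (\int[P]_w (Z_ n w ^+ l.+1)%:E <= C%:E)%E) ->
  s_ @ \oo --> s%:E ->
  (\int[P]_w (Num.max (Z w) 0 ^+ l)%:E = s%:E)%E.
Proof.
move=> s_E boundC cvgs.
pose e_ M n := (\int[P]_w (clamp M (Z_ n w) ^+ l)%:E)%E.
pose e M := (\int[P]_w (clamp M (Z w) ^+ l)%:E)%E.
have cvge M : 0 <= M -> e_ M @ \oo --> e M.
  move=> M0; have := cvgZ (@continuous_clampX M l) (@bounded_clampX M l M0).
  by under eq_fun do rewrite expectation.unlock; rewrite expectation.unlock.
have mclamp M (f : Omega -> R) : measurable_fun setT f ->
    measurable_fun setT (fun w => (clamp M (f w) ^+ l)%:E).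
  move=> mf; apply: measurable_funEFin; apply: measurable_funX.
  by apply: measurable_minr => //; exact: measurable_maxr.
have mpow (j : nat) n : measurable_fun setT (fun w => (Z_ n w ^+ j)%:E).
  by apply: measurable_funEFin; exact: measurable_funX.
(* Truncation lowers every moment of [Z_ n], and the inequality passes to the limit. *)
have e_le M : 0 < M -> (e M <= s%:E)%E.
  move=> M0; have M0' := ltW M0.
  rewrite -(cvg_lim _ (cvge M M0'))// -(cvg_lim _ cvgs)//.
  apply: lee_lim; [exact: cvgP (cvge M M0')|exact: cvgP cvgs|].
  apply: nearW => n; rewrite -s_E; apply: ge0_le_integral => //.
  - by move=> w _; rewrite lee_fin exprn_ge0// clamp_ge0.
  - exact: mclamp.
  move=> w _; rewrite lee_fin lerXn2r ?nnegrE ?clamp_ge0//.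
  by apply: le_trans (clamp_le_pos _ _) _; rewrite (max_idPl (Z_ge0 n w)).
(* Conversely, by [expr_clamp_bound], truncation loses at most the moment of order [l.+1] divided by
   [M]. *)
have s_le M : 0 < M -> (s%:E <= e M + (C / M)%:E)%E.
  move=> M0; have M0' := ltW M0.
  have c2 : (fun n => e_ M n + (C / M)%:E)%E @ \oo --> (e M + (C / M)%:E)%E.
    by apply: cvgeD; [exact: fin_num_adde_defl|exact: cvge|exact: cvg_cst].
  rewrite -(cvg_lim _ c2)// -(cvg_lim _ cvgs)//.
  apply: lee_lim; [exact: cvgP cvgs|exact: cvgP c2|].
  apply: filterS boundC => n nC; rewrite -s_E.
  apply: (@le_trans _ _ (\int[P]_w ((clamp M (Z_ n w) ^+ l)%:E +
      (M^-1)%:E * (Z_ n w ^+ l.+1)%:E))%E).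
    apply: ge0_le_integral => //.
    - by move=> w _; rewrite lee_fin exprn_ge0.
    - by apply: emeasurable_funD; [exact: mclamp|apply: measurable_funeM].
    - move=> w _; rewrite -EFinM -EFinD lee_fin [M^-1 * _]mulrC.
      exact: expr_clamp_bound.
  rewrite ge0_integralD//; last 4 first.
  - by move=> w _; rewrite lee_fin exprn_ge0// clamp_ge0.
  - exact: mclamp.
  - by move=> w _; rewrite -EFinM lee_fin mulr_ge0 ?invr_ge0 ?exprn_ge0.
  - exact: measurable_funeM.
  rewrite leeD2l// ge0_integralZl//; last 2 first.
  - by move=> w _; rewrite lee_fin exprn_ge0.
  - by rewrite lee_fin invr_ge0.
  by rewrite mulrC EFinM lee_wpmul2l// lee_fin invr_ge0.
(* Along these levels the truncated moments of [Z] are squeezed to [s], while monotone convergence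
   sends them to the moment of the positive part. *)
pose M_ (n : nat) : R := n.+1%:R.
have M_0 n : 0 < M_ n by rewrite ltr0n.
have cvge_s : (e \o M_) @ \oo --> s%:E.
  apply: (@squeeze_cvge _ _ _ _ (fun n => (s - C / M_ n)%:E) _ (cst s%:E)).
  - apply: nearW => n /=; rewrite e_le// andbT EFinB leeBlDr// s_le//.
  - apply: cvg_EFin; first exact: nearW.
    rewrite -[X in _ --> X]subr0; apply: cvgB; first exact: cvg_cst.
    rewrite -[X in _ --> X](mulr0 C); apply: cvgM; first exact: cvg_cst.
    exact: cvg_harmonic.
  - exact: cvg_cst.
have -> : (fun w => (Num.max (Z w) 0 ^+ l)%:E) =
    (fun w => limn (fun n => (clamp (M_ n) (Z w) ^+ l)%:E)).
  apply/funext => w; apply/esym/cvg_lim => //.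
  apply: cvg_near_cst; near=> n; congr (_ ^+ _)%:E; apply/min_idPl.
  near: n; exists (Num.truncn (Num.max (Z w) 0)) => // n /= nZ.
  rewrite (le_trans (ltW (truncnS_gt _)))// ler_nat ltnS//.
have : (fun n => \int[P]_w (clamp (M_ n) (Z w) ^+ l)%:E)%E @ \oo -->
    (\int[P]_w (limn (fun n => (clamp (M_ n) (Z w) ^+ l)%:E)))%E.
  apply: cvg_monotone_convergence => //.
  - by move=> n; exact: mclamp.
  - by move=> n w _; rewrite lee_fin exprn_ge0// clamp_ge0// ltW.
  - move=> w _ m n mn; have M0' k : 0 <= M_ k by exact: ltW.
    rewrite lee_fin lerXn2r ?nnegrE ?clamp_ge0//.
    by apply: le_clamp; rewrite ler_nat ltnS.
by move=> h; rewrite -(cvg_lim _ h)// -[RHS](cvg_lim _ cvge_s).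
Unshelve. all: by end_near. Qed.

End law_limit.

(** * Almost everywhere statements on pairs *)

Section ae_pairs.
Context d (T : measurableType d) (R : realType).

Lemma ae_swap (nu : {sigma_finite_measure set T -> \bar R}) (Q : T * T -> Prop) :
  {ae (nu \x nu)%E, forall p, Q p} -> {ae (nu \x nu)%E, forall p, Q (p.2, p.1)}.
Proof.
move=> [N [mN N0 QN]].
pose sw (p : T * T) := (p.2, p.1).
have msw : measurable_fun setT sw by exact: measurable_fun_pair.
have mswN : measurable (sw @^-1` N) by rewrite -[X in measurable X]setTI; exact: msw.
exists (sw @^-1` N); split => //; last by move=> p /= nQ; exact: QN.
have i1 (A : set (T * T)) : measurable A ->
    (nu \x nu)%E A = (\int[nu \x nu]_p (\1_A p)%:E)%E.
  by move=> mA; rewrite integral_indic// setIT.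
have mind (A : set (T * T)) : measurable A ->
    measurable_fun setT (fun p => (\1_A p : R)%:E).
  by move=> mA; apply: measurable_funEFin; exact: measurable_indic.
rewrite i1// fubini_tonelli1//; last exact: mind.
rewrite /fubini_F -[RHS]N0 i1// fubini_tonelli2//; last exact: mind.
Qed.

End ae_pairs.

Section weighted_ae.
Context d (T : measurableType d) (R : realType).
Variables (m : {sigma_finite_measure set T -> \bar R}) (D : set T) (phi : T -> R).
Hypotheses (mD : measurable D) (phi0 : forall x, D x -> 0 <= phi x)
  (intphi : m.-integrable D (EFin \o phi)).
Let nu := weighted_measure mD phi0 intphi.

Lemma ge0_integral_weighted_pairT (f : T * T -> R) : measurable_fun setT f ->
  (forall p, 0 <= f p) ->
  measurable_fun setT (fun p => (f p * (phi \_ D) p.2 * (phi \_ D) p.1)%:E) /\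
  (\int[nu \x nu]_p (f p)%:E =
   \int[m \x m]_p (f p * (phi \_ D) p.2 * (phi \_ D) p.1)%:E)%E.
Proof.
move=> mf f0.
have mphi : measurable_fun setT (phi \_ D).
  exact: integrable_measurable_real (integrable_patch mD intphi).
have phiD0 := patch_ge0 phi0.
have mfE : measurable_fun setT (fun p => (f p)%:E) by exact: measurable_funEFin.
pose F (p : T * T) := (f p * (phi \_ D) p.2 * (phi \_ D) p.1)%:E.
have mF : measurable_fun setT F.
  apply: measurable_funEFin; apply: measurable_funM; first apply: measurable_funM => //.
    exact: (measurableT_comp mphi measurable_snd).
  exact: (measurableT_comp mphi measurable_fst).
split; first exact: mF.
have F0 p : (0 <= F p)%E by rewrite lee_fin mulr_ge0// mulr_ge0.
have fE0 p : (0 <= (f p)%:E)%E by rewrite lee_fin.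
rewrite (fubini_tonelli1 _ mfE fE0) (fubini_tonelli1 _ mF F0).
rewrite ge0_integral_density//; last 2 first.
- exact: (measurable_fun_fubini_tonelli_F _ mfE (fun p => f0 p)).
- by move=> x; apply: integral_ge0 => y _; rewrite lee_fin.
apply: eq_integral => x _; rewrite /fubini_F.
have mfx : measurable_fun setT (fun y => (f (x, y))%:E).
  exact: (measurableT_comp mfE (pair1_measurable x)).
rewrite ge0_integral_density//.
rewrite muleC -ge0_integralZl//; last 3 first.
- apply: emeasurable_funM => //; exact: measurable_funEFin.
- by move=> y _; rewrite mule_ge0 ?lee_fin.
- by rewrite lee_fin.
by apply: eq_integral => y _; rewrite /F /= muleC !EFinM.
Qed.

Lemma ge0_integral_weighted_pair (f : T * T -> R) : measurable_fun setT f ->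
  (forall p, 0 <= f p) ->
  (\int[nu \x nu]_p (f p)%:E =
   \int[m \x m]_(p in D `*` D) (phi p.1 * phi p.2 * f p)%:E)%E.
Proof.
move=> mf f0; rewrite (ge0_integral_weighted_pairT mf f0).2.
rewrite [RHS]integral_mkcond; apply: eq_integral => -[x y] _.
rewrite !patchE in_setX /=.
by case: (x \in D) => /=; case: (y \in D); rewrite ?mulr0 ?mul0r//; congr EFin; ring.
Qed.

(** The measure [nu \x nu] has a density with respect to [m \x m] and does not charge pairs with a
    point outside [D]. *)
Lemma ae_weighted_pair (Q : T * T -> Prop) :
  {ae (m \x m)%E, forall p, D p.1 -> D p.2 -> Q p} -> {ae (nu \x nu)%E, forall p, Q p}.
Proof.
move=> [N [mN N0 QN]].
have nuE (A : set (T * T)) : measurable A -> (nu \x nu)%E A =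
    (\int[m \x m]_p (\1_A p * (phi \_ D) p.2 * (phi \_ D) p.1)%:E)%E.
  move=> mA; have mA1 : measurable_fun setT (\1_A : T * T -> R) by exact: measurable_indic.
  have e : ((nu \x nu)%E A = \int[nu \x nu]_p (\1_A p)%:E)%E.
    by rewrite integral_indic ?setIT.
  by apply: etrans e _; apply: (ge0_integral_weighted_pairT mA1 _).2 => p; rewrite indicE.
have mDD : measurable (~` (D `*` D)) by apply: measurableC; exact: measurableX.
have nN : (nu \x nu)%E.-negligible N.
  exists N; split => //; apply: etrans (nuE _ mN) _.
  have mN1 : measurable_fun setT (\1_N : T * T -> R) by exact: measurable_indic.
  rewrite -[RHS](null_set_integral mN (measurable_funTS (ge0_integral_weighted_pairT mN1 _).1) N0)//.
  rewrite [RHS]integral_mkcond; apply: eq_integral => p _; rewrite [RHS]patchE indicE.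
  by case: (p \in N) => //; rewrite !mul0r.
have nDD : (nu \x nu)%E.-negligible (~` (D `*` D)).
  exists (~` (D `*` D)); split; [exact: mDD| |exact: subset_refl].
  apply: etrans (nuE _ mDD) _.
  apply: integral0_eq => -[x y] _; rewrite indicE in_setC in_setX !patchE /=.
  by case: (x \in D); case: (y \in D); rewrite ?mulr0 ?mul0r.
apply: (negligibleS _ (negligibleU nN nDD)) => p nQ.
have [[Dx Dy]|nD] := pselect ((D `*` D) p); last by right.
by left; apply: QN => /= h; apply: nQ; exact: h.
Qed.

End weighted_ae.

(** * Kernels bounded almost everywhere *)

(** A sequence is needed twice: countably many exceptional null sets may be united, and dominated
    convergence applies. *)
Lemma at_right_seq (R : realType) (Q : R -> Prop) : (\forall e \near (0 : R)^'+, Q e) ->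
  exists u : nat -> R, [/\ forall n, 0 < u n, forall n, Q (u n) &
    u @ \oo --> (0 : R)^'+].
Proof.
move=> nQ.
have cvgu : @harmonic R @ \oo --> (0 : R)^'+.
  move=> A /= [e /= e0 eA].
  have /cvgrPdist_lt/(_ e e0) h := @cvg_harmonic R.
  by apply: filterS h => n /= hn; apply: eA.
have [N _ hN] := cvgu _ nQ.
exists (fun n => harmonic (n + N)); split.
- by move=> n; rewrite invr_gt0 ltr0n.
- by move=> n; apply: hN => /=; exact: leq_addl.
- by apply: cvg_comp cvgu; exact: cvg_addnr.
Qed.

Section pair_sum_functional.
Context d (T : measurableType d) (R : realType).
Implicit Types (g : T -> T -> R) (x : nat -> T).

Lemma eq_pair_sum g g' k x :
  (forall i j, (i < j < k)%N -> g (x i) (x j) = g' (x i) (x j)) ->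
  pair_sum g k x = pair_sum g' k x.
Proof.
by move=> gg; apply: eq_bigr => j _; apply: eq_bigr => i _; rewrite gg// !ltn_ord.
Qed.

(** Like a pair sum, [h] sees the kernel only at pairs [i < j], never on the diagonal; so kernels
    that agree almost everywhere give the same [h] almost everywhere. *)
Lemma eq_h_coef0 g g' n k x :
  (forall i j, (i < j < k)%N -> g (x i) (x j) = g' (x i) (x j)) ->
  h_coef0 g n k x = h_coef0 g' n k x.
Proof.
elim: n k => [//|n IHn] k gg.
have IH j : (j <= k)%N -> h_coef0 g n j x = h_coef0 g' n j x.
  by move=> jk; apply: IHn => i i' /andP[ii' i'j]; rewrite gg// ii' (leq_trans i'j).
rewrite !h_coef0S (IH k (leqnn k)) (eq_pair_sum gg); congr (_ + _ + _).
- case: ifP => // k2; rewrite IH ?gg//; last exact: leq_trans (leq_pred _) (leq_pred _).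
  by case: (k) k2 => [//|[//|j]] _ /=; rewrite !ltnS !leqnn.
- case: ifP => // k1; rewrite IH ?leq_pred//; congr (_ * _).
  by apply: eq_bigr => i _; rewrite gg// ltn_ord/= prednK.
Qed.

Lemma cvg_pair_sum (gs : nat -> T -> T -> R) g k x :
  (forall i j, (i < j < k)%N -> (fun n => gs n (x i) (x j)) @ \oo --> g (x i) (x j)) ->
  (fun n => pair_sum (gs n) k x) @ \oo --> pair_sum g k x.
Proof.
move=> gg; apply: cvg_big => [|j _]; first exact: add_continuous.
apply: cvg_big => [|i _]; first exact: add_continuous.
by apply: gg; rewrite !ltn_ord.
Qed.

Lemma le_pair_sum_pair g (G : T * T -> R) k x :
  (forall i j, (i < j < k)%N -> `|g (x i) (x j)| <= G (x i, x j)) ->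
  `|pair_sum g k x| <= pair_sum (fun a b => G (a, b)) k x.
Proof.
move=> gG; apply: le_trans (ler_norm_sum _ _ _) _; apply: ler_sum => j _.
apply: le_trans (ler_norm_sum _ _ _) _; apply: ler_sum => i _.
by apply: gG; rewrite !ltn_ord.
Qed.

Lemma ae_power_nth (nu : {finite_measure set T -> \bar R}) (x0 : T) l (Q : T * T -> Prop) :
  {ae (nu \x nu)%E, forall p, Q p} ->
  {ae power_measure nu l, forall x : l.-tuple T, forall i j, (i < j < l)%N ->
    Q (nth x0 x i, nth x0 x j)}.
Proof.
move=> /(ae_power_pair l); apply: filterS => x Qx i j /andP[ij jl].
have il := ltn_trans ij jl.
have := Qx (Ordinal il) (Ordinal jl); rewrite !(tnth_nth x0) /=; apply.
by rewrite -val_eqE /= ltn_eqF.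
Qed.

End pair_sum_functional.

Section regular_version.
Context d (T : measurableType d) (R : realType).
Variables (g : T -> T -> R) (G : T * T -> R).
Hypotheses (mg : measurable_fun setT (fun p : T * T => g p.1 p.2))
  (mG : measurable_fun setT G).

(* The bounds on moments below assume that g is symmetric and |g| <= G at every
   point, whereas both hold only almost everywhere for a limit of kernels. *)
Definition regular_version a b :=
  if [&& `|g a b| <= G (a, b), `|g b a| <= G (b, a) & g a b == g b a]
  then g a b else 0.

Lemma regular_versionC a b : regular_version a b = regular_version b a.
Proof.
rewrite /regular_version andbCA [g b a == _]eq_sym.
by case: ifP => // /and3P[_ _ /eqP].
Qed.

(** The maximum covers the points where the kernel was reset to [0] and [G] may be negative. *)
Lemma regular_version_le a b : `|regular_version a b| <= Num.max (G (a, b)) 0.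
Proof.
rewrite /regular_version; case: ifP => [/and3P[h _ _]|_]; rewrite le_max.
  by rewrite h.
by rewrite normr0 lexx orbT.
Qed.

Lemma measurable_regular_version :
  measurable_fun setT (fun p : T * T => regular_version p.1 p.2).
Proof.
have msw : measurable_fun setT (fun p : T * T => (p.2, p.1)).
  exact: measurable_fun_pair.
have mg' : measurable_fun setT (fun p : T * T => g p.2 p.1).
  exact: (measurableT_comp mg msw).
have mG' : measurable_fun setT (fun p : T * T => G (p.2, p.1)).
  exact: (measurableT_comp mG msw).
have mG'' : measurable_fun setT (fun p : T * T => G (p.1, p.2)).
  by rewrite (_ : (fun _ => _) = G)//; apply/funext => -[].
apply: measurable_fun_ifT => //; apply: measurable_and.
  by apply: measurable_fun_ler => //; exact: measurableT_comp.
apply: measurable_and; last exact: measurable_fun_eqr.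
by apply: measurable_fun_ler => //; exact: measurableT_comp.
Qed.

Variables (nu : {finite_measure set T -> \bar R}) (gs : nat -> T -> T -> R).
Hypotheses (symgs : forall n a b, gs n a b = gs n b a)
  (cvggs : {ae (nu \x nu)%E, forall p,
    (fun n => gs n p.1 p.2) @ \oo --> g p.1 p.2})
  (gsG : forall n, {ae (nu \x nu)%E, forall p, `|gs n p.1 p.2| <= G p}).

(** Where the kernels converge and are dominated at both [(a, b)] and [(b, a)], the limit inherits
    their symmetry and the bound, so the test in [regular_version] succeeds. *)
Lemma ae_regular_version :
  {ae (nu \x nu)%E, forall p, regular_version p.1 p.2 = g p.1 p.2}.
Proof.
have gsG' := ae_foralln gsG.
apply: filterS3 (filterI gsG' (ae_swap gsG')) cvggs (ae_swap cvggs).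
move=> [a b] /= [h1 h2] c1 c2.
have bnd x y : (forall n, `|gs n x y| <= G (x, y)) ->
    (fun n => gs n x y) @ \oo --> g x y -> `|g x y| <= G (x, y).
  move=> h /cvg_norm c; rewrite -(cvg_lim _ c)//.
  by apply: limr_le; [exact: cvgP c|exact: nearW].
have e : g a b = g b a.
  rewrite -(cvg_lim _ c1)// -(cvg_lim _ c2)//; congr (limn _).
  by apply/funext => n; exact: symgs.
by rewrite /regular_version bnd// bnd// e eqxx.
Qed.

Variable c : R.
Hypotheses (c0 : 0 < c)
  (expG : (\int[nu \x nu]_p (expR (c * G p))%:E < +oo)%E).

Let G' p := Num.max (G p) 0.

Lemma measurable_max0 : measurable_fun setT G'.
Proof. exact: measurable_maxr. Qed.

Lemma expR_max0_lty : (\int[nu \x nu]_p (expR (c * G' p))%:E < +oo)%E.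
Proof.
have mE (H : T * T -> R) : measurable_fun setT H ->
    measurable_fun setT (fun p => (expR (c * H p))%:E).
  move=> mH; apply: measurable_funEFin; apply: measurableT_comp => //.
  exact: measurable_funM.
apply: (@le_lt_trans _ _ (\int[nu \x nu]_p ((expR (c * G p))%:E + 1))%E).
  apply: ge0_le_integral => //.
  - exact: (mE _ measurable_max0).
  - by apply: emeasurable_funD => //; exact: mE.
  move=> p _; rewrite -EFinD lee_fin /G'.
  have := expR_ge0 (c * G p); case: (leP (G p) 0) => _; last lra.
  by rewrite mulr0 expR0; lra.
rewrite ge0_integralD//; last exact: mE.
rewrite lte_add_pinfty// integral_cst// mul1e.
have e : (nu \x nu)%E setT = (nu setT * nu setT)%E.
  by rewrite -(product_measure1E nu nu measurableT measurableT) setXTT.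
rewrite [X in (X < _)%E](_ : _ = (nu \x nu)%E setT)// e.
by rewrite lte_mul_pinfty// ?fin_num_measure// ltey_eq fin_num_measure.
Qed.

Variable x0 : T.

Lemma cvg_exp_pair_sum l mu : 0 <= mu -> mu <= exp_rate c l ->
  (forall n, measurable_fun setT
    (fun x : l.-tuple T => expR (mu * pair_sum (gs n) l (nth x0 x)))) ->
  (fun n => \int[power_measure nu l]_x
    (expR (mu * pair_sum (gs n) l (nth x0 x)))%:E)%E @ \oo -->
  (\int[power_measure nu l]_x
    (expR (mu * pair_sum regular_version l (nth x0 x)))%:E)%E.
Proof.
move=> mu0 mur mgs.
have mps : measurable_fun setT (fun x : l.-tuple T =>
    expR (mu * pair_sum regular_version l (nth x0 x))).
  apply: measurableT_comp => //; apply: measurable_funM => //.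
  by apply: measurable_pair_sum; exact: measurable_regular_version.
have intb := integrable_exp_bound x0 c0 measurable_max0 regular_version_le
  expR_max0_lty l.
pose f_ n (x : l.-tuple T) := (expR (mu * pair_sum (gs n) l (nth x0 x)))%:E.
pose f (x : l.-tuple T) := (expR (mu * pair_sum regular_version l (nth x0 x)))%:E.
have mf_ n : measurable_fun setT (f_ n) by exact: measurable_funEFin.
have mf : measurable_fun setT f by exact: measurable_funEFin.
have f_f : {ae power_measure nu l, forall x, setT x -> f_ ^~ x @ \oo --> f x}.
  apply: filterS2 (ae_power_nth x0 l cvggs) (ae_power_nth x0 l ae_regular_version).
  move=> x h1 h2 _; apply: cvg_EFin; first exact: nearW.
  rewrite (eq_pair_sum h2).
  suff h : (fun n => mu * pair_sum (gs n) l (nth x0 x)) @ \oo -->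
      mu * pair_sum g l (nth x0 x).
    exact: (cvg_comp _ _ h (@continuous_expR R _)).
  by apply: cvgM; [exact: cvg_cst|exact: cvg_pair_sum].
have f_g : {ae power_measure nu l, forall x n, setT x -> (`|f_ n x| <=
    (EFin \o (fun x => expR (exp_rate c l *
      pair_sum (fun a b => G' (a, b)) l (nth x0 x)))) x)%E}.
  have := ae_power_nth x0 l (ae_foralln gsG); apply: filterS => x h n _.
  rewrite lee_fin ger0_norm ?expR_ge0// ler_expR.
  have b0 : `|pair_sum (gs n) l (nth x0 x)| <= pair_sum (fun a b => G' (a, b)) l (nth x0 x).
    by apply: le_pair_sum_pair => i j ijl; rewrite le_max h.
  apply: le_trans (ler_wpM2r _ mur); last exact: le_trans b0.
  by rewrite ler_wpM2l// (le_trans (ler_norm _)).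
by have [_ _] := dominated_convergence measurableT mf_ mf f_f intb f_g.
Qed.

End regular_version.

(** * Moments of the limit mass *)

Section phi_mass_theory.
Context dO (Omega : measurableType dO) (R : realType) (P : probability Omega R).
Context d (T : measurableType d) (m : {sigma_finite_measure set T -> \bar R}).
Variables (D : set T) (phi : T -> R).
Hypotheses (mD : measurable D) (phi0 : forall x, D x -> 0 <= phi x)
  (intphi : m.-integrable D (EFin \o phi)).
Let nu := weighted_measure mD phi0 intphi.
Variables (X : T -> Omega -> R) (g : T -> T -> R).
Hypotheses (gaussX : centered_gaussian_process P X g)
  (mX : measurable_fun setT (fun p : T * Omega => X p.1 p.2)).

Lemma phi_massE mu w : phi_mass P m D phi X mu w = fine (chaos_mass P X nu mu w).
Proof.
rewrite /phi_mass /chaos_mass /nu integral_weighted1//.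
apply: measurableT_comp => //.
exact: (measurableT_comp (measurable_omega gaussX mX mu) (pair2_measurable w)).
Qed.

Lemma phi_mass_ge0 mu w : 0 <= phi_mass P m D phi X mu w.
Proof. by rewrite phi_massE fine_ge0// chaos_mass_ge0. Qed.

Lemma measurable_phi_mass mu : measurable_fun setT (phi_mass P m D phi X mu).
Proof.
rewrite (_ : phi_mass _ _ _ _ _ _ = fine \o chaos_mass P X nu mu); last first.
  by apply/funext => w; rewrite phi_massE.
by apply: measurableT_comp => //; exact: (measurable_chaos_mass gaussX).
Qed.

Lemma phi_mass_moment mu l x0 : 0 <= mu ->
  (\int[P]_w (phi_mass P m D phi X mu w ^+ l)%:E =
  \int[power_measure nu l]_x (expR (mu * pair_sum g l (nth x0 x)))%:E)%E.
Proof.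
move=> mu0; rewrite -(chaos_mass_moment gaussX nu mX l x0 mu0).
have mY := measurable_chaos_mass gaussX nu mX mu.
(* The first moment is the finite mass of [nu], so the mass is finite almost surely and [fine] does
   not change the moments. *)
have iY : P.-integrable setT (chaos_mass P X nu mu).
  apply/integrableP; split => //.
  under eq_integral do rewrite gee0_abs ?chaos_mass_ge0//.
  have -> : (\int[P]_w chaos_mass P X nu mu w = _)%E :=
    chaos_mass_moment gaussX nu mX 1 x0 mu0.
   under eq_integral do rewrite /pair_sum big_ord1 big_ord0 mulr0 expR0.
  rewrite integral_cst// mul1e; exact: (@power_measure_lty _ _ _ nu 1 setT).
apply: ae_eq_integral => //.
- by apply: measurable_funEFin; apply: measurable_funX; exact: measurable_phi_mass.
- elim: l => [|j IH]; first exact: measurable_cst.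
  by under eq_fun do rewrite expeS; exact: emeasurable_funM.
have := integrable_ae measurableT iY; apply: filterS => w /(_ I) fw _.
by rewrite phi_massE EFin_expe fineK.
Qed.

End phi_mass_theory.

Section ae_real.
Context d (T : measurableType d) (R : realType) (mu : {measure set T -> \bar R}).
Variables f h : T -> R.
Hypotheses (mf : measurable_fun setT f) (mh : measurable_fun setT h)
  (fh : {ae mu, forall x, h x = f x}).

Lemma ae_eq_Rintegral : \int[mu]_x f x = \int[mu]_x h x.
Proof.
congr fine; apply: ae_eq_integral => //; [exact: measurable_funEFin..|].
by apply: filterS fh => x -> _.
Qed.

Lemma ae_eq_integrable : mu.-integrable setT (EFin \o h) ->
  mu.-integrable setT (EFin \o f).
Proof.
move=> /integrableP[_ hoo]; apply/integrableP; split; first exact: measurable_funEFin.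
rewrite (ae_eq_integral (fun x => `|(EFin \o h) x|%E))//.
- by apply: measurableT_comp => //; exact: measurable_funEFin.
- by apply: measurableT_comp => //; exact: measurable_funEFin.
- by apply: filterS fh => x /= -> _.
Qed.

End ae_real.

Section chaos_limit.
Context dO (Omega : measurableType dO) (R : realType) (P : probability Omega R).
Context d (T : measurableType d) (m : {sigma_finite_measure set T -> \bar R}).
Variables (D : set T) (phi : T -> R).
Hypotheses (mD : measurable D) (phi0 : forall x, D x -> 0 <= phi x)
  (intphi : m.-integrable D (EFin \o phi)).
Let nu := weighted_measure mD phi0 intphi.
Variables (X : R -> T -> Omega -> R) (g_ : R -> T -> T -> R) (g : T -> T -> R).
Hypotheses (gaussX : forall eps, 0 < eps -> centered_gaussian_process P (X eps) (g_ eps))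
  (mX : forall eps, 0 < eps ->
    measurable_fun setT (fun p : T * Omega => X eps p.1 p.2)).
Variables (c : R) (G : T * T -> R) (x0 : T).
Hypotheses (mg : measurable_fun setT (fun p : T * T => g p.1 p.2))
  (cvgg : {ae (m \x m)%E, forall p, D p.1 -> D p.2 ->
     (fun eps => g_ eps p.1 p.2) @ (0 : R)^'+ --> g p.1 p.2})
  (c0 : 0 < c) (mG : measurable_fun setT G)
  (leG : \forall eps \near (0 : R)^'+, {ae (m \x m)%E, forall p,
     D p.1 -> D p.2 -> `|g_ eps p.1 p.2| <= G p})
  (expG : (\int[m \x m]_(p in D `*` D)
     (phi p.1 * phi p.2 * expR (c * G p))%:E < +oo)%E).

Let g' := regular_version g G.

Lemma weighted_expG : (\int[nu \x nu]_p (expR (c * G p))%:E < +oo)%E.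
Proof.
rewrite /nu ge0_integral_weighted_pair//.
by apply: measurableT_comp => //; exact: measurable_funM.
Qed.

Lemma regularizing_sequence : exists u : nat -> R, [/\ forall n, 0 < u n,
  forall n, {ae (nu \x nu)%E, forall p, `|g_ (u n) p.1 p.2| <= G p} &
  u @ \oo --> (0 : R)^'+].
Proof.
have [u [u0 uG cvgu]] := at_right_seq leG.
by exists u; split => // n; exact: ae_weighted_pair.
Qed.

Lemma ae_regularizing_cvg (u : nat -> R) : u @ \oo --> (0 : R)^'+ ->
  {ae (nu \x nu)%E, forall p, (fun n => g_ (u n) p.1 p.2) @ \oo --> g p.1 p.2}.
Proof.
move=> cvgu; apply: ae_weighted_pair; apply: filterS cvgg => p h D1 D2.
exact: (cvg_comp _ _ cvgu (h D1 D2)).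
Qed.

Lemma weighted_ae_regular : {ae (nu \x nu)%E, forall p, g' p.1 p.2 = g p.1 p.2}.
Proof.
have [u [u0 uG cvgu]] := regularizing_sequence.
apply: (@ae_regular_version _ _ _ _ _ _ (fun n => g_ (u n))) => //.
- by move=> n a b; exact: process_covarianceC (gaussX (u0 n)) a b.
- exact: ae_regularizing_cvg.
Qed.

(** The moments of order [l.+1] must converge too, since [law_limit_moment] draws uniform
    integrability from them; hence the second bound on [mu]. *)
Lemma mass_moment l mu (Z : {RV P >-> R}) : 0 <= mu ->
  mu <= exp_rate c l -> mu <= exp_rate c l.+1 ->
  cvg_in_law P (fun eps => phi_mass P m D phi (X eps) mu) Z ->
  (\int[P]_w (Num.max (Z w) 0 ^+ l)%:E =
   \int[power_measure nu l]_x (expR (mu * pair_sum g' l (nth x0 x)))%:E)%E.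
Proof.
move=> mu0 mul mulS cvgZ.
have [u [u0 uG cvgu]] := regularizing_sequence.
have mexp n j : measurable_fun setT (fun x : j.-tuple T =>
    expR (mu * pair_sum (g_ (u n)) j (nth x0 x))).
  exact: (measurable_expR_pair_sum (gaussX (u0 n)) (mX (u0 n)) x0 mu0).
have cvgE j : mu <= exp_rate c j -> (fun n => \int[power_measure nu j]_x
    (expR (mu * pair_sum (g_ (u n)) j (nth x0 x)))%:E)%E @ \oo -->
    (\int[power_measure nu j]_x (expR (mu * pair_sum g' j (nth x0 x)))%:E)%E.
  move=> muj; apply: (cvg_exp_pair_sum mg mG _ _ uG c0 weighted_expG) => //.
  - by move=> n a b; exact: process_covarianceC (gaussX (u0 n)) a b.
  - exact: ae_regularizing_cvg.
have fin j : mu <= exp_rate c j -> (\int[power_measure nu j]_x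
    (expR (mu * pair_sum g' j (nth x0 x)))%:E)%E \is a fin_num.
  move=> muj; apply: integrable_fin_num => //.
  apply: (integrable_le_exp (C := 1)
    (w := fun x => expR (mu * pair_sum g' j (nth x0 x))) (x0 := x0) (l := j) c0
    (measurable_max0 mG) (regular_version_le g G)
    (expR_max0_lty mG weighted_expG)).
    apply: measurableT_comp => //; apply: measurable_funM => //.
    by apply: measurable_pair_sum; exact: measurable_regular_version.
  move=> x; rewrite mul1r ger0_norm ?expR_ge0// ler_expR.
  have h := le_pair_sum (G := fun p => Num.max (G p) 0) (regular_version_le g G) j (nth x0 x).
  apply: le_trans (ler_wpM2r _ muj); last exact: le_trans h.
  by rewrite ler_wpM2l// (le_trans (ler_norm _)).
rewrite -(fineK (fin l mul)).
pose Z_ n := phi_mass P m D phi (X (u n)) mu.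
have momZ n j : (\int[P]_w (Z_ n w ^+ j)%:E = \int[power_measure nu j]_x
    (expR (mu * pair_sum (g_ (u n)) j (nth x0 x)))%:E)%E.
  exact: (phi_mass_moment mD phi0 intphi (gaussX (u0 n)) (mX (u0 n)) j x0 mu0).
(* Convergent moments of order [l.+1] are eventually below their limit plus [1]. *)
pose C := fine (\int[power_measure nu l.+1]_x
  (expR (mu * pair_sum g' l.+1 (nth x0 x)))%:E)%E + 1.
apply: (@law_limit_moment _ _ _ _ Z_ Z _ _ _ l _ _ C).
- by move=> n; exact: (measurable_phi_mass mD phi0 intphi (gaussX (u0 n)) (mX (u0 n))).
- by move=> n w; exact: (phi_mass_ge0 mD phi0 intphi (gaussX (u0 n)) (mX (u0 n))).
- move=> f cf bf; exact: (cvg_comp _ _ cvgu (cvgZ f cf bf)).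
- by move=> n; exact: momZ.
- have := cvgE _ mulS; rewrite -(fineK (fin _ mulS)) => cv.
  under eq_near do rewrite momZ.
  apply: (cv (fun y => (y <= C%:E)%E)).
  apply: filterS (open_ereal_lt' (y := C%:E) _) => [y /ltW//|].
  by rewrite lte_fin ltrDl.
- by rewrite fineK ?fin//; exact: cvgE.
Qed.

Let rvle := regular_version_le g G.
Let mg' := measurable_regular_version mg mG.

Lemma S_momentE l mu : S_moment m D phi g x0 l mu = exp_moment nu x0 g' l 0 mu.
Proof.
have mex (f : T -> T -> R) : measurable_fun setT (fun p : T * T => f p.1 p.2) ->
    measurable_fun setT (fun x : l.-tuple T => expR (mu * pair_sum f l (nth x0 x))).
  move=> mf; apply: measurableT_comp => //; apply: measurable_funM => //.
  exact: measurable_pair_sum.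
transitivity (\int[power_measure nu l]_x expR (mu * pair_sum g l (nth x0 x))).
  congr fine; rewrite -[RHS](integral_weighted mD phi0 intphi (mex _ mg)).
  apply: eq_integral => x _; congr EFin; congr (_ * _).
  by apply: eq_bigr => i _; rewrite (tnth_nth x0).
under [RHS]eq_Rintegral do rewrite expr0 mul1r.
apply: ae_eq_Rintegral; [exact: mex|exact: mex|].
have := ae_power_nth x0 l weighted_ae_regular; apply: filterS => x h.
by rewrite (eq_pair_sum h).
Qed.

Let h_coef_weighted n k (x : k.-tuple T) : h_coef phi g n.+1 k (nth x0 x) =
  (\prod_(i < k) phi (tnth x i)) * h_coef0 g n.+1 k (nth x0 x).
Proof.
by rewrite h_coefE; congr (_ * _); apply: eq_bigr => i _; rewrite (tnth_nth x0).
Qed.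

Let ae_h_coef0 n k : {ae power_measure nu k, forall x : k.-tuple T,
  h_coef0 g' n k (nth x0 x) = h_coef0 g n k (nth x0 x)}.
Proof.
have := ae_power_nth x0 k weighted_ae_regular; apply: filterS => x h.
by rewrite (eq_h_coef0 _ h).
Qed.

(** At order [0] the conventions differ: [h_coef] is [0] while [h_coef0] is the indicator of
    [k = 0]. *)
Lemma H_coefE n k : H_coef m D phi g x0 n.+1 k = h_integral nu x0 g' n.+1 k.
Proof.
transitivity (\int[power_measure nu k]_x h_coef0 g n.+1 k (nth x0 x)).
  congr fine.
  rewrite -[RHS](integral_weighted mD phi0 intphi (@measurable_h_coef0 _ _ _ x0 g n.+1 k k mg)).
  by apply: eq_integral => x _; rewrite h_coef_weighted.
apply: ae_eq_Rintegral; [exact: measurable_h_coef0|exact: measurable_h_coef0|].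
exact: ae_h_coef0.
Qed.

Lemma integrable_h_coef n k : (power_measure m k).-integrable (set_power D k)
  (fun x => (h_coef phi g n k (nth x0 x))%:E).
Proof.
case: n => [|n]; first exact: integrable0.
rewrite (_ : (fun _ => _) = (fun x : k.-tuple T =>
    ((\prod_(i < k) phi (tnth x i)) * h_coef0 g n.+1 k (nth x0 x))%:E)); last first.
  by apply/funext => x; rewrite h_coef_weighted.
apply: integrable_weighted.
apply: (ae_eq_integrable (h := fun x : k.-tuple T => h_coef0 g' n.+1 k (nth x0 x))).
- exact: measurable_h_coef0.
- exact: measurable_h_coef0.
- exact: ae_h_coef0.
- exact: (integrable_h_coef0 x0 c0 mg' (measurable_max0 mG) rvle
    (expR_max0_lty mG weighted_expG)).
Qed.

Lemma integrable_moment_integrand l mu : `|mu| <= exp_rate c l / 2 ->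
  (power_measure m l).-integrable (set_power D l)
    (fun x => (moment_integrand phi g l mu (nth x0 x))%:E).
Proof.
move=> mur.
rewrite (_ : (fun _ => _) = (fun x : l.-tuple T =>
    ((\prod_(i < l) phi (tnth x i)) * expR (mu * pair_sum g l (nth x0 x)))%:E)); last first.
  apply/funext => x; congr (_ * _)%:E.
  by apply: eq_bigr => i _; rewrite (tnth_nth x0).
have mex (f : T -> T -> R) : measurable_fun setT (fun p : T * T => f p.1 p.2) ->
    measurable_fun setT (fun x : l.-tuple T => expR (mu * pair_sum f l (nth x0 x))).
  move=> mf; apply: measurableT_comp => //; apply: measurable_funM => //.
  exact: measurable_pair_sum.
apply: integrable_weighted.
apply: (ae_eq_integrable (h := fun x : l.-tuple T => expR (mu * pair_sum g' l (nth x0 x)))).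
- exact: mex.
- exact: mex.
- have := ae_power_nth x0 l weighted_ae_regular; apply: filterS => x h.
  by rewrite (eq_pair_sum h).
- have := integrable_pair_sum_expR x0 c0 mg' (measurable_max0 mG) rvle
    (expR_max0_lty mG weighted_expG) 0 mur.
  by apply: eq_integrable => // x _ /=; rewrite mul1r.
Qed.

End chaos_limit.

(** * From moments to the expansion *)

Section tail_bounds.
Variable R : realType.
Implicit Types (mu y q a w z : R).

(* Either y <= mu ^- M or (mu ^+ M * y) `^ (q - 1) >= 1. *)
Lemma le_powR_split mu y q N M : 0 < mu <= 1 -> 0 <= y -> 1 < q ->
  N%:R <= M%:R * (q - 1) -> y <= mu ^- M + mu ^+ N * y `^ q.
Proof.
move=> /andP[mu0 mu1] y0 q1 NM; have q10 : 0 <= q - 1 by rewrite subr_ge0 ltW.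
have [yM|My] := leP y (mu ^- M).
  by rewrite (le_trans yM)// lerDl mulr_ge0 ?exprn_ge0 ?powR_ge0// ltW.
have y1 : 1 <= mu ^+ M * y.
  by rewrite mulrC -ler_pdivrMr ?exprn_gt0// mul1r ltW.
apply: (@le_trans _ _ (mu ^+ N * y `^ q)); last first.
  by rewrite lerDr invr_ge0 exprn_ge0// ltW.
rewrite -(mulr_powRB1 y0 (lt_trans ltr01 q1)) mulrCA ler_peMr//.
apply: (@le_trans _ _ ((mu ^+ M * y) `^ (q - 1))).
  have := ge0_ler_powR q10 _ _ y1; rewrite powR1; apply; rewrite nnegrE//.
  by rewrite (le_trans ler01).
rewrite powRM ?exprn_ge0 ?(ltW mu0)//.
rewrite -(powR_mulrn M (ltW mu0)) -powRrM -(powR_mulrn N (ltW mu0)).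
by rewrite ler_wpM2r ?powR_ge0// ger_powR// mu0.
Qed.

(** At distance at least [r], a power [j < N] is at most the [N]-th power divided by [r^(N-j)]. *)
Lemma taylor_sum_tail F a N r : 0 < r -> exists2 C, 0 <= C &
  forall x, r <= `|x - a| -> `|taylor_sum F a N x| <= C * `|x - a| ^+ N.
Proof.
move=> r0; pose C := \sum_(j < N) `|derive1n j F a / j`!%:R| / r ^+ (N - j).
exists C; first by apply: sumr_ge0 => j _; rewrite divr_ge0// exprn_ge0// ltW.
move=> x rx; apply: le_trans (ler_norm_sum _ _ _) _; rewrite mulr_suml.
apply: ler_sum => j _; rewrite normrM normrX -mulrA ler_wpM2l//.
have -> : `|x - a| ^+ N = `|x - a| ^+ (N - j) * `|x - a| ^+ j.
  by rewrite -exprD subnK// ltnW.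
rewrite mulrA ler_peMl ?exprn_ge0//.
rewrite mulrC ler_pdivlMr ?exprn_gt0// mul1r lerXn2r ?nnegrE ?(ltW r0)//.
Qed.

(** Within [a / 2] of [a] the positive part equals [z], and [F] is smooth there. Farther away [F z]
    is left as it is, and the minimum, which equals [1] there, replaces the indicator of the far
    region by a quantity that centered moments control. *)
Lemma taylor_positive_part F a J : 0 < a ->
  (forall (n : nat) x, 0 < x -> derivable (derive1n n F) x 1) ->
  exists2 C, 0 <= C & forall z p, `|F z - taylor_sum F a J (Num.max z 0)| <=
    C * `|Num.max z 0 - a| ^+ J +
    `|F z| * Num.min 1 ((`|Num.max z 0 - a| / (a / 2)) ^+ p).
Proof.
move=> a0 dF; have r0 : 0 < a / 2 by rewrite divr_gt0.
have [|C1 C10 tl] := @taylor_local R F a J (a / 2) r0.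
  move=> n y; rewrite ler_norml => /andP[h _]; apply: dF; lra.
have [C2 C20 tt] := taylor_sum_tail F a J r0.
exists (C1 + C2); first exact: addr_ge0.
move=> z p; set w := Num.max z 0; have [wr|rw] := leP `|w - a| (a / 2).
  have zw : w = z.
    apply/max_idPl; have [//|z0] := leP 0 z.
    by move: wr; rewrite /w (max_idPr (ltW z0)) sub0r normrN gtr0_norm//; lra.
  rewrite -[z in F z]zw -[leLHS]addr0 lerD//.
    by rewrite mulrDl (le_trans (tl _ wr))// lerDl mulr_ge0// exprn_ge0.
  by rewrite mulr_ge0// le_min ler01 exprn_ge0// divr_ge0// ltW.
have -> : Num.min 1 ((`|w - a| / (a / 2)) ^+ p) = 1.
  by apply/min_idPl; rewrite exprn_ege1// ler_pdivlMr// mul1r ltW.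
rewrite mulr1 [leRHS]addrC; apply: le_trans (ler_normB _ _) _; rewrite lerD2l.
by rewrite mulrDl (le_trans (tt _ (ltW rw)))// lerDr mulr_ge0// exprn_ge0.
Qed.

End tail_bounds.

(** * Orders of magnitude at zero intermittency *)

Section order_of_magnitude.
Variable R : realType.

(** Landau's [O(mu^N)] as [mu] tends to [0] from the right. *)
Definition small_order N (f : R -> R) :=
  exists2 C, 0 <= C & \forall mu \near (0 : R)^'+, `|f mu| <= C * mu ^+ N.

Lemma small_orderD N f h : small_order N f -> small_order N h ->
  small_order N (fun mu => f mu + h mu).
Proof.
move=> [C C0 fC] [C' C'0 hC']; exists (C + C'); first exact: addr_ge0.
apply: filterS2 fC hC' => mu h1 h2.
by rewrite mulrDl (le_trans (ler_normD _ _))// lerD.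
Qed.

Lemma small_orderZ N c f : small_order N f -> small_order N (fun mu => c * f mu).
Proof.
move=> [C C0 fC]; exists (`|c| * C); first exact: mulr_ge0.
by apply: filterS fC => mu h; rewrite normrM -mulrA ler_wpM2l.
Qed.

Lemma small_order_sum N (I : Type) (s : seq I) (f : I -> R -> R) :
  (forall i, small_order N (f i)) ->
  small_order N (fun mu => \sum_(i <- s) f i mu).
Proof.
move=> sf; elim: s => [|i s IH].
  by exists 0 => //; apply: nearW => mu; rewrite big_nil normr0 mul0r.
under eq_fun do rewrite big_cons; exact: small_orderD.
Qed.

Lemma small_order_le N f h : (\forall mu \near (0 : R)^'+, `|f mu| <= h mu) ->
  small_order N h -> small_order N f.
Proof.
move=> fh [C C0 hC]; exists C => //; apply: filterS2 fh hC => mu h1 h2.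
exact: le_trans h1 (le_trans (ler_norm _) h2).
Qed.

Lemma small_orderXn N M f : small_order (N + M) f ->
  small_order N (fun mu => mu ^- M * f mu).
Proof.
move=> [C C0 fC]; exists C => //; near=> mu.
have mu0 : 0 < mu by near: mu; exact: nbhs_right_gt.
rewrite normrM normfV normrX gtr0_norm// mulrC ler_pdivrMr ?exprn_gt0//.
by rewrite -mulrA -exprD; near: mu.
Unshelve. all: by end_near. Qed.

Lemma small_orderE N M f c : (N <= M)%N -> (\forall mu \near (0 : R)^'+, f mu = c * mu ^+ M) ->
  small_order N f.
Proof.
move=> NM fE; exists `|c| => //; near=> mu.
have mu0 : 0 < mu by near: mu; exact: nbhs_right_gt.
have mu1 : mu <= 1 by near: mu; exact: nbhs_right_le.
have -> : f mu = c * mu ^+ M by near: mu.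
rewrite normrM ler_wpM2l// gtr0_norm ?exprn_gt0//.
exact: ler_wiXn2l (ltW mu0) mu1 _ _ NM.
Unshelve. all: by end_near. Qed.

Lemma formal_expansion_small_order (v : R -> R) (a : nat -> R) :
  (forall N, small_order N.+1 (fun mu => v mu - \sum_(n < N.+1) a n * mu ^+ n)) ->
  formal_expansion v a.
Proof.
move=> h N; have [C C0 hC] := h N.
apply/cvgr0Pnorm_lt => e e0; near=> mu.
have mu0 : 0 < mu by near: mu; exact: nbhs_right_gt.
have mue : mu < e / (C + 1) by near: mu; apply: nbhs_right_lt; rewrite divr_gt0// ltr_wpDl.
rewrite normrM normfV [X in _ / X]gtr0_norm ?exprn_gt0//.
have hm : `|v mu - \sum_(n < N.+1) a n * mu ^+ n| <= C * mu ^+ N.+1 by near: mu.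
rewrite ltr_pdivrMr ?exprn_gt0//; apply: le_lt_trans hm _.
rewrite exprS mulrA ltr_pM2r ?exprn_gt0//.
move: mue; rewrite ltr_pdivlMr ?ltr_wpDl//; apply: le_lt_trans.
by rewrite mulrDr mulr1 mulrC lerDl ltW.
Unshelve. all: by end_near. Qed.

End order_of_magnitude.
Section moment_expansion.
Context dO (Omega : measurableType dO) (R : realType) (P : probability Omega R).
Variables (F : R -> R) (a q B : R) (Z : R -> {RV P >-> R}).
Variables (m H : nat -> nat -> R) (Mo : nat -> R -> R).
Hypotheses (a0 : 0 < a) (q1 : 1 < q) (mF : measurable_fun setT F)
  (dF : forall (n : nat) x, 0 < x -> derivable (derive1n n F) x 1)
  (FB : \forall mu \near (0 : R)^'+,
     ('E_P[fun w => (`|F (Z mu w)| `^ q)%R] <= B%:E)%E).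
Hypotheses (momZ : forall L, \forall mu \near (0 : R)^'+, forall l, (l <= L)%N ->
     (\int[P]_w (Num.max (Z mu w) 0 ^+ l)%:E = (Mo l mu)%:E)%E)
  (momT : forall l N, small_order N
     (fun mu => Mo l mu - \sum_(n < N) m l n / n`!%:R * mu ^+ n))
  (momI : forall n k, \sum_(l < k.+1) 'C(k, l)%:R * (- a) ^+ (k - l) * m l n =
     if (k < n.*2.+1)%N then k`!%:R * H n k else 0).

Let W mu w := Num.max (Z mu w) 0.
(** The centered moment of order [j], written through the raw moments so that their asymptotics can
    be inserted. *)
Let c j mu := \sum_(l < j.+1) 'C(j, l)%:R * (- a) ^+ (j - l) * Mo l mu.

Let c_expansion j N : small_order N
  (fun mu => c j mu - \sum_(n < N) (if (j < n.*2.+1)%N then j`!%:R * H n j else 0)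
    / n`!%:R * mu ^+ n).
Proof.
have h : small_order N (fun mu => \sum_(l < j.+1) 'C(j, l)%:R * (- a) ^+ (j - l) *
    (Mo l mu - \sum_(n < N) m l n / n`!%:R * mu ^+ n)).
  by apply: small_order_sum => l; exact: small_orderZ.
congr (small_order _ _): h; apply/funext => mu.
under eq_bigr do rewrite mulrBr; rewrite sumrB; congr (_ - _).
under eq_bigr do rewrite mulr_sumr; rewrite exchange_big; apply: eq_bigr => n _.
by rewrite -momI !mulr_suml; apply: eq_bigr => l _; rewrite !mulrA.
Qed.

Let measurable_W mu : measurable_fun setT (W mu).
Proof. exact: measurable_maxr. Qed.

Let integrable_WX L : \forall mu \near (0 : R)^'+, forall l, (l <= L)%N ->
  P.-integrable setT (EFin \o (fun w => W mu w ^+ l)).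
Proof.
have := momZ L; apply: filterS => mu h l lL; apply/integrableP; split.
  by apply: measurable_funEFin; exact: measurable_funX.
under eq_integral => w _.
  rewrite gee0_abs; last by rewrite lee_fin exprn_ge0// le_max lexx orbT.
  over.
by rewrite h// ltry.
Qed.

Let centered_moment L : \forall mu \near (0 : R)^'+, forall j, (j <= L)%N ->
  P.-integrable setT (EFin \o (fun w => (W mu w - a) ^+ j)) /\
  \int[P]_w ((W mu w - a) ^+ j) = c j mu.
Proof.
apply: filterS2 (momZ L) (integrable_WX L) => mu h i j jL.
pose f l w := 'C(j, l)%:R * (- a) ^+ (j - l) * W mu w ^+ l.
have e w : (W mu w - a) ^+ j = \sum_(l < j.+1) f l w.
  rewrite addrC exprDn; apply: eq_bigr => l _.
  by rewrite /f -mulr_natl mulrA.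
have fi (l : 'I_j.+1) : P.-integrable setT (EFin \o f l).
  by apply: integrableZ_real; apply: i; rewrite (leq_trans _ jL)// -ltnS.
split.
  rewrite (_ : (fun w => _) = (fun w => \sum_(l < j.+1) f l w)); last first.
    by apply/funext => w; rewrite e.
  exact: integrable_sum_real.
under eq_Rintegral do rewrite e.
rewrite Rintegral_sum//; apply: eq_bigr => l _.
have lL : (l <= L)%N by rewrite (leq_trans _ jL)// -ltnS.
rewrite /f RintegralZl//; last exact: i.
by congr (_ * _); rewrite /Rintegral h.
Qed.

Let small_c j K : (K.*2 <= j)%N -> small_order K (c j).
Proof.
move=> Kj; congr (small_order _ _): (c_expansion j K); apply/funext => mu.
rewrite big1 ?subr0// => n _; rewrite ltnNge (leq_trans _ Kj) ?mul0r//.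
by rewrite ltn_double.
Qed.

Let integrable_F : \forall mu \near (0 : R)^'+,
  P.-integrable setT (EFin \o (fun w => `|F (Z mu w)| `^ q)) /\
  P.-integrable setT (EFin \o (F \o Z mu)).
Proof.
apply: filterS FB => mu; rewrite expectation.unlock => fb.
have mFZ : measurable_fun setT (F \o Z mu) by exact: measurableT_comp.
have iq : P.-integrable setT (EFin \o (fun w => `|F (Z mu w)| `^ q)).
  apply/integrableP; split.
    apply: measurable_funEFin; apply: (measurableT_comp (f := fun x : R => x `^ q)).
      exact: measurable_powR.
    exact: measurableT_comp.
  under eq_integral => w _ do rewrite gee0_abs ?lee_fin ?powR_ge0//.
  exact: le_lt_trans fb (ltry _).
split => //; apply: (@le_integrable_real _ _ _ _ _ (fun w => 1 + `|F (Z mu w)| `^ q)) => //.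
  (* At [mu = 1] and with both exponents [0], the splitting reads [|F| <= 1 + |F|^q]. *)
  move=> w; have := @le_powR_split _ 1 `|F (Z mu w)| q 0 0.
  by rewrite !expr0 invr1 mul1r mul0r; apply; rewrite ?ltr01 ?lexx.
by apply: integrableD_real => //; exact: finite_measure_integrable_cst.
Qed.

Let remainder J S K p C : 0 <= C ->
  (forall z p, `|F z - taylor_sum F a J (Num.max z 0)| <=
    C * `|Num.max z 0 - a| ^+ J +
    `|F z| * Num.min 1 ((`|Num.max z 0 - a| / (a / 2)) ^+ p)) ->
  S%:R <= K%:R * (q - 1) -> ~~ odd J -> ~~ odd p ->
  \forall mu \near (0 : R)^'+,
    `|fine ('E_P[F \o Z mu])%E - \sum_(j < J) derive1n j F a / j`!%:R * c j mu| <=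
    C * c J mu + ((a / 2) ^- p * (mu ^- K * c p mu) + B * mu ^+ S).
Proof.
move=> C0 FC SK oJ op; near=> mu.
have mu0 : 0 < mu by near: mu; exact: nbhs_right_gt.
have mu1 : mu <= 1 by near: mu; exact: nbhs_right_le.
have mu01 : 0 < mu <= 1 by rewrite mu0.
have cm : forall j, (j <= J + p)%N ->
    P.-integrable setT (EFin \o (fun w => (W mu w - a) ^+ j)) /\
    \int[P]_w ((W mu w - a) ^+ j) = c j mu.
  by near: mu; exact: centered_moment.
have [iq iF] : P.-integrable setT (EFin \o (fun w => `|F (Z mu w)| `^ q)) /\
  P.-integrable setT (EFin \o (F \o Z mu)) by near: mu; exact: integrable_F.
have fb : ('E_P[fun w => (`|F (Z mu w)| `^ q)%R] <= B%:E)%E by near: mu.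
have evn (x : R) n : ~~ odd n -> `|x| ^+ n = x ^+ n.
  by move=> on; rewrite -normrX ger0_norm// exprn_even_ge0.
pose b w := C * (W mu w - a) ^+ J + ((a / 2) ^- p * (mu ^- K * (W mu w - a) ^+ p) +
  mu ^+ S * `|F (Z mu w)| `^ q).
have [iJ eJ] := cm J (leq_addr _ _); have [ip ep] := cm p (leq_addl _ _).
have i1 := integrableZ_real C iJ.
have i2 := integrableZ_real ((a / 2) ^- p) (integrableZ_real (mu ^- K) ip).
have i3 := integrableZ_real (mu ^+ S) iq.
have ib : P.-integrable setT (EFin \o b).
  by apply: integrableD_real => //; exact: integrableD_real.
have it (j : 'I_J) : P.-integrable setT
    (EFin \o (fun w => derive1n j F a / j`!%:R * (W mu w - a) ^+ j)).
  apply: integrableZ_real; apply: (cm j _).1.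
  by rewrite (leq_trans (ltnW (ltn_ord j)))// leq_addr.
have iT : P.-integrable setT (EFin \o (fun w => taylor_sum F a J (W mu w))).
  exact: integrable_sum_real.
have le_b w : `|F (Z mu w) - taylor_sum F a J (W mu w)| <= b w.
  apply: le_trans (FC (Z mu w) p) _; rewrite -/(W mu w) /b !evn// lerD2l.
  set y := `|F _|; set t := _ ^+ p; have y0 : 0 <= y by exact: normr_ge0.
  have t0 : 0 <= t by rewrite exprn_ge0// divr_ge0// ltW// divr_gt0.
  have t0' : 0 <= Num.min 1 t by rewrite le_min ler01.
  (* The minimum is bounded by [t] in the term with [mu^-K] and by [1] in the term with [mu^S]. *)
  apply: le_trans (ler_wpM2r t0' (le_powR_split mu01 y0 q1 SK)) _.
  rewrite mulrDl lerD//.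
    rewrite mulrCA ler_wpM2l ?invr_ge0 ?exprn_ge0 ?(ltW mu0)//.
    have -> : (a / 2) ^- p * (W mu w - a) ^+ p = t.
      by rewrite /t [RHS]exprMn evn// exprVn mulrC.
    by rewrite ge_min lexx orbT.
  by rewrite ler_piMr ?mulr_ge0 ?exprn_ge0 ?powR_ge0 ?(ltW mu0)// ge_min lexx.
have -> : fine ('E_P[F \o Z mu])%E = \int[P]_w F (Z mu w) by rewrite expectation.unlock.
have -> : \sum_(j < J) derive1n j F a / j`!%:R * c j mu = \int[P]_w taylor_sum F a J (W mu w).
  rewrite Rintegral_sum//; apply: eq_bigr => j _.
  have jJ : (j <= J + p)%N by rewrite (leq_trans (ltnW (ltn_ord j)))// leq_addr.
  by have [ij <-] := cm j jJ; rewrite RintegralZl.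
have iFT : P.-integrable setT
    (EFin \o (fun w => F (Z mu w) - taylor_sum F a J (W mu w))).
  rewrite (_ : EFin \o _ = ((EFin \o (F \o Z mu)) \-
    (EFin \o (fun w => taylor_sum F a J (W mu w))))%E); first exact: integrableB.
  by apply/funext => w; rewrite /= EFinB.
rewrite -RintegralB//; apply: le_trans (le_normr_Rintegral measurableT iFT) _.
apply: (@le_trans _ _ (\int[P]_w b w)).
  apply: le_Rintegral => //; exact: integrable_norm.
rewrite /b RintegralD//; last exact: integrableD_real.
rewrite RintegralD// !RintegralZl//; last exact: integrableZ_real.
rewrite eJ ep !lerD2l [B * _]mulrC ler_wpM2l ?exprn_ge0 ?(ltW mu0)//.
move: fb; rewrite expectation.unlock -[X in (X <= _)%E]fineK ?lee_fin//.
exact: integrable_fin_num.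
Unshelve. all: by end_near. Qed.

Hypotheses (H0 : forall k, H 0%N k = (k == 0%N)%:R)
  (H1 : forall n k, (k < 2)%N -> H n.+1 k = 0).

(** The factorial in the centered moment cancels that of Taylor's formula. Terms with [j > 2n]
    vanish, and so do [j = 0, 1] when [n > 0]; at [n = 0] only [j = 0] is left. *)
Let taylor_coefficient n J : (n.*2 < J)%N ->
  \sum_(j < J) derive1n j F a / j`!%:R *
    ((if (j < n.*2.+1)%N then j`!%:R * H n j else 0) / n`!%:R) =
  if n == 0%N then F a else
    n`!%:R^-1 * \sum_(2 <= k < n.*2.+1) derive1n k F a * H n k.
Proof.
move=> nJ; pose f j := n`!%:R^-1 * (if (j < n.*2.+1)%N then derive1n j F a * H n j else 0).
transitivity (\sum_(0 <= j < J) f j).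
  rewrite big_mkord; apply: eq_bigr => j _; rewrite /f; case: ifP => _; last first.
    by rewrite mul0r !mulr0.
  have jn0 : j`!%:R != 0 :> R by rewrite pnatr_eq0 -lt0n fact_gt0.
  have nn0 : n`!%:R != 0 :> R by rewrite pnatr_eq0 -lt0n fact_gt0.
  by field; rewrite jn0 nn0.
rewrite (big_cat_nat (n := n.*2.+1))//= [X in _ + X](_ : _ = 0) ?addr0; last first.
  rewrite big_nat_cond big1// => j /andP[/andP[nj _] _].
  by rewrite /f ltnNge nj mulr0.
transitivity (n`!%:R^-1 * \sum_(0 <= j < n.*2.+1) derive1n j F a * H n j).
  by rewrite mulr_sumr; apply: eq_big_nat => j /andP[_ jn]; rewrite /f jn.
case: n {nJ f} => [|n] /=.
  by rewrite big_nat1 H0 invr1 mul1r mulr1.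
by rewrite big_ltn// big_ltn// !H1// !mulr0 !add0r.
Qed.

Lemma moment_expansion :
  formal_expansion (fun mu => fine ('E_P[F \o Z mu])%E)
    (fun n => if n == 0%N then F a else
       n`!%:R^-1 * \sum_(2 <= k < n.*2.+1) derive1n k F a * H n k).
Proof.
apply: formal_expansion_small_order => N.
(* [J] makes the centered moment of order [J] of size [mu^(N+1)], [K] is large enough for the
   splitting of [|F|], and [p] adds [2K] so that [mu^-K] times the centered moment of order [p] is
   still [O(mu^(N+1))]. *)
pose J := N.+1.*2; pose K := (Num.truncn (N.+1%:R / (q - 1))).+1.
pose p := (N.+1 + K).*2.
have SK : N.+1%:R <= K%:R * (q - 1).
  by rewrite -ler_pdivrMr ?subr_gt0// ltW// truncnS_gt.
have [C C0 FC] := taylor_positive_part J a0 dF.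
have small1 : small_order N.+1 (fun mu => fine ('E_P[F \o Z mu])%E -
    \sum_(j < J) derive1n j F a / j`!%:R * c j mu).
  apply: small_order_le (remainder (p := p) C0 FC SK _ _) _; rewrite ?odd_double//.
  apply: small_orderD; first by apply: small_orderZ; exact: small_c.
  apply: small_orderD; last by apply: (@small_orderE _ _ N.+1 _ B) => //; exact: nearW.
  by apply: small_orderZ; apply: small_orderXn; exact: small_c.
have small2 : small_order N.+1 (fun mu => \sum_(j < J) derive1n j F a / j`!%:R *
    (c j mu - \sum_(n < N.+1) (if (j < n.*2.+1)%N then j`!%:R * H n j else 0)
      / n`!%:R * mu ^+ n)).
  by apply: small_order_sum => j; apply: small_orderZ; exact: c_expansion.
congr (small_order _ _): (small_orderD small1 small2); apply/funext => mu.
rewrite -addrA; congr (_ + _).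
under [X in _ + X]eq_bigr do rewrite mulrBr.
rewrite sumrB addrA addNr add0r; congr (- _).
under eq_bigr do rewrite mulr_sumr; rewrite exchange_big; apply: eq_bigr => n _.
rewrite -(@taylor_coefficient n J) ?ltn_double// mulr_suml.
by apply: eq_bigr => j _; rewrite -!mulrA.
Qed.

End moment_expansion.

(** * Measurability of compact regions *)

Section compact_region_measurable.
Variables (R : realType) (d : nat).

Let row (x : Rvec R d) : 'rV[R]_d := \row_i tnth x i.

Let rat_box (s : d.-tuple rat * nat) : set (Rvec R d) :=
  box (fun i => ball (ratr (tnth s.1 i) : R) s.2.+1%:R^-1).

(** Bridges the topology of row vectors and the product sigma-algebra of tuples: an open set is a
    countable union of boxes with rational centers. *)
Lemma measurable_row_open (U : set 'rV[R]_d) : open U ->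
  measurable [set x : Rvec R d | U (\row_i tnth x i)].
Proof.
move=> oU.
(* A box that does not fit into [U] is replaced by the empty set, so the union runs over a whole
   countable type. *)
pose F s := if `[< rat_box s `<=` [set x | U (row x)] >] then rat_box s else set0.
rewrite (_ : [set x | _] = \bigcup_s F s); last first.
  apply/seteqP; split => [x Ux|x [s _]]; last first.
    by rewrite /F; case: ifPn => // /asboolP h; exact: h.
  have /nbhs_ballP[e /= e0 eU] : nbhs (row x) U by exact: open_nbhs_nbhs.
  (* Two points of one box of radius [1/(n+1)] differ by less than [2/(n+1)] in each coordinate,
     hence by less than [e]. *)
  pose n := Num.truncn (2 / e).
  have ne : 2 * n.+1%:R^-1 < e.
    by rewrite ltr_pdivrMr ?ltr0n// mulrC -ltr_pdivrMr// truncnS_gt.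
  have n0 : 0 < n.+1%:R^-1 :> R by rewrite invr_gt0.
  have /choice[q qx] : forall i : 'I_d, exists q : rat,
      ball (ratr q : R) n.+1%:R^-1 (tnth x i).
    move=> i; have := @rat_in_itvoo R (tnth x i) (tnth x i + n.+1%:R^-1).
    rewrite ltrDl => /(_ n0)[q]; rewrite in_itv/= => /andP[h1 h2]; exists q.
    by rewrite /ball/= ger0_norm ?subr_ge0 ?ltrBlDl// ltW.
  exists ([tuple q i | i < d], n) => //; rewrite /F ifT.
    by move=> i; rewrite tnth_mktuple; exact: qx.
  apply/asboolP => y hy /=; apply: eU; split => // i j; rewrite !mxE.
  have := qx j; have := hy j; rewrite tnth_mktuple /ball/= => h1 h2.
  rewrite (le_lt_trans _ ne)// (le_trans (ler_distD (ratr (q j)) _ _))//.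
  by rewrite [`|_ - ratr _|]distrC mulr_natl mulr2n lerD// ltW.
apply: countable_bigcupT_measurable; first exact: countableP.
move=> s; rewrite /F; case: ifP => _ //; apply: measurable_box => i.
exact: measurable_ball.
Qed.

Lemma measurable_compact_region (D : set (Rvec R d)) :
  compact_region D -> measurable D.
Proof.
move=> cD; pose S := [set row x | x in D].
have cS : closed S by apply: compact_closed => //; exact: norm_hausdorff.
rewrite -[D]setCK; apply: measurableC.
rewrite (_ : ~` D = [set x | (~` S) (row x)]).
  by apply: measurable_row_open; exact: closed_openC.
apply/seteqP; split => [x nD [y Dy yx]|x nS Dx]; last by apply: nS; exists x.
apply: nD; rewrite (_ : x = y)//; apply: eq_from_tnth => i.
by move/rowP: yx => /(_ i); rewrite !mxE.
Qed.

End compact_region_measurable.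

(** * The intermittency expansion *)

Section h_integral_values.
Context d (T : measurableType d) (R : realType) (nu : {finite_measure set T -> \bar R}).
Variables (x0 : T) (g : T -> T -> R).

Lemma h_integral0 k : h_integral nu x0 g 0 k = (k == 0%N)%:R.
Proof.
rewrite /h_integral /Rintegral (eq_integral (cst (k == 0%N)%:R%:E))// integral_cst//.
case: k => [|k] /=; last by rewrite mul0e.
by rewrite indicT mulr1.
Qed.

Lemma h_integral_small n k : (k < 2)%N -> h_integral nu x0 g n.+1 k = 0.
Proof.
move=> k2; rewrite /h_integral; under eq_Rintegral => x _.
  rewrite [h_coef0 _ _ _ _]h_coef_supp ?negb_and -?ltnNge ?k2//; over.
by rewrite /Rintegral integral0.
Qed.

Lemma h_integral_null n k : nu setT = 0%E ->
  measurable_fun setT (fun p : T * T => g p.1 p.2) -> h_integral nu x0 g n.+1 k = 0.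
Proof.
move=> nu0 mg; have [k2|k2] := ltnP k 2; first exact: h_integral_small.
rewrite /h_integral (ae_eq_Rintegral (h := cst 0)).
- by rewrite /Rintegral integral0.
- exact: measurable_h_coef0.
- exact: measurable_cst.
exists setT; split => //; apply: etrans (power_measureT nu k) _.
by rewrite nu0 expr0n; case: (k) k2.
Qed.

(** Fewer than two points form no pair; this is why the binomial transform starts at [l = 2]. *)
Lemma pair_moment_small l n : (l < 2)%N -> pair_moment nu x0 g l n.+1 = 0.
Proof.
move=> l2; rewrite /pair_moment; under eq_Rintegral => x _.
  rewrite (_ : pair_sum g l _ = 0) ?expr0n; first over.
  rewrite /pair_sum big1// => j _; rewrite big1// => -[i ij] _.
  have j0 : (j <= 0)%N by rewrite -ltnS (leq_trans (ltn_ord j)).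
  by have := leq_trans ij j0.
by rewrite /Rintegral integral0.
Qed.

End h_integral_values.

Section chaos_expansion.
Context dO (Omega : measurableType dO) (R : realType) (P : probability Omega R).
Context d (T : measurableType d) (m : {sigma_finite_measure set T -> \bar R}).
Variables (D : set T) (phi : T -> R).
Hypotheses (mD : measurable D) (phi0 : forall x, D x -> 0 <= phi x)
  (intphi : m.-integrable D (EFin \o phi)).
Let nu := weighted_measure mD phi0 intphi.
Variables (X : R -> T -> Omega -> R) (g_ : R -> T -> T -> R) (g : T -> T -> R).
Hypotheses (gaussX : forall eps, 0 < eps -> centered_gaussian_process P (X eps) (g_ eps))
  (mX : forall eps, 0 < eps ->
    measurable_fun setT (fun p : T * Omega => X eps p.1 p.2)).
Variables (c : R) (G : T * T -> R) (x0 : T).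
Hypotheses (mg : measurable_fun setT (fun p : T * T => g p.1 p.2))
  (cvgg : {ae (m \x m)%E, forall p, D p.1 -> D p.2 ->
     (fun eps => g_ eps p.1 p.2) @ (0 : R)^'+ --> g p.1 p.2})
  (c0 : 0 < c) (mG : measurable_fun setT G)
  (leG : \forall eps \near (0 : R)^'+, {ae (m \x m)%E, forall p,
     D p.1 -> D p.2 -> `|g_ eps p.1 p.2| <= G p})
  (expG : (\int[m \x m]_(p in D `*` D)
     (phi p.1 * phi p.2 * expR (c * G p))%:E < +oo)%E).

Let g' := regular_version g G.
Let b := phi_bar m D phi.
Let mg' := measurable_regular_version mg mG.
Let mG' := measurable_max0 mG.
Let symg' := regular_versionC g G.
Let gG' := regular_version_le g G.
Let expG' := expR_max0_lty mG (weighted_expG mD phi0 intphi mG expG).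

Let nuT : nu setT = b%:E.
Proof. exact: weighted_measureT. Qed.

Lemma near_exp_rate l : \forall mu \near (0 : R), `|mu| < exp_rate c l / 2.
Proof.
have r0 : 0 < exp_rate c l / 2 by rewrite divr_gt0// exp_rate_gt0.
apply/nbhs_ballP; exists (exp_rate c l / 2) => // mu.
by rewrite /ball/= sub0r normrN.
Qed.

Lemma near_integrable_moment_integrand l : \forall mu \near (0 : R),
  (power_measure m l).-integrable (set_power D l)
    (fun x => (moment_integrand phi g l mu (nth x0 x))%:E).
Proof.
have := near_exp_rate l; apply: filterS => mu /ltW mur.
exact: (integrable_moment_integrand mD phi0 intphi gaussX x0 mg cvgg c0 mG leG expG mur).
Qed.

Let S_momentF l : S_moment m D phi g x0 l = exp_moment nu x0 g' l 0.
Proof.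
apply/funext => mu.
exact: (S_momentE mD phi0 intphi gaussX x0 mg cvgg mG leG l mu).
Qed.

Lemma near_derivable_S_moment l n :
  \forall mu \near (0 : R), derivable (derive1n n (S_moment m D phi g x0 l)) mu 1.
Proof.
have := near_exp_rate l; apply: filterS => mu mur; rewrite S_momentF.
exact: (near_derive1n_exp_moment x0 c0 mg' mG' gG' expG' n mur).2.
Qed.

Let derive1n_S_moment0 l n :
  derive1n n (S_moment m D phi g x0 l) 0 = pair_moment nu x0 g' l n.
Proof.
have r0 : `|0 : R| < exp_rate c l / 2 by rewrite normr0 divr_gt0// exp_rate_gt0.
by rewrite S_momentF (near_derive1n_exp_moment x0 c0 mg' mG' gG' expG' n r0).1 exp_moment0.
Qed.

Let inversion n k : \sum_(l < k.+1) 'C(k, l)%:R * (- b) ^+ (k - l) * pair_moment nu x0 g' l n =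
  if (k < n.*2.+1)%N then k`!%:R * h_integral nu x0 g' n k else 0.
Proof.
rewrite -(h_integral_inversion x0 c0 mg' mG' symg' gG' expG').
by apply: eq_bigr => l _; rewrite nuT.
Qed.

Let H_coefF n k : H_coef m D phi g x0 n.+1 k = h_integral nu x0 g' n.+1 k.
Proof. exact: (H_coefE mD phi0 intphi gaussX x0 mg cvgg mG leG). Qed.

Lemma H_coef_binomial_transform n k : (0 < n)%N -> (2 <= k <= n.*2)%N ->
  H_coef m D phi g x0 n k = (-1) ^+ k / k`!%:R *
    \sum_(2 <= l < k.+1) (-1) ^+ l * 'C(k, l)%:R * b ^+ (k - l) *
      derive1n n (S_moment m D phi g x0 l) 0.
Proof.
case: n => // n _ /andP[k2 kn]; rewrite H_coefF.
have := inversion n.+1 k; rewrite ltnS kn.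
rewrite -(big_mkord predT (fun l =>
  'C(k, l)%:R * (- b) ^+ (k - l) * pair_moment nu x0 g' l n.+1)).
rewrite (@big_ltn _ _ _ 0)// (@big_ltn _ _ _ 1)//; last by rewrite ltnW.
rewrite (pair_moment_small nu x0 g' n (isT : (0 < 2)%N)) (pair_moment_small nu x0 g' n (isT : (1 < 2)%N)).
rewrite !mulr0 !add0r => h.
have k0 : k`!%:R != 0 :> R by rewrite pnatr_eq0 -lt0n fact_gt0.
apply: (mulfI k0); rewrite -h mulrA [_ * (_ / _)]mulrCA divff// mulr1 mulr_sumr.
apply: eq_big_nat => l /andP[_ lk]; rewrite ltnS in lk.
rewrite derive1n_S_moment0 (exprNn b).
have -> : (-1) ^+ (k - l) = (-1) ^+ k * (-1) ^+ l :> R.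
  by rewrite -[in RHS](subnK lk) exprD -mulrA -exprD addnn -[X in _ * X]signr_odd
    odd_double mulr1.
by ring.
Qed.

(** The degenerate case: [F] need not be differentiable at [0], but the regularized masses are all
    [0], so their limit in law is [0] almost surely. *)
Lemma fine_expectation_null (F : R -> R) mu (Z : {RV P >-> R}) : b = 0 ->
  measurable_fun setT F ->
  cvg_in_law P (fun eps => phi_mass P m D phi (X eps) mu) Z ->
  fine ('E_P[F \o Z])%E = F 0.
Proof.
move=> b0 mF cvgZ.
(* A bounded continuous test function that is nonnegative and vanishes only at [0]. *)
pose f (x : R) := Num.min `|x| 1.
have f0 x : 0 <= f x by rewrite le_min normr_ge0 ler01.
have cf : continuous f.
  move=> x; rewrite /f; under eq_fun do rewrite minr_absE.
  apply: cvgM; last exact: cvg_cst.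
  apply: cvgB; first by apply: cvgD; [exact: norm_continuous|exact: cvg_cst].
  by apply: cvg_norm; apply: cvgB; [exact: norm_continuous|exact: cvg_cst].
have bf : exists M, forall x, `|f x| <= M.
  by exists 1 => x; rewrite ger0_norm// ge_min lexx orbT.
have mf : measurable_fun setT f by exact: continuous_measurable_fun.
have Ef0 : 'E_P[f \o Z]%E = 0%E.
  rewrite -(cvg_lim _ (cvgZ f cf bf))//; apply: lim_near_cst => //.
  near=> eps; have eps0 : 0 < eps by near: eps; exact: nbhs_right_gt.
  rewrite expectation.unlock; apply: integral0_eq => w _ /=.
  rewrite (phi_massE mD phi0 intphi (gaussX eps0) (mX eps0)).
  rewrite (_ : chaos_mass _ _ _ _ _ = 0%E) /f ?normr0 ?(min_idPl ler01)//.
  rewrite /chaos_mass (ae_eq_integral (cst 0%E)) ?integral0//.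
    apply: measurable_funEFin; apply: measurableT_comp => //.
    exact: (measurableT_comp (measurable_omega (gaussX eps0) (mX eps0) mu)
      (pair2_measurable w)).
  by exists setT; split => //; exact: etrans nuT (congr1 EFin b0).
have Z0 : {ae P, forall w, Z w = 0}.
  have mfZ : measurable_fun setT (EFin \o (f \o Z)).
    by apply: measurable_funEFin; exact: measurableT_comp.
  have := (ae_eq_integral_abs P measurableT mfZ).1.
  rewrite expectation.unlock in Ef0.
  under eq_integral do rewrite gee0_abs ?lee_fin ?f0//.
  move=> /(_ Ef0); apply: filterS => w /(_ I) [] /eqP.
  rewrite /f; case: (leP `|Z w| 1) => _; first by rewrite normr_eq0 => /eqP.
  by rewrite oner_eq0.
rewrite expectation.unlock (ae_eq_integral (cst (F 0)%:E)).
- rewrite (integral_cst P measurableT) [X in (_ * X)%E](_ : _ = 1%E) ?mule1//.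
  exact: probability_setT.
- by [].
- by apply: measurable_funEFin; exact: measurableT_comp.
- exact: measurable_cst.
- by apply: filterS Z0 => w /= -> _.
Unshelve. all: by end_near. Qed.

Lemma chaos_expansion (F : R -> R) (q B : R) (mass : R -> {RV P >-> R}) :
  (\forall mu \near (0 : R)^'+,
     cvg_in_law P (fun eps => phi_mass P m D phi (X eps) mu) (mass mu)) ->
  measurable_fun setT F ->
  (forall (n : nat) (x : R), 0 < x -> derivable (derive1n n F) x 1) ->
  1 < q ->
  (\forall mu \near (0 : R)^'+,
     ('E_P[fun w => (`|F (mass mu w)| `^ q)%R] <= B%:E)%E) ->
  formal_expansion
    (fun mu => fine ('E_P[F \o mass mu])%E)
    (fun n => if n == 0%N then F b else
       (n`!%:R)^-1 * \sum_(2 <= k < n.*2.+1) derive1n k F b * H_coef m D phi g x0 n k).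
Proof.
move=> cvgM mF dF q1 FB.
rewrite (_ : (fun n => _) = (fun n => if n == 0%N then F b else
    n`!%:R^-1 * \sum_(2 <= k < n.*2.+1) derive1n k F b * h_integral nu x0 g' n k)); last first.
  by apply/funext => -[//|n] /=; congr (_ * _); apply: eq_bigr => k _; rewrite H_coefF.
have b0 : 0 <= b by apply: Rintegral_ge0.
move: b0; rewrite le_eqVlt => /predU1P[b0|b0].
  (* Here [nu] is null: the expectation is exactly [F 0], and all coefficients with [n > 0]
     vanish. *)
  apply: formal_expansion_small_order => N; exists 0 => //.
  apply: filterS cvgM => mu cv.
  rewrite (fine_expectation_null _ mF cv)// big_ord_recl /= expr0 mulr1 -b0.
  rewrite big1 ?addr0 ?subrr ?normr0 ?mul0r// => i _.
  rewrite big1 ?mulr0 ?mul0r// => k _.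
  by rewrite h_integral_null ?mulr0// nuT -b0.
apply: (moment_expansion (Mo := fun l => exp_moment nu x0 g' l 0)
  (m := pair_moment nu x0 g') b0 q1 mF dF FB) => //.
- move=> L; near=> mu => l lL.
  have mu0 : 0 < mu by near: mu; exact: nbhs_right_gt.
  (* The rate decreases with the order, so one bound at [L.+1] serves every [l <= L] together with
     the next order [l.+1]. *)
  have rate j : (j <= L.+1)%N -> exp_rate c L.+1 / 2 <= exp_rate c j / 2.
    move=> jL; rewrite ler_pM2r ?invr_gt0// ler_pM2l// lef_pV2 ?posrE ?ltr0n ?expn_gt0//.
    by rewrite ler_nat leq_exp2r.
  have mur : mu < exp_rate c L.+1 / 2.
    by near: mu; apply: nbhs_right_lt; rewrite divr_gt0// exp_rate_gt0.
  have muj j : (j <= L.+1)%N -> mu <= exp_rate c j / 2.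
    by move=> /rate; exact: le_trans (ltW mur).
  have mujj j : (j <= L.+1)%N -> mu <= exp_rate c j.
    move=> /muj /le_trans; apply; have := exp_rate_gt0 c0 j; lra.
  have cv : cvg_in_law P (fun eps => phi_mass P m D phi (X eps) mu) (mass mu) by near: mu.
  have lL' : (l <= L.+1)%N by rewrite ltnW.
  rewrite (mass_moment mD phi0 intphi gaussX mX x0 mg cvgg c0 mG leG expG (ltW mu0)
    (mujj l lL') (mujj l.+1 lL) cv).
  have iE := integrable_pair_sum_expR x0 c0 mg' mG' gG' expG' 0 (l := l) (mu := mu).
  rewrite gtr0_norm// in iE; have /integrable_fin_num/fineK := iE (muj l lL').
  move=> /(_ measurableT) e; rewrite [RHS]e; apply: eq_integral => x _.
  by rewrite /= mul1r.
- move=> l N; have [C C0 h] := exp_moment_taylor x0 c0 mg' mG' gG' expG' l N.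
  exists C => //; near=> mu.
  have mu0 : 0 < mu by near: mu; exact: nbhs_right_gt.
  have mur : mu < exp_rate c l / 2.
    by near: mu; apply: nbhs_right_lt; rewrite divr_gt0// exp_rate_gt0.
  by have := h mu; rewrite (gtr0_norm mu0); apply; exact: ltW.
- exact: h_integral0.
- exact: h_integral_small.
Unshelve. all: by end_near. Qed.

End chaos_expansion.

Theorem theorem2 (R : realType) (d : nat)
    (dO : measure_display) (Omega : measurableType dO) (P : probability Omega R)
    (D : set (Rvec R d)) (phi : Rvec R d -> R)
    (X : R -> Rvec R d -> Omega -> R)
    (g_ : R -> Rvec R d -> Rvec R d -> R)
    (g : Rvec R d -> Rvec R d -> R)
    (mass : R -> {RV P >-> R})
    (F : R -> R) (q B : R)
    (x0 := [tuple of nseq d (0 : R)] : Rvec R d)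
    (leb := lebesgue_Rd R d)
    (fbar := phi_bar leb D phi)
    (Hnk := H_coef leb D phi g x0)
    (Sl := S_moment leb D phi g x0) :
  compact_region D ->
  (forall x, D x -> 0 < phi x) ->
  leb.-integrable D (EFin \o phi) ->
  (forall eps, 0 < eps -> centered_gaussian_process P (X eps) (g_ eps)) ->
  (forall eps, 0 < eps ->
     measurable_fun [set: (Rvec R d * Omega)%type] (fun p => X eps p.1 p.2)) ->
  regularizes leb D phi g_ g ->
  (\forall mu \near (0 : R)^'+,
     cvg_in_law P (fun eps => phi_mass P leb D phi (X eps) mu) (mass mu)) ->
  measurable_fun setT F ->
  (forall (n : nat) (x : R), 0 < x -> derivable (derive1n n F) x 1) ->
  1 < q ->
  (\forall mu \near (0 : R)^'+,
     ('E_P[fun w => (`|F (mass mu w)| `^ q)%R] <= B%:E)%E) ->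
  [/\ forall n k : nat,
        (power_measure leb k).-integrable (set_power D k)
          (fun x => (h_coef phi g n k (nth x0 x))%:E),
      formal_expansion
        (fun mu => fine ('E_P[F \o mass mu])%E)
        (fun n => if n == 0%N then F fbar else
           (n`!%:R)^-1 * \sum_(2 <= k < n.*2.+1) derive1n k F fbar * Hnk n k),
      forall l : nat, \forall mu \near (0 : R),
        (power_measure leb l).-integrable (set_power D l)
          (fun x => (moment_integrand phi g l mu (nth x0 x))%:E),
      forall l n : nat, \forall mu \near (0 : R), derivable (derive1n n (Sl l)) mu 1 &
      forall n k : nat, (1 <= n)%N -> (2 <= k <= n.*2)%N ->
        Hnk n k = (-1) ^+ k / k`!%:R *
          \sum_(2 <= l < k.+1)
            (-1) ^+ l * 'C(k, l)%:R * fbar ^+ (k - l) * derive1n n (Sl l) 0].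
Proof.
move=> cD phi_gt0 intphi gaussX mX [mg cvgg [c [G [c0 mG leG expG]]]].
move=> cvgM mF dF q1 FB.
have mD := measurable_compact_region cD.
have phi0 x : D x -> 0 <= phi x by move=> /phi_gt0/ltW.
split.
- exact: (integrable_h_coef mD phi0 intphi gaussX x0 mg cvgg c0 mG leG expG).
- exact: (chaos_expansion mD phi0 intphi gaussX mX x0 mg cvgg c0 mG leG expG
    cvgM mF dF q1 FB).
- exact: (near_integrable_moment_integrand mD phi0 intphi gaussX x0 mg cvgg c0 mG leG expG).
- exact: (near_derivable_S_moment mD phi0 intphi gaussX x0 mg cvgg c0 mG leG expG).
- exact: (H_coef_binomial_transform mD phi0 intphi gaussX x0 mg cvgg c0 mG leG expG).
Qed.
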